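(* Let $\mathbf{k}$ be an algebraically closed field of characteristic $0$, and let $U$ be a $\mathbf{k}$-vector space of dimension $n+1$. Let $R=\operatorname{Sym}(\operatorname{Sym}^d U)$, $A=\bigoplus_{m\ge 0}(\operatorname{Sym}^m U)^{\otimes d}$, $B=A^{\mathfrak{S}_d}$, and $M_\lambda=\operatorname{Hom}_{\mathfrak{S}_d}(V_\lambda,A)$ for $\lambda$ a partition of $d$, all considered as graded $R$-modules. Then the Castelnuovo–Mumford regularity of $A$ as an $R$-module is $$\operatorname{reg}(A)=(d-1)n,$$ and therefore $\operatorname{reg}(M_\lambda)\le (d-1)n$ for all $\lambda$. If $n$ is even then $\operatorname{reg}(B)=\operatorname{reg}(A)$, while for $n$ odd we have $\operatorname{reg}(B)<\operatorname{reg}(A)$.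
   Context: The parameters $d$ and $n$ refer to homogeneous polynomials of degree $d$ in $n+1$ variables. The ring $A=\bigoplus_{m\ge 0}(\operatorname{Sym}^m U)^{\otimes d}$ ($d$ tensor factors) is the homogeneous coordinate ring of the Segre product $(\mathbb{P}^n)^{\times d}$; it is a subring of $\operatorname{Sym}(U)^{\otimes d}$, graded by $m$. The symmetric group $\mathfrak{S}_d$ acts on $A$ by permuting tensor factors. The ring $R=\operatorname{Sym}(\operatorname{Sym}^d U)$ is the coordinate ring of the affine space $\operatorname{Sym}^d(U^* )$, graded with $\operatorname{Sym}^d U$ in degree $1$. In characteristic zero $\operatorname{Sym}^dU$ is identified with the symmetric tensors in $U^{\otimes d}=A_1$, and this inclusion induces a graded ring homomorphism $R\to A$ with image in $B=A^{\mathfrak{S}_d}$, making $A$, $B$ and the $M_\lambda$ finitely generated graded $R$-modules. For a partition $\lambda$ of $d$, $V_\lambda$ is the irreducible $\mathfrak{S}_d$-representation indexed by $\lambda$ ($V_{(d)}$ trivial, $V_{(1^d)}$ sign), and $M_\lambda=\operatorname{Hom}_{\mathfrak{S}_d}(V_\lambda,A)=\bigoplus_{m\ge 0}\mathbf{S}_\lambda(\operatorname{Sym}^m U)$, where $\mathbf{S}_\lambda$ is the Schur functor, graded by $m$; thus $B=M_{(d)}$. For a finitely generated graded $R$-module $M$, $\operatorname{reg}(M)=\max\{r: \operatorname{Tor}_i^R(M,\mathbf{k})_{i+r}\ne 0\text{ for some }i\}$.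
   Formalization: Degree d ≥ 1 is assumed throughout, and the strict inequality reg(B) < reg(A) for n odd is stated only for d ≥ 2, since for d = 1 the group is trivial, A = B = R and both regularities are 0. *)

(* Defs.v *)
From HB Require Import structures.
From mathcomp Require Import all_boot all_order all_algebra all_fingroup.
From mathcomp Require Import mxrepresentation.
(* mpoly has to be imported before constructive_ereal: in the other order their
   notation levels clash. *)
From mathcomp Require Import mpoly.
From mathcomp Require Import boolp constructive_ereal.

Set Implicit Arguments.
Unset Strict Implicit.
Unset Printing Implicit Defensive.

Import Order.TTheory GRing.Theory Num.Theory.
Local Open Scope ring_scope.

Section GradedModules.
Variables (k : fieldType) (N : nat).
Local Notation R := {mpoly k[N]}.

Record gradedModule := GradedModule {
  gm_sort :> lmodType R;
  gm_pc : nat -> {pred gm_sort};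
  gm_pc_zmod : forall t, zmod_closed (gm_pc t);
  gm_pcZ : forall e t (r : R) x,
    r \is e.-homog -> x \in gm_pc t -> r *: x \in gm_pc (e + t);
  gm_span : forall x, exists T (c : nat -> gm_sort),
    (forall t, c t \in gm_pc t) /\ x = \sum_(t < T) c t;
  gm_direct : forall T (c : nat -> gm_sort), (forall t, c t \in gm_pc t) ->
    \sum_(t < T) c t = 0 -> forall t, (t < T)%N -> c t = 0
}.

Arguments gm_pc : clear implicits.

(* v has degree e in the free module \bigoplus_c R(- a c) *)
Definition free_homog b (a : 'I_b -> nat) (e : nat) (v : 'rV[R]_b) : bool :=
  [forall c, if (a c <= e)%N then v 0 c \is (e - a c).-homog else v 0 c == 0].

(* A graded free resolution ... -> F_1 -> F_0 -> M -> 0, where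
   F_i = \bigoplus_c R(- res_deg i c) has rank res_rk i.  Elements of F_i are
   row vectors, and the differentials act by right multiplication. *)
Record resolution (M : gradedModule) := Resolution {
  res_rk : nat -> nat;
  res_deg : forall i, 'I_(res_rk i) -> nat;
  res_gen : 'I_(res_rk 0) -> M;
  res_d : forall i, 'M[R]_(res_rk i.+1, res_rk i);
  res_gen_homog : forall c, res_gen c \in gm_pc M (res_deg c);
  res_d_homog : forall i r,
    free_homog (@res_deg i) (@res_deg i.+1 r) (row r (res_d i));
  res_surj : forall x : M, exists v : 'rV[R]_(res_rk 0),
    x = \sum_c v 0 c *: res_gen c;
  res_exact0 : forall v : 'rV[R]_(res_rk 0),
    \sum_c v 0 c *: res_gen c = 0 <-> exists w, v = w *m res_d 0;
  res_exactS : forall i (v : 'rV[R]_(res_rk i.+1)),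
    v *m res_d i = 0 <-> exists w, v = w *m res_d i.+1
}.

(* The differential of F \otimes_R k, with k = R / R_+ *)
Definition tor_d M (F : resolution M) i : 'M[k]_(res_rk F i.+1, res_rk F i) :=
  map_mx (mcoeff 0%MM) (res_d F i).

Definition tor_cycle M (F : resolution M) i : 'rV[k]_(res_rk F i) -> Prop :=
  match i with
  | 0 => fun _ => True
  | i'.+1 => fun v => v *m tor_d F i' = 0
  end.

(* Tor_i^R(M, k)_j != 0: some cycle of degree j in F_i \otimes_R k is not a
   boundary.  The choice of F is immaterial. *)
Definition tor_neq0 (M : gradedModule) (i j : nat) : Prop :=
  exists (F : resolution M) (v : 'rV[k]_(res_rk F i)),
    [/\ forall c, res_deg c != j -> v 0 c = 0,
        tor_cycle v
      & ~ exists w, v = w *m tor_d F i].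

Definition reg_val (M : gradedModule) (r : int) : Prop :=
  exists i j, tor_neq0 M i j /\ j%:Z = i%:Z + r.

(* The Castelnuovo-Mumford regularity, with max of the empty set = -oo; the
   value is +oo if the maximum is over an unbounded set. *)
Definition reg (M : gradedModule) : \bar int :=
  match pselect (exists r, reg_val M r /\ forall s, reg_val M s -> s <= r) with
  | left H => (projT1 (cid H))%:E
  | right _ => if `[< exists r, reg_val M r >] then +oo%E else -oo%E
  end.

Section Submodule.
Variables (W : lmodType R) (S : {pred W}) (pc : nat -> {pred W}).
Hypothesis S_sub : GRing.submod_closed S.
Hypothesis pcS : forall t x, x \in pc t -> x \in S.
Hypothesis pc_zmod : forall t, zmod_closed (pc t).
Hypothesis pcZ : forall e t (r : R) x,
  r \is e.-homog -> x \in pc t -> r *: x \in pc (e + t)%N.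
Hypothesis pc_span : forall x, x \in S -> exists T (c : nat -> W),
  (forall t, c t \in pc t) /\ x = \sum_(t < T) c t.
Hypothesis pc_direct : forall T (c : nat -> W), (forall t, c t \in pc t) ->
  \sum_(t < T) c t = 0 -> forall t, (t < T)%N -> c t = 0.

Definition sub_pred of GRing.submod_closed S := S.

HB.instance Definition _ :=
  GRing.isSubmodClosed.Build R W (sub_pred S_sub) S_sub.

Record submodule := Submodule { sub_val : W; _ : sub_val \in sub_pred S_sub }.

HB.instance Definition _ := [isSub for sub_val].
HB.instance Definition _ := [Choice of submodule by <:].
HB.instance Definition _ := [SubChoice_isSubLmodule of submodule by <:].

Definition sub_pc t : {pred submodule} := [pred x | val x \in pc t].

Lemma sub_pc_zmod t : zmod_closed (sub_pc t).
Proof.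
have [p0 pB] := pc_zmod t.
by split=> [|x y]; rewrite !inE ?raddf0 // raddfB; exact: pB.
Qed.

Lemma sub_pcZ e t (r : R) x :
  r \is e.-homog -> x \in sub_pc t -> r *: x \in sub_pc (e + t)%N.
Proof. move=> re; rewrite !inE; exact: pcZ. Qed.

Lemma sub_pc_span x : exists T (c : nat -> submodule),
  (forall t, c t \in sub_pc t) /\ x = \sum_(t < T) c t.
Proof.
have [T [c [cP xE]]] := pc_span (valP x).
exists T, (fun t => Submodule (pcS (cP t) : c t \in sub_pred S_sub)).
split=> [t|]; first by rewrite inE /= cP.
by apply: val_inj; rewrite raddf_sum.
Qed.

Lemma sub_pc_direct T (c : nat -> submodule) : (forall t, c t \in sub_pc t) ->
  \sum_(t < T) c t = 0 -> forall t, (t < T)%N -> c t = 0.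
Proof.
move=> cP c0 t tT; apply: val_inj; rewrite raddf0.
apply: (pc_direct (c := fun t => val (c t)) (T := T)) => //.
by rewrite -raddf_sum c0 raddf0.
Qed.

Definition graded_submodule : gradedModule :=
  GradedModule sub_pc_zmod sub_pcZ sub_pc_span sub_pc_direct.

End Submodule.
End GradedModules.

Section Segre.
Variables (k : fieldType) (n d : nat).

(* With a basis u_0, ..., u_n of U, Sym(U)^{\otimes d} is the polynomial ring in
   the variables xvar a j = 1 \otimes ... \otimes u_j \otimes ... \otimes 1,
   where u_j is in position a. *)
Definition nvar := #|{: 'I_d * 'I_n.+1}|.
Definition symtens := {mpoly k[nvar]}.
HB.instance Definition _ := GRing.ComNzRing.on symtens.

Definition xvar (a : 'I_d) (j : 'I_n.+1) : symtens := 'X_(enum_rank (a, j)).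

(* The degree in the a-th tensor factor *)
Definition bdeg (a : 'I_d) (m : 'X_{1.. nvar}) : nat :=
  \sum_(j < n.+1) m (enum_rank (a, j)).

Lemma bdeg0 a : bdeg a 0%MM = 0%N.
Proof. by rewrite /bdeg big1 // => j _; rewrite mnmE. Qed.

Lemma bdegD a : {morph bdeg a : m1 m2 / (m1 + m2)%MM >-> (m1 + m2)%N}.
Proof.
by move=> m1 m2; rewrite /bdeg -big_split; apply: eq_bigr => j _; rewrite mnmE.
Qed.

HB.instance Definition _ a := isMeasure.Build nvar (bdeg a) (bdeg0 a) (bdegD a).

(* A_t = (Sym^t U)^{\otimes d} *)
Definition segre_pc (t : nat) : {pred symtens} :=
  [pred p | [forall a, (p : {mpoly k[nvar]}) \is t.-homog for (bdeg a)]].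

(* A = \bigoplus_t A_t, inside Sym(U)^{\otimes d} *)
Definition segre : {pred symtens} :=
  [pred p | all (fun m => [forall a, forall b, bdeg a m == bdeg b m])
                (msupp (p : {mpoly k[nvar]}))].

(* s moves the factor in position a to position s a *)
Definition perm_act (s : 'S_d) (p : symtens) : symtens :=
  p \mPo [tuple xvar (s (enum_val v).1) (enum_val v).2 | v < nvar].

(* The monomials of degree d in u_0, ..., u_n, a basis of Sym^d U *)
Definition monomial := {m : 'X_{1.. n.+1 < d.+1} | mdeg m == d}.
Definition nmon := #|{: monomial}|.

Definition words (m : 'X_{1.. n.+1}) : {set {ffun 'I_d -> 'I_n.+1}} :=
  [set f : {ffun 'I_d -> 'I_n.+1} | (\sum_a U_(f a))%MM == m].

(* The symmetric tensor identified with the monomial u^m: the symmetrization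
   (1/d!) \sum_s s . (u_(f 0) \otimes ... \otimes u_(f (d - 1))), for any word f
   with content m, is the average of the tensors of all such words. *)
Definition symtensor (m : 'X_{1.. n.+1}) : symtens :=
  (#|words m|%:R^-1)%:MP * \sum_(f in words m) \prod_a xvar a (f a).

(* R = Sym(Sym^d U), with one variable for each monomial, and R -> A *)
Local Notation symsym := {mpoly k[nmon]}.

Definition symsym_map (r : symsym) : symtens :=
  r \mPo [tuple symtensor (val (val (enum_val v : monomial))) | v < nmon].


Lemma symsym_mapD r1 r2 : symsym_map (r1 + r2) = symsym_map r1 + symsym_map r2.
Proof. exact: raddfD. Qed.

Lemma symsym_mapM r1 r2 : symsym_map (r1 * r2) = symsym_map r1 * symsym_map r2.
Proof. exact: rmorphM. Qed.

Lemma symsym_map1 : symsym_map 1 = 1.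
Proof. exact: rmorph1. Qed.

Definition symtens_scale (r : symsym) (p : symtens) : symtens :=
  symsym_map r * p.

Fact symtens_scaleA r1 r2 p :
  symtens_scale r1 (symtens_scale r2 p) = symtens_scale (r1 * r2) p.
Proof. by rewrite /symtens_scale symsym_mapM mulrA. Qed.

Fact symtens_scale1 : left_id 1 symtens_scale.
Proof. by move=> p; rewrite /symtens_scale symsym_map1 mul1r. Qed.

Fact symtens_scaleDr : right_distributive symtens_scale +%R.
Proof. by move=> r p q; rewrite /symtens_scale mulrDr. Qed.

Fact symtens_scaleDl p : {morph symtens_scale^~ p : r1 r2 / r1 + r2}.
Proof. by move=> r1 r2; rewrite /symtens_scale symsym_mapD mulrDl. Qed.

HB.instance Definition _ := GRing.Zmodule_isLmodule.Build symsym symtens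
  symtens_scaleA symtens_scale1 symtens_scaleDr symtens_scaleDl.

Lemma symtens_scaleE (r : symsym) (p : symtens) : r *: p = symsym_map r * p.
Proof. by []. Qed.


Lemma segre_pcP t (p : symtens) :
  reflect (forall a, (p : {mpoly k[nvar]}) \is t.-homog for (bdeg a))
          (p \in segre_pc t).
Proof. exact: forallP. Qed.

Lemma segre_pc_segre t (p : symtens) : p \in segre_pc t -> p \in segre.
Proof.
move/segre_pcP => hp; apply/allP => m mp; apply/forallP => a; apply/forallP => b.
by rewrite (dhomog_mf (hp a) mp) (dhomog_mf (hp b) mp).
Qed.

Lemma segre_pc_zmod t : zmod_closed (segre_pc t).
Proof.
split=> [|p q /segre_pcP hp /segre_pcP hq]; apply/segre_pcP => a.
  exact: dhomog0.
by apply: dhomogD; [exact: hp|rewrite dhomogN; exact: hq].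
Qed.

Lemma segre_pcM e t (p q : symtens) :
  p \in segre_pc e -> q \in segre_pc t -> p * q \in segre_pc (e + t).
Proof.
move=> /segre_pcP hp /segre_pcP hq; apply/segre_pcP => a; exact: dhomogM.
Qed.

Lemma segre_pcC (c : k) : (c%:MP : symtens) \in segre_pc 0.
Proof.
apply/segre_pcP => a; rewrite -[c%:MP]mulr1 mul_mpolyC; apply: dhomogZ.
exact: dhomog1.
Qed.

Lemma segre_pc_sum t I (r : seq I) (P : pred I) (F : I -> symtens) :
  (forall i, P i -> F i \in segre_pc t) -> \sum_(i <- r | P i) F i \in segre_pc t.
Proof.
have [p0 pB] := segre_pc_zmod t; have pN q : q \in segre_pc t -> - q \in segre_pc t.
  by move=> qt; rewrite -sub0r pB.
move=> Ft; apply: (big_ind (fun p => p \in segre_pc t)) => // p q pt qt.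
by rewrite -[q]opprK pB ?pN.
Qed.

Lemma segre_pc_prod (I : finType) (e : I -> nat) (F : I -> symtens) :
  (forall i, F i \in segre_pc (e i)) -> \prod_i F i \in segre_pc (\sum_i e i).
Proof.
move=> Fe; apply: (big_ind2 (fun p t => p \in segre_pc t)) => //.
  exact: (segre_pcC 1).
by move=> p1 t1 p2 t2; exact: segre_pcM.
Qed.

Lemma segre_pcX t (p : symtens) m :
  p \in segre_pc t -> p ^+ m \in segre_pc (t * m).
Proof. by move=> /segre_pcP hp; apply/segre_pcP => a; exact: dhomogMn. Qed.

Lemma bdegU a b j : bdeg a U_(enum_rank (b, j))%MM = (a == b).
Proof.
rewrite /bdeg (bigD1 j) //= big1 ?addn0 => [|i ij]; rewrite mnm1E.
  by rewrite (inj_eq enum_rank_inj) xpair_eqE eqxx andbT eq_sym.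
by rewrite (inj_eq enum_rank_inj) xpair_eqE [j == i]eq_sym (negPf ij) andbF.
Qed.

Lemma symtensor_pc m : symtensor m \in segre_pc 1.
Proof.
rewrite /symtensor -[X in segre_pc X]add0n; apply: segre_pcM.
  exact: segre_pcC.
apply: segre_pc_sum => f _; apply/segre_pcP => a.
suff: ('X_[\sum_b U_(enum_rank (b, f b))] : {mpoly k[nvar]})
        \is 1.-homog for (bdeg a) by rewrite -mprodXE.
rewrite dhomogX; apply/eqP; apply: etrans (big_morph _ (bdegD a) (bdeg0 a) _ _ _) _.
rewrite (bigD1 a) //= [X in (X + _)%N]bdegU eqxx big1 // => b ba.
by rewrite [LHS]bdegU eq_sym (negPf ba).
Qed.

Lemma symsym_map_pc e (r : symsym) :
  r \is e.-homog -> symsym_map r \in segre_pc e.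
Proof.
move=> re; rewrite /symsym_map comp_mpolyE big_seq.
apply: segre_pc_sum => m mr; rewrite -mul_mpolyC -[e]add0n.
apply: segre_pcM; first exact: segre_pcC.
have <- : mdeg m = e by exact: dhomog_mf re _ mr.
rewrite mdegE; apply: segre_pc_prod => i.
by rewrite tnth_mktuple -[X in segre_pc X]mul1n; apply/segre_pcX/symtensor_pc.
Qed.


Lemma segre_pcZ e t (r : symsym) (p : symtens) :
  r \is e.-homog -> p \in segre_pc t -> r *: p \in segre_pc (e + t).
Proof.
by move=> re pt; rewrite symtens_scaleE; apply: segre_pcM pt; exact: symsym_map_pc.
Qed.

Lemma segreP (p : symtens) :
  reflect {in msupp (p : {mpoly k[nvar]}), forall m a b, bdeg a m = bdeg b m}
          (p \in segre).
Proof.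
apply: (iffP allP) => [hp m mp a b|hp m mp].
  by have /forallP/(_ a)/forallP/(_ b)/eqP := hp m mp.
by apply/forallP => a; apply/forallP => b; rewrite (hp m mp a b).
Qed.

Lemma segreD (p q : symtens) : p \in segre -> q \in segre -> p + q \in segre.
Proof.
move=> /segreP hp /segreP hq; apply/segreP => m.
by move/msuppD_le; rewrite mem_cat => /orP[/hp|/hq].
Qed.

Lemma segreM (p q : symtens) : p \in segre -> q \in segre -> p * q \in segre.
Proof.
move=> /segreP hp /segreP hq; apply/segreP => m.
case/msuppM_le/allpairsP => -[m1 m2] /= [m1p m2q ->] a b.
by rewrite !bdegD (hp _ m1p a b) (hq _ m2q a b).
Qed.

Lemma symsym_map_segre (r : symsym) : symsym_map r \in segre.
Proof.
elim/mpolyind: r => [|c m r _ _ hr].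
  by rewrite /symsym_map raddf0; apply/segreP => m; rewrite msupp0.
rewrite symsym_mapD; apply: segreD hr; apply: segre_pc_segre.
apply: (@symsym_map_pc (mdeg m)); apply: dhomogZ; rewrite dhomogX; exact: eqxx.
Qed.

Lemma segre_submod : GRing.submod_closed segre.
Proof.
split=> [|r p q hp hq]; first by apply/segreP => m; rewrite msupp0.
by rewrite symtens_scaleE segreD ?segreM ?symsym_map_segre.
Qed.

Lemma perm_act_pc s t (p : symtens) : p \in segre_pc t -> perm_act s p \in segre_pc t.
Proof.
move=> /segre_pcP hp; rewrite /perm_act comp_mpolyE big_seq.
apply: segre_pc_sum => m mp; rewrite -mul_mpolyC -[t]add0n.
apply: segre_pcM; first exact: segre_pcC.
apply/segre_pcP => a.
have -> : t = (\sum_(v < nvar) (s (enum_val v).1 == a) * m v)%N.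
  have <- : bdeg ((s^-1)%g a) m = t by exact: dhomog_mf (hp _) _ mp.
  rewrite /bdeg (reindex enum_rank) /=; last exact: onW_bij (enum_rank_bij _).
  rewrite (eq_bigr (fun u : 'I_d * 'I_n.+1 =>
    (s u.1 == a) * m (enum_rank (u.1, u.2)))%N); last first.
    by move=> [b j] _; rewrite enum_rankK.
  rewrite -(pair_bigA _ (fun b j => (s b == a) * m (enum_rank (b, j)))%N) /=.
  rewrite (bigD1 ((s^-1)%g a)) //= permKV eqxx [X in (_ + X)%N]big1 ?addn0.
    by apply: eq_bigr => j _; rewrite mul1n.
  move=> b ba; rewrite big1 // => j _; case: eqP => // sba.
  by rewrite -sba permK eqxx in ba.
apply: (big_ind2 (fun (p : {mpoly k[nvar]}) t => p \is t.-homog for (bdeg a))).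
- exact: dhomog1.
- by move=> *; apply: dhomogM.
move=> v _; apply: dhomogMn; rewrite tnth_mktuple dhomogX; apply/eqP.
by rewrite [LHS]bdegU eq_sym.
Qed.

Lemma perm_act_sum s I (r : seq I) (P : pred I) (F : I -> symtens) :
  perm_act s (\sum_(i <- r | P i) F i) = \sum_(i <- r | P i) perm_act s (F i).
Proof. exact: raddf_sum. Qed.

Lemma perm_actD s p q : perm_act s (p + q) = perm_act s p + perm_act s q.
Proof. exact: raddfD. Qed.

Lemma perm_actM s p q : perm_act s (p * q) = perm_act s p * perm_act s q.
Proof. exact: rmorphM. Qed.

Lemma perm_actC s (c : k) : perm_act s c%:MP = c%:MP.
Proof. exact: comp_mpolyC. Qed.

Lemma perm_act_xvar s a j : perm_act s (xvar a j) = xvar (s a) j.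
Proof.
by rewrite /perm_act /xvar comp_mpolyXU -tnth_nth tnth_mktuple enum_rankK.
Qed.

Lemma perm_act_symtensor s m : perm_act s (symtensor m) = symtensor m.
Proof.
rewrite /symtensor perm_actM perm_actC perm_act_sum; congr (_ * _).
pose h (f : {ffun 'I_d -> 'I_n.+1}) : {ffun 'I_d -> 'I_n.+1} := [ffun a => f (s a)].
have hB : bijective h.
  by exists (fun f : {ffun 'I_d -> 'I_n.+1} => [ffun a => f ((s^-1)%g a)]) => f; apply/ffunP => a;
     rewrite !ffunE ?permK ?permKV.
rewrite (reindex h) /=; last exact: onW_bij.
apply: eq_big => [f|f _]; rewrite ?inE.
  rewrite [in RHS](reindex s) /=; last exact: onW_bij (injF_bij (@perm_inj _ s)).
  by congr (_ == _); apply: eq_bigr => a _; rewrite ffunE.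
rewrite [RHS](reindex s) /=; last exact: onW_bij (injF_bij (@perm_inj _ s)).
rewrite [LHS]rmorph_prod; apply: eq_bigr => a _.
by rewrite [LHS]perm_act_xvar ffunE.
Qed.

Lemma perm_act_symsym s (r : symsym) : perm_act s (symsym_map r) = symsym_map r.
Proof.
rewrite /symsym_map comp_mpolyE [LHS]raddf_sum; apply: eq_bigr => m _.
rewrite -mul_mpolyC [LHS]perm_actM perm_actC; congr (_ * _).
rewrite [LHS]rmorph_prod.
apply: eq_bigr => i _; rewrite [LHS]rmorphXn; congr (_ ^+ _).
by rewrite tnth_mktuple; exact: perm_act_symtensor.
Qed.

Lemma perm_actZ s (r : symsym) p : perm_act s (r *: p) = r *: perm_act s p.
Proof. by rewrite !symtens_scaleE perm_actM perm_act_symsym. Qed.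

Hypothesis d_gt0 : (0 < d)%N.

Let pi t (p : symtens) : symtens := pihomog (bdeg (Ordinal d_gt0)) t p.

Lemma pi_pc t p : p \in segre -> pi t p \in segre_pc t.
Proof.
move=> /segreP hp; rewrite /pi pihomogE big_seq_cond.
apply: segre_pc_sum => m /andP[mp /eqP <-]; apply/segre_pcP => a.
by apply: dhomogZ; rewrite dhomogX; apply/eqP; exact: hp.
Qed.

Lemma segre_direct T (c : nat -> symtens) : (forall t, c t \in segre_pc t) ->
  \sum_(t < T) c t = 0 -> forall t, (t < T)%N -> c t = 0.
Proof.
move=> hc c0 t tT.
have := congr1 (pi t) c0; rewrite /pi pihomog0 [LHS]raddf_sum /=.
rewrite (bigD1 (Ordinal tT)) //= big1 => [|u ut].
  by rewrite addr0 pihomog_dE //; exact: (segre_pcP _ _ (hc t)).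
rewrite (@pihomog_ne0 _ _ _ u) //; last exact: (segre_pcP _ _ (hc u)).
Qed.


Lemma segre_pc_eq T (c c' : nat -> symtens) :
  (forall t, c t \in segre_pc t) -> (forall t, c' t \in segre_pc t) ->
  \sum_(t < T) c t = \sum_(t < T) c' t -> forall t, (t < T)%N -> c t = c' t.
Proof.
move=> hc hc' cc' t tT; apply/eqP; rewrite -subr_eq0; apply/eqP.
apply: (@segre_direct T (fun t => c t - c' t)) => // [u|].
  by have [_ pB] := segre_pc_zmod u; exact: pB.
by rewrite sumrB cc' subrr.
Qed.

Let cut T t (p : symtens) : symtens := if (t < T)%N then pi t p else 0.

Let cut_pc T t p : p \in segre -> cut T t p \in segre_pc t.
Proof.
by rewrite /cut => hp; case: ifP => _; [exact: pi_pc|have [] := segre_pc_zmod t].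
Qed.

Let bound (p : symtens) : nat := mmeasure (bdeg (Ordinal d_gt0)) p.

Let cut_sum T p : (bound p <= T)%N -> p = \sum_(t < T) cut T t p.
Proof.
move=> pT; rewrite [LHS](pihomog_partitionE pT).
by apply: eq_bigr => t _; rewrite /cut ltn_ord.
Qed.

Lemma segre_span p : p \in segre -> exists T (c : nat -> symtens),
  (forall t, c t \in segre_pc t) /\ p = \sum_(t < T) c t.
Proof.
move=> hp; exists (bound p), (fun t => cut (bound p) t p).
by split=> [t|]; [exact: cut_pc|exact: cut_sum].
Qed.

Definition A_mod : gradedModule k nmon :=
  graded_submodule segre_submod segre_pc_segre segre_pc_zmod segre_pcZ
    segre_span segre_direct.

Definition invariants : {pred symtens} :=
  [pred p | (p \in segre) && [forall s, perm_act s p == p]].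

Definition invariants_pc t : {pred symtens} :=
  [pred p | (p \in segre_pc t) && [forall s, perm_act s p == p]].

Lemma invariantsE p :
  (p \in invariants) = (p \in segre) && [forall s, perm_act s p == p].
Proof. by []. Qed.

Lemma invariants_pcE t p :
  (p \in invariants_pc t) = (p \in segre_pc t) && [forall s, perm_act s p == p].
Proof. by []. Qed.

Lemma invariants_submod : GRing.submod_closed invariants.
Proof.
have [s0 sZ] := segre_submod.
split=> [|r p q]; rewrite ?invariantsE ?invariants_pcE.
  by rewrite s0; apply/forallP => s; rewrite /perm_act raddf0.
move=> /andP[hp /forallP ip] /andP[hq /forallP iq]; rewrite sZ //=.
by apply/forallP => s; rewrite perm_actD perm_actZ (eqP (ip s)) (eqP (iq s)).
Qed.

Lemma invariants_pcS t p : p \in invariants_pc t -> p \in invariants.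
Proof. by rewrite ?invariantsE ?invariants_pcE => /andP[/segre_pc_segre hp ->]; rewrite hp. Qed.

Lemma invariants_pc_zmod t : zmod_closed (invariants_pc t).
Proof.
have [s0 sB] := segre_pc_zmod t.
split=> [|p q]; rewrite ?invariantsE ?invariants_pcE.
  by rewrite s0; apply/forallP => s; rewrite /perm_act raddf0.
move=> /andP[hp /forallP ip] /andP[hq /forallP iq]; rewrite sB //=.
apply/forallP => s.
by rewrite -scaleN1r perm_actD perm_actZ (eqP (ip s)) (eqP (iq s)).
Qed.

Lemma invariants_pcZ e t (r : symsym) p :
  r \is e.-homog -> p \in invariants_pc t -> r *: p \in invariants_pc (e + t)%N.
Proof.
rewrite ?invariantsE ?invariants_pcE => re /andP[hp /forallP ip]; rewrite segre_pcZ //=.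
by apply/forallP => s; rewrite perm_actZ (eqP (ip s)).
Qed.

Lemma invariants_span p : p \in invariants -> exists T (c : nat -> symtens),
  (forall t, c t \in invariants_pc t) /\ p = \sum_(t < T) c t.
Proof.
rewrite ?invariantsE ?invariants_pcE => /andP[hp /forallP ip].
exists (bound p), (fun t => cut (bound p) t p).
split=> [t|]; last exact: cut_sum.
rewrite ?invariantsE ?invariants_pcE cut_pc //=; apply/forallP => s; apply/eqP.
have [tT|tT] := boolP (t < bound p)%N; last first.
  by rewrite /cut (negPf tT) /perm_act raddf0.
apply: (@segre_pc_eq (bound p) (fun t => perm_act s (cut (bound p) t p))
  (fun t => cut (bound p) t p)) => // [u|u|].
- exact/perm_act_pc/cut_pc.
- exact: cut_pc.
by rewrite -perm_act_sum -cut_sum // (eqP (ip s)).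
Qed.

Lemma invariants_direct T (c : nat -> symtens) :
  (forall t, c t \in invariants_pc t) ->
  \sum_(t < T) c t = 0 -> forall t, (t < T)%N -> c t = 0.
Proof. by move=> hc; apply: segre_direct => t; have /andP[] := hc t. Qed.

Definition B_mod : gradedModule k nmon :=
  graded_submodule invariants_submod invariants_pcS invariants_pc_zmod
    invariants_pcZ invariants_span invariants_direct.

Section Hom.
Variables (e : nat) (V : mx_representation k [set: 'S_d]%G e).

(* A k-linear map phi from the representation space 'rV[k]_e of V to A is given
   by its values f i on the standard basis. Both S_d-actions are right actions,
   as s * t is "s, then t" in 'S_d. *)
Definition equivariant (f : {ffun 'I_e -> symtens}) : bool :=
  [forall s, forall i, perm_act s (f i) == \sum_j (V s i j)%:MP * f j].

(* Hom_{S_d}(V, A) *)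
Definition homs : {pred {ffun 'I_e -> symtens}} :=
  [pred f : {ffun 'I_e -> symtens} |
     [forall i, f i \in segre] && equivariant f].

Definition homs_pc t : {pred {ffun 'I_e -> symtens}} :=
  [pred f : {ffun 'I_e -> symtens} |
     [forall i, f i \in segre_pc t] && equivariant f].

Implicit Types f g : {ffun 'I_e -> symtens}.

Lemma homsE f : (f \in homs) = [forall i, f i \in segre] && equivariant f.
Proof. by []. Qed.

Lemma homs_pcE t f :
  (f \in homs_pc t) = [forall i, f i \in segre_pc t] && equivariant f.
Proof. by []. Qed.

Lemma equivariantZD (r : symsym) f g :
  equivariant f -> equivariant g -> equivariant (r *: f + g).
Proof.
move=> /forallP ef /forallP eg; apply/forallP => s; apply/forallP => i.
rewrite !ffunE perm_actD perm_actZ.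
rewrite (eqP (forallP (ef s) i)) (eqP (forallP (eg s) i)) scaler_sumr -big_split.
apply/eqP/eq_bigr => j _; rewrite !ffunE mulrDr; congr (_ + _).
by rewrite !symtens_scaleE mulrCA.
Qed.

Lemma equivariant0 : equivariant 0.
Proof.
apply/forallP => s; apply/forallP => i; rewrite ffunE /perm_act raddf0 eq_sym.
by apply/eqP/big1 => j _; rewrite ffunE mulr0.
Qed.

Lemma homs_submod : GRing.submod_closed homs.
Proof.
have [s0 sZ] := segre_submod.
split=> [|r f g]; rewrite ?homsE ?homs_pcE.
  by rewrite equivariant0 andbT; apply/forallP => i; rewrite ffunE.
move=> /andP[/forallP hf ef] /andP[/forallP hg eg]; rewrite equivariantZD // andbT.
by apply/forallP => i; rewrite !ffunE sZ.
Qed.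

Lemma homs_pcS t f : f \in homs_pc t -> f \in homs.
Proof.
rewrite ?homsE ?homs_pcE => /andP[/forallP hf ->]; rewrite andbT.
by apply/forallP => i; apply: segre_pc_segre.
Qed.

Lemma homs_pc_zmod t : zmod_closed (homs_pc t).
Proof.
have [s0 sB] := segre_pc_zmod t.
split=> [|f g]; rewrite ?homsE ?homs_pcE.
  by rewrite equivariant0 andbT; apply/forallP => i; rewrite ffunE.
move=> /andP[/forallP hf ef] /andP[/forallP hg eg].
rewrite addrC -scaleN1r equivariantZD // andbT scaleN1r addrC.
by apply/forallP => i; rewrite !ffunE sB.
Qed.

Lemma homs_pcZ e' t (r : symsym) f :
  r \is e'.-homog -> f \in homs_pc t -> r *: f \in homs_pc (e' + t)%N.
Proof.
rewrite ?homsE ?homs_pcE => re /andP[/forallP hf ef].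
rewrite -[r *: f]addr0 equivariantZD ?equivariant0 // andbT addr0.
by apply/forallP => i; rewrite ffunE segre_pcZ.
Qed.

Lemma homs_span f : f \in homs -> exists T (c : nat -> {ffun 'I_e -> symtens}),
  (forall t, c t \in homs_pc t) /\ f = \sum_(t < T) c t.
Proof.
rewrite ?homsE ?homs_pcE => /andP[/forallP hf /forallP ef].
pose T := (\max_i bound (f i))%N.
have fT i : (bound (f i) <= T)%N by exact: leq_bigmax.
exists T, (fun t => [ffun i => cut T t (f i)]); split=> [t|]; last first.
  by apply/ffunP => i; rewrite sum_ffunE [LHS](cut_sum (fT i));
     apply: eq_bigr => t _; rewrite ffunE.
rewrite ?homsE ?homs_pcE; apply/andP; split; first by apply/forallP => i; rewrite ffunE cut_pc.
apply/forallP => s; apply/forallP => i; rewrite ffunE; apply/eqP.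
rewrite (eq_bigr (fun j => (V s i j)%:MP * cut T t (f j))); last first.
  by move=> j _; rewrite ffunE.
have [tT|tT] := boolP (t < T)%N; last first.
  rewrite /cut (negPf tT) /perm_act raddf0 big1 // => j _; exact: mulr0.
apply: (@segre_pc_eq T (fun t => perm_act s (cut T t (f i)))
  (fun t => \sum_j (V s i j)%:MP * cut T t (f j))) => // [u|u|].
- exact/perm_act_pc/cut_pc.
- apply: segre_pc_sum => j _; rewrite -[u]add0n; apply: segre_pcM.
    exact: segre_pcC.
  exact: cut_pc.
rewrite -perm_act_sum -cut_sum // (eqP (forallP (ef s) i)) exchange_big /=.
by apply: eq_bigr => j _; rewrite -mulr_sumr -cut_sum.
Qed.

Lemma homs_direct T (c : nat -> {ffun 'I_e -> symtens}) :
  (forall t, c t \in homs_pc t) ->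
  \sum_(t < T) c t = 0 -> forall t, (t < T)%N -> c t = 0.
Proof.
move=> hc c0 t tT; apply/ffunP => i; rewrite ffunE.
apply: (@segre_direct T (fun t => c t i)) => // [u|].
  by have /andP[/forallP] := hc u.
by have := congr1 (fun f : {ffun _ -> symtens} => f i) c0; rewrite sum_ffunE ffunE.
Qed.

Definition Hom_mod : gradedModule k nmon :=
  graded_submodule homs_submod homs_pcS homs_pc_zmod homs_pcZ
    homs_span homs_direct.

End Hom.

End Segre.

Definition is_partition (d : nat) (lam : seq nat) : bool :=
  [&& sorted geq lam, 0%N \notin lam & sumn lam == d].

Section Specht.
Variables (k : fieldType) (d : nat) (lam : seq nat).

(* The standard filling of the Young diagram of lam: the boxes are numbered
   0, ..., d - 1 row by row. *)
Definition row_stab : {set 'S_d} :=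
  [set s : 'S_d | [forall a : 'I_d, reshape_index lam (s a) == reshape_index lam a]].

Definition col_stab : {set 'S_d} :=
  [set s : 'S_d | [forall a : 'I_d, reshape_offset lam (s a) == reshape_offset lam a]].

(* The Young symmetrizer, in the group algebra 'rV[k]_#|'S_d| *)
Definition young_symmetrizer : 'rV[k]_(gcard [set: 'S_d]%G) :=
  \sum_(p in row_stab) \sum_(q in col_stab)
    (-1) ^+ odd_perm q *: 'e_(gring_index [set: 'S_d]%G (p * q)%g).

(* V_lambda: the submodule of the regular representation generated by the Young
   symmetrizer *)
Definition specht := submod_repr
  (cyclic_mx_module (regular_repr k [set: 'S_d]%G) young_symmetrizer).

End Specht.

Definition M_mod (k : fieldType) (n d : nat) (d_gt0 : (0 < d)%N) (lam : seq nat) :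
    gradedModule k (nmon n d) :=
  Hom_mod n d_gt0 (specht k d lam).

(* Main.v *)
Require Import Defs.
From HB Require Import structures.
From mathcomp Require Import all_boot all_order all_algebra all_fingroup.
From mathcomp Require Import mxrepresentation.
From mathcomp Require Import mpoly.
From mathcomp Require Import boolp constructive_ereal.
From mathcomp Require Import zify ring.

(** Write x_(a,j) for the variable u_j of the tensor factor (row) a, and let theta_s,
    for s = 0, ..., dn, be the coefficient of T^s in the product over all rows a of
    the polynomials sum_j x_(a,j) T^j. These dn + 1 elements are S_d-invariant and are
    images of linear forms of R. Put r = (d - 1) n. The theorem follows from three
    facts.

    1. The theta's are a regular sequence on A, and A / theta A lives in degrees at
    most r and is at most a line in degree r (segre_cohen_macaulay). Here
    theta_0 is the product of the variables x_(a,0). Splitting off its factors one by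
    one filters A / theta_0 A by modules of the same kind, with one variable fewer in
    one row and with the degrees of the rows shifted, and on which theta_1 is again
    the product of the first variables of the rows. So the proof is an induction on
    the number of variables over Segre products of polynomial rings with shifted
    rows; the shifts that occur must stay within the range in which the product has
    no intermediate cohomology (balanced).

    2. In degree r there is a functional that vanishes on theta A but not on A, and
    that an exchange of two rows multiplies by (-1)^n (residue_theta,
    residue_corner, residue_tperm). To get it, each row is written as a product of n
    linear polynomials, so that x_(a,j) becomes an elementary symmetric function of n
    roots, and theta_s one of all dn roots. After multiplication by a monomial the
    alternating sum over all permutations of the roots is linear over the theta's,
    and it vanishes on polynomials in which all exponents are at most dn - 2.
    Exchanging two rows exchanges n pairs of roots.

    3. If the theta's are a regular sequence on M and M / theta M lives in degrees at
    most r, then reg M <= r, with equality if M / theta M is not zero in degree r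
    (tor_above, tor_corner). Indeed, modulo theta a free resolution of M becomes a
    resolution of M / theta M; dividing it by the other linear forms, one at a time,
    the long exact sequences keep the homology in position i in degrees at most
    i + r, and transport the part of degree i + r from position i to i + 1. Once all
    linear forms are gone, the homology is Tor. That a resolution exists, so that
    the bound is attained, is the Hilbert basis theorem (resolution_exists).

    In characteristic 0, averaging over S_d makes B a direct summand of A, and
    Hom(V, A) one of a power of A, as modules over R. So the theta's are regular on
    them too, and their quotients by theta live in degrees at most r. By 2, S_d acts on
    the line (A / theta A)_r through the n-th power of the sign; so this line survives
    in B / theta B for n even, and does not for n odd and d > 1. *)

Set Implicit Arguments.
Unset Strict Implicit.
Unset Printing Implicit Defensive.

Import Order.TTheory GRing.Theory Num.Theory.
Local Open Scope ring_scope.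

(** * Combinations of linear forms, and homogeneous parts *)

Section Combinations.
Variables (R : comNzRingType) (l : nat -> R).

Definition combo (V : lmodType R) (t : nat) (x : V) : Prop :=
  exists q : nat -> V, x = \sum_(s < t) l s *: q s.

Lemma combo0 (V : lmodType R) t : combo t (0 : V).
Proof. by exists (fun _ => 0); rewrite big1 // => s _; rewrite scaler0. Qed.

Lemma comboD (V : lmodType R) t (x y : V) :
  combo t x -> combo t y -> combo t (x + y).
Proof.
move=> [q ->] [q' ->]; exists (fun s => q s + q' s).
by rewrite -big_split; apply: eq_bigr => s _; rewrite scalerDr.
Qed.

Lemma comboZ (V : lmodType R) t r (x : V) : combo t x -> combo t (r *: x).
Proof.
move=> [q ->]; exists (fun s => r *: q s); rewrite scaler_sumr.
by apply: eq_bigr => s _; rewrite !scalerA mulrC.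
Qed.

Lemma comboN (V : lmodType R) t (x : V) : combo t x -> combo t (- x).
Proof. by rewrite -scaleN1r; exact: comboZ. Qed.

Lemma combo_linear (V W : lmodType R) (f : {linear V -> W}) t x :
  combo t x -> combo t (f x).
Proof.
move=> [q ->]; exists (f \o q); rewrite linear_sum.
by apply: eq_bigr => s _; rewrite linearZ.
Qed.

Lemma combo_gen (V : lmodType R) s t (x : V) : (s < t)%N -> combo t (l s *: x).
Proof.
move=> st; exists (fun i => if i == s then x else 0).
rewrite (bigD1 (Ordinal st)) //= eqxx big1 ?addr0 // => i.
by rewrite -val_eqE /= => /negPf ->; rewrite scaler0.
Qed.

Lemma comboW (V : lmodType R) s t (x : V) : (s <= t)%N -> combo s x -> combo t x.
Proof.
move=> st [q ->]; apply: (big_ind (combo t)); first exact: combo0.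
  exact: comboD.
by move=> i _; apply: combo_gen; apply: leq_trans st.
Qed.

Lemma comboS (V : lmodType R) t (x : V) :
  combo t.+1 x <-> exists y, combo t (x - l t *: y).
Proof.
split=> [[q ->]|[y hy]].
  by exists (q t); exists q; rewrite big_ord_recr /= addrK.
rewrite -(subrK (l t *: y) x); apply: comboD (combo_gen _ (ltnSn t)).
exact: comboW hy.
Qed.

(** For a free module, membership in l V is tested coordinatewise; so a sequence
    that is regular on R is regular on every free module. *)
Lemma combo_rV b t (v : 'rV[R]_b) :
  (forall c, combo t (v 0 c : R^o)) -> combo t v.
Proof.
move=> /choice[q hq]; exists (fun s => \row_c q c s).
apply/rowP => c; rewrite hq summxE.
by apply: eq_bigr => s _; rewrite !mxE.
Qed.

Lemma combo_coord b t (v : 'rV[R]_b) c : combo t v -> combo t (v 0 c : R^o).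
Proof.
move=> [q ->]; exists (fun s => q s 0 c); rewrite summxE.
by apply: eq_bigr => s _; rewrite !mxE.
Qed.

Lemma comboR t (p : R) :
  combo t (p : R^o) <-> exists q : nat -> R, p = \sum_(s < t) l s * q s.
Proof. by []. Qed.

Definition regular_at (V : lmodType R) t :=
  forall x : V, combo t (l t *: x) -> combo t x.

Lemma regular_rV b t : regular_at R^o t -> regular_at 'rV[R]_b t.
Proof.
move=> hR x hx; apply: combo_rV => c; apply: hR.
by have := combo_coord c hx; rewrite mxE.
Qed.

End Combinations.

Section HomogeneousParts.
Variables (k : fieldType) (N : nat).
Local Notation R := {mpoly k[N]}.

Lemma pihomogM (mf : measure N) (e j : nat) (l p : R) : l \is e.-homog for mf ->
  pihomog mf j (l * p) = if (e <= j)%N then l * pihomog mf (j - e) p else 0.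
Proof.
move=> le; rewrite {1}(pihomog_partitionE (leqnn (mmeasure mf p))).
have hp i : l * pihomog mf i p \is (e + i).-homog for mf.
  by apply: dhomogM => //; exact: pihomogP.
rewrite mulr_sumr linear_sum /=.
have [ej|ej] := leqP e j; last first.
  apply: big1 => i _; apply: pihomog_ne0 (hp i).
  by rewrite neq_ltn orbC (leq_trans ej) ?leq_addr.
have [jp|jp] := ltnP (j - e) (mmeasure mf p).
  rewrite (bigD1 (Ordinal jp)) //= big1 => [|i].
    by rewrite addr0 pihomog_dE // -{2}(subnKC ej).
  rewrite -val_eqE /= => ij; apply: pihomog_ne0 (hp i).
  by rewrite -(subnKC ej) eqn_add2l.
rewrite big1 => [|i _].
  suff -> : pihomog mf (j - e) p = 0 by rewrite mulr0.
  rewrite pihomogE big_seq_cond big1 // => m /andP[mp /eqP mj].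
  by have := mmeasure_mnm_lt mf mp; rewrite mj ltnNge jp.
apply: pihomog_ne0 (hp i); rewrite -(subnKC ej) eqn_add2l neq_ltn.
by rewrite (leq_trans (ltn_ord i)).
Qed.

Definition hproj b (a : 'I_b -> nat) j (v : 'rV[R]_b) : 'rV[R]_b :=
  \row_c if (a c <= j)%N then pihomog mdeg (j - a c) (v 0 c) else 0.

Lemma hproj_homog b (a : 'I_b -> nat) j v : free_homog a j (hproj a j v).
Proof. by apply/forallP => c; rewrite mxE; case: leqP => _; rewrite ?eqxx ?pihomogP. Qed.

Lemma hproj_id b (a : 'I_b -> nat) j v : free_homog a j v -> hproj a j v = v.
Proof.
move=> /forallP hv; apply/rowP => c; rewrite mxE; have := hv c.
by case: ifP => _; [exact: pihomog_dE|move/eqP].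
Qed.

Lemma hproj_sum b (a : 'I_b -> nat) j I (r : seq I) P (F : I -> 'rV[R]_b) :
  hproj a j (\sum_(i <- r | P i) F i) = \sum_(i <- r | P i) hproj a j (F i).
Proof.
apply/rowP => c; rewrite mxE !summxE.
case: ifP => ac; last by rewrite big1 // => i _; rewrite mxE ac.
by rewrite linear_sum; apply: eq_bigr => i _; rewrite mxE ac.
Qed.

Lemma hproj0 b (a : 'I_b -> nat) j : hproj a j 0 = 0.
Proof. by apply/rowP => c; rewrite !mxE linear0 if_same. Qed.

Lemma hprojB b (a : 'I_b -> nat) j v w :
  hproj a j (v - w) = hproj a j v - hproj a j w.
Proof.
by apply/rowP => c; rewrite !mxE; case: ifP => _; rewrite ?subr0 // linearB.
Qed.

Lemma hprojZS b (a : 'I_b -> nat) j (l : R) v : l \is 1.-homog ->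
  hproj a j.+1 (l *: v) = l *: hproj a j v.
Proof.
move=> hl; apply/rowP => c; rewrite !mxE (pihomogM _ _ hl) subn_gt0 ltnS.
have [ac|ac] := leqP (a c) j; first by rewrite leqW // subSn // subn1.
by rewrite mulr0; case: ifP.
Qed.

Lemma hprojZ0 b (a : 'I_b -> nat) (l : R) v : l \is 1.-homog ->
  hproj a 0 (l *: v) = 0.
Proof.
move=> hl; apply/rowP => c; rewrite !mxE (pihomogM _ _ hl) sub0n.
by case: ifP.
Qed.

(** Differentials preserve degrees, so they commute with homogeneous parts. *)
Lemma hproj_mul b b' (a : 'I_b -> nat) (a' : 'I_b' -> nat) j (d : 'M[R]_(b', b))
    (w : 'rV[R]_b') :
  (forall r, free_homog a (a' r) (row r d)) ->
  hproj a j (w *m d) = hproj a' j w *m d.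
Proof.
move=> hd; apply/rowP => c; rewrite !mxE.
have {}hd r : if (a c <= a' r)%N then d r c \is (a' r - a c).-homog
              else d r c == 0 by have /forallP/(_ c) := hd r; rewrite mxE.
transitivity (\sum_r (if (a c <= j)%N then pihomog mdeg (j - a c) (w 0 r * d r c)
                      else 0)).
  by case: ifP => _; rewrite ?linear_sum // big1.
apply: eq_bigr => r _; rewrite mxE; have := hd r.
have [ar hrc|ar /eqP->] := leqP (a c) (a' r); last first.
  by rewrite !mulr0 linear0; case: ifP.
rewrite mulrC (pihomogM _ _ hrc).
have [aj|aj] := leqP (a c) j.
  rewrite leq_sub2rE // -subnDA subnKC //.
  by case: ifP => _; rewrite ?mul0r // mulrC.
by rewrite leqNgt (leq_trans aj ar) mul0r.
Qed.

Lemma free_homogP b (a : 'I_b -> nat) j (v : 'rV[R]_b) :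
  free_homog a j v <-> hproj a j v = v.
Proof. by split=> [|<-]; [exact: hproj_id|exact: hproj_homog]. Qed.

Lemma free_homogB b (a : 'I_b -> nat) j (v w : 'rV[R]_b) :
  free_homog a j v -> free_homog a j w -> free_homog a j (v - w).
Proof. by rewrite !free_homogP hprojB => -> ->. Qed.

(** Coordinate c of the part of degree i is the part of degree i - a c of v_c,
    whence the bound on the number of parts. *)
Lemma hproj_decomp b (a : 'I_b -> nat) (v : 'rV[R]_b) :
  exists T, forall T', (T <= T')%N -> v = \sum_(i < T') hproj a i v.
Proof.
exists (\max_c (a c + mmeasure mdeg (v 0%R c)))%N => T' TT'.
apply/rowP => c; rewrite summxE.
have cT : (a c + mmeasure mdeg (v 0%R c) <= T')%N.
  by apply: leq_trans TT'; apply: leq_bigmax.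
have aT : (a c <= T')%N by apply: leq_trans cT; exact: leq_addr.
transitivity (\sum_(i < T') (if (a c <= i)%N then pihomog mdeg (i - a c) (v 0 c) else 0));
  last by apply: eq_bigr => i _; rewrite mxE.
rewrite -(subnKC aT) big_split_ord /= big1 ?add0r => [|i _]; last by rewrite leqNgt ltn_ord.
rewrite {1}(@pihomog_partitionE _ _ mdeg (T' - a c) (v 0 c)); last by rewrite leq_subRL.
by apply: eq_bigr => i _; rewrite leq_addr addKn.
Qed.

End HomogeneousParts.

Section Generators.
Variables (k : fieldType) (N : nat).
Local Notation R := {mpoly k[N]}.
Variables (M : gradedModule k N) (b : nat) (a : 'I_b -> nat) (g : 'I_b -> M).
Hypothesis g_homog : forall c, g c \in gm_pc (a c).

Definition gen (v : 'rV[R]_b) : M := \sum_c v 0 c *: g c.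

Lemma gen_linear : linear gen.
Proof.
move=> r v w; rewrite /gen scaler_sumr -big_split; apply: eq_bigr => i _.
by rewrite !mxE scalerDl scalerA.
Qed.

HB.instance Definition _ := GRing.isLinear.Build R _ _ _ gen gen_linear.

Lemma genB v w : gen (v - w) = gen v - gen w.
Proof. exact: linearB. Qed.

Lemma genD v w : gen (v + w) = gen v + gen w.
Proof. exact: linearD. Qed.

Lemma gen0 : gen 0 = 0.
Proof. exact: linear0. Qed.

Lemma genZ r v : gen (r *: v) = r *: gen v.
Proof. exact: linearZ. Qed.

Lemma gen_sum I (r : seq I) P (F : I -> 'rV[R]_b) :
  gen (\sum_(i <- r | P i) F i) = \sum_(i <- r | P i) gen (F i).
Proof. exact: linear_sum. Qed.

Lemma gen_combo (l : nat -> R) t v : combo l t v -> combo l t (gen v).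
Proof.
move=> [q ->]; exists (gen \o q); rewrite gen_sum.
by apply: eq_bigr => s _; rewrite genZ.
Qed.

Lemma gen_homog j v : free_homog a j v -> gen v \in gm_pc j.
Proof.
have [p0 pB] := @gm_pc_zmod _ _ M j.
have pD x y : x \in @gm_pc _ _ M j -> y \in @gm_pc _ _ M j -> x + y \in @gm_pc _ _ M j.
  by move=> hx hy; rewrite -[y]opprK -[- y]sub0r !pB.
move=> /forallP hv; apply: (big_ind (fun x => x \in gm_pc j)) => // i _.
have := hv i; case: leqP => [ij vi|_ /eqP->]; last by rewrite scale0r.
by rewrite -(subnK ij); apply: gm_pcZ vi _; exact: g_homog.
Qed.

(** The parts of v are sent to distinct graded components, whose sum is direct;
    so a homogeneous element only sees one part of each of its lifts, and the
    relations among homogeneous generators form a graded module. *)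
Lemma gen_hproj j v : gen v \in @gm_pc _ _ M j ->
  forall i, gen (hproj a i v) = if i == j then gen v else 0.
Proof.
move=> vj i; have [T vE] := hproj_decomp a v.
pose y i := gen (hproj a i v) - (if i == j then gen v else 0).
have yP n : y n \in @gm_pc _ _ M n.
  have [q0 qB] := @gm_pc_zmod _ _ M n; apply: qB; first exact/gen_homog/hproj_homog.
  by case: eqP => // ->.
pose T' := maxn T (maxn i j).+1.
have iT : (i < T')%N by rewrite leq_max ltnS leq_maxl orbT.
have jT : (j < T')%N by rewrite leq_max ltnS leq_maxr orbT.
suff /(gm_direct yP)/(_ i iT)/eqP : \sum_(i < T') y i = 0 by rewrite subr_eq0 => /eqP.
rewrite sumrB -linear_sum -(vE _ (leq_maxl _ _)) /=.
rewrite (bigD1 (Ordinal jT)) //= eqxx big1 ?addr0 ?subrr // => n.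
by rewrite -val_eqE /= => /negPf ->.
Qed.

End Generators.

(** * Killing linear forms in a free resolution *)

Section Koszul.
Variables (k : fieldType) (N : nat).
Local Notation R := {mpoly k[N]}.
Variables (D c : nat) (l : nat -> R).
Hypothesis l_homog : forall s, l s \is 1.-homog.
Hypothesis l_reg : forall t, (t < D + c)%N -> regular_at l R^o t.
Hypothesis l_max : forall p : R, p@_0%MM = 0 -> combo l (D + c) (p : R^o).

Variables (M : gradedModule k N) (F : resolution M).
Hypothesis M_reg : forall t, (t < D)%N -> regular_at l M t.

Local Notation deg i := (@res_deg k N M F i).
Local Notation dd i := (res_d F i).

Local Notation gen := (gen (@res_gen k N M F)).

(** Cycles and boundaries of the complex F / (l_0, ..., l_(t-1)) F, on
    representatives in F; there is no condition on cycles in position 0. For t = 0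
    this is F, and for t = D + c it is F tensored with k. *)
Definition koszul_cycle t i : 'rV[R]_(res_rk F i) -> Prop :=
  match i with
  | 0 => fun _ => True
  | i'.+1 => fun v => combo l t (v *m dd i')
  end.

Definition koszul_bound t i (v : 'rV[R]_(res_rk F i)) : Prop :=
  exists w, combo l t (v - w *m dd i).

Definition acyclic t i j := forall v : 'rV[R]_(res_rk F i),
  free_homog (deg i) j v -> koszul_cycle t v -> koszul_bound t v.

Lemma res_dd i (w : 'rV_(res_rk F i.+2)) : w *m dd i.+1 *m dd i = 0.
Proof. by apply/res_exactS; exists w. Qed.

Lemma gen_d (w : 'rV_(res_rk F 1)) : gen (w *m dd 0) = 0.
Proof. by apply/res_exact0; exists w. Qed.

Lemma boundS t i (v : 'rV[R]_(res_rk F i)) : koszul_bound t v -> koszul_bound t.+1 v.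
Proof. by move=> [w hw]; exists w; exact: comboW hw. Qed.

Lemma koszul_cycleZ t i (v : 'rV[R]_(res_rk F i)) r :
  koszul_cycle t v -> koszul_cycle t (r *: v).
Proof. by case: i v => //= i v hv; rewrite -scalemxAl; exact: comboZ. Qed.

(** Write v d = l_t q modulo l_0, ..., l_(t-1): the class of q is the image of v
    under the connecting map of 0 -> G -> G -> G / l_t G -> 0, where
    G = F / (l_0, ..., l_(t-1)) F. When it vanishes, v lifts to a cycle of G. *)
Lemma lift_cycle t i (v : 'rV[R]_(res_rk F i.+1)) q w :
  combo l t (v *m dd i - l t *: q) -> combo l t (q - w *m dd i) ->
  koszul_cycle t (v - l t *: w).
Proof.
move=> hv hq; rewrite /koszul_cycle mulmxBl -scalemxAl.
rewrite -[X in combo l t X](subrKA (l t *: q)) addrC.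
by rewrite -scalerBr; apply: comboD hv; exact: comboZ.
Qed.

Lemma unlift_bound t i (v : 'rV[R]_(res_rk F i)) w :
  koszul_bound t (v - l t *: w) -> koszul_bound t.+1 v.
Proof.
by move=> [u hu]; exists u; apply/comboS; exists w; rewrite addrAC.
Qed.

(** In position 0 the homology of F / (l_0, ..., l_(t-1)) F is
    M / (l_0, ..., l_(t-1)) M. *)
Lemma gen_bound t v : combo l t (gen v) -> koszul_bound t v.
Proof.
move=> [x xE].
have /choice[w hw] s : exists w, x s = gen w by have [w ->] := res_surj F (x s); exists w.
have : gen (v - \sum_(s < t) l s *: w s) = 0.
  apply/eqP; rewrite genB subr_eq0; apply/eqP; rewrite [LHS]xE gen_sum.
  by apply: eq_bigr => s _; rewrite genZ hw.
by move=> /res_exact0[u uE]; exists u; rewrite -uE subKr; exists w.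
Qed.

(** Dividing by an M-regular sequence does not create homology in positive
    positions. Position 1 is where the regularity on M enters: there the
    connecting map has values in M / (l_0, ..., l_(t-1)) M. *)
Lemma acyclic_pos t i (v : 'rV[R]_(res_rk F i.+1)) : (t <= D)%N ->
  koszul_cycle t v -> koszul_bound t v.
Proof.
elim: t i v => [|t IH] i v tD.
  move=> [q]; rewrite big_ord0 => /res_exactS[w ->].
  by exists w; rewrite subrr; exact: combo0.
move=> /comboS[q hq].
have tDc : (t < D + c)%N by rewrite ltn_addr.
suff [w hw] : koszul_bound t q.
  by apply: unlift_bound (IH _ _ (ltnW tD) (lift_cycle hq hw)).
case: i => [|i] in v q hq *; last first.
  apply: IH (ltnW tD) _; apply: (regular_rV (l_reg tDc)).
  have := combo_linear (mulmxr (dd i)) hq.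
  by rewrite /= mulmxBl res_dd sub0r -scalemxAl => /comboN; rewrite opprK.
apply: gen_bound; have := gen_combo (@res_gen k N M F) hq.
by rewrite genB gen_d sub0r genZ => /comboN; rewrite opprK => /(M_reg tD).
Qed.

Lemma combo_hproj t i j (v : 'rV[R]_(res_rk F i)) :
  combo l t v -> combo l t (hproj (deg i) j v).
Proof.
move=> [q ->]; rewrite hproj_sum; case: j => [|j].
  by rewrite big1; [exact: combo0|move=> s _; exact: hprojZ0].
exists (fun s => hproj (deg i) j (q s)).
by apply: eq_bigr => s _; exact: hprojZS.
Qed.

Lemma free_homog_d i j (w : 'rV[R]_(res_rk F i.+1)) :
  free_homog (deg i.+1) j w -> free_homog (deg i) j (w *m dd i).
Proof.
move=> hw; rewrite -(hproj_id hw) -(hproj_mul _ _ (@res_d_homog _ _ _ F i)).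
exact: hproj_homog.
Qed.

Lemma free_homogZ i j (v : 'rV[R]_(res_rk F i)) t :
  free_homog (deg i) j v -> free_homog (deg i) j.+1 (l t *: v).
Proof.
move=> hv; rewrite -(hproj_id hv) -(hprojZS _ _ _ (l_homog t)).
exact: hproj_homog.
Qed.

(** The homogeneous part of a boundary equation is a boundary equation. *)
Lemma bound_homog t i j (v : 'rV[R]_(res_rk F i)) : free_homog (deg i) j v ->
  koszul_bound t v ->
  exists2 w, free_homog (deg i.+1) j w & combo l t (v - w *m dd i).
Proof.
move=> hv [w hw]; exists (hproj (deg i.+1) j w); first exact: hproj_homog.
rewrite -(hproj_mul _ _ (@res_d_homog _ _ _ F i)) -{1}(hproj_id hv) -hprojB.
exact: combo_hproj.
Qed.

(** The exact sequence H_(i+1)(G)_j -> H_(i+1)(G / l_t G)_j -> H_i(G)_(j-1). *)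
Lemma acyclicS t i j : (t < D + c)%N ->
  (forall j', j = j'.+1 -> acyclic t i j') -> acyclic t i.+1 j ->
  acyclic t.+1 i.+1 j.
Proof.
move=> tDc Hi HS v hv /comboS[q hq].
have hvd := free_homog_d hv.
case: j => [|j] in Hi HS hv hvd *.
  apply/boundS/HS => //; have := combo_hproj 0 hq.
  by rewrite hprojB (hproj_id hvd) (hprojZ0 _ _ (l_homog t)) subr0.
have hq' : combo l t (v *m dd i - l t *: hproj (deg i) j q).
  have := combo_hproj j.+1 hq.
  by rewrite hprojB (hproj_id hvd) (hprojZS _ _ _ (l_homog t)).
have hqj := hproj_homog (deg i) j q; set q' := hproj _ _ _ in hq' hqj.
have [w hw wE] : exists2 w, free_homog (deg i.+1) j w & combo l t (q' - w *m dd i).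
  apply: bound_homog => //; apply: (Hi j) => //.
  case: i => [|i] // in v hv hvd q hq q' hq' hqj HS Hi *.
  apply: (regular_rV (l_reg tDc)).
  have := combo_linear (mulmxr (dd i)) hq'.
  by rewrite /= mulmxBl res_dd sub0r -scalemxAl => /comboN; rewrite opprK.
apply: (@unlift_bound _ _ v w); apply: HS (lift_cycle hq' wE).
by apply: free_homogB => //; exact: free_homogZ.
Qed.

(** The bound j <= i + r on the degrees of the homology is stable under division by
    one more linear form, as the connecting map lowers i and j by 1 together. *)
Lemma acyclic_above r t i j : (D <= t <= D + c)%N ->
  (forall j (x : M), (r < j)%N -> x \in @gm_pc _ _ M j -> combo l D x) ->
  (i + r < j)%N -> acyclic t i j.
Proof.
move=> /andP[Dt tDc] M_top; rewrite -(subnKC Dt) in tDc *.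
elim: (t - D)%N tDc i j => [|u IH] uc i j irj.
  rewrite addn0; case: i irj => [|i] irj v hv hc; last exact: acyclic_pos hc.
  by apply/gen_bound/(M_top j) => //; exact: gen_homog (@res_gen_homog _ _ _ F) _ _ _.
rewrite addnS in uc *; case: i irj => [|i] irj.
  by move=> v hv hc; apply/boundS/(IH _ 0%N j) => //; exact: ltnW.
apply: acyclicS => // [j' jE|]; apply: IH; rewrite ?(ltnW uc) //.
by rewrite -ltnS -jE.
Qed.

Lemma mcoeff0_combo t (p : R) : combo l t (p : R^o) -> p@_0%MM = 0.
Proof.
move=> [q ->]; rewrite linear_sum big1 // => s _.
rewrite /= [_ *: _]/(_ * _) rmorphM /= (dhomog_nemf_coeff (l_homog s)) ?mul0r //.
by rewrite [X in X != _]mdeg0.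
Qed.

(* Modulo all the linear forms only the constant terms survive. *)
Local Notation const0 := (map_mx (mcoeff (0%MM : 'X_{1..N}))).

Lemma combo_maxP b (u : 'rV[R]_b) : combo l (D + c) u <-> const0 u = 0.
Proof.
split=> [hu|u0]; first by apply/rowP => i; rewrite !mxE (mcoeff0_combo (combo_coord i hu)).
by apply: combo_rV => i; apply: l_max; have /rowP/(_ i) := u0; rewrite !mxE.
Qed.

Lemma const0_d i (w : 'rV[R]_(res_rk F i.+1)) :
  const0 (w *m dd i) = const0 w *m tor_d F i.
Proof. exact: map_mxM. Qed.

Lemma tor_cycleP i (v : 'rV[R]_(res_rk F i)) :
  koszul_cycle (D + c) v <-> tor_cycle (const0 v).
Proof. by case: i v => [|i] // v; rewrite /= -const0_d; exact: combo_maxP. Qed.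

Lemma tor_boundP i (v : 'rV[R]_(res_rk F i)) :
  koszul_bound (D + c) v <-> exists w, const0 v = w *m tor_d F i.
Proof.
split=> [[w /combo_maxP]|[w vE]].
  by rewrite map_mxB const0_d => /eqP; rewrite subr_eq0 => /eqP ->; exists (const0 w).
exists (map_mx (@mpolyC N k) w); apply/combo_maxP.
rewrite map_mxB const0_d vE -map_mx_comp (_ : map_mx _ w = w) ?subrr //.
by apply/matrixP => a b; rewrite mxE; exact: mpolyCK.
Qed.

Lemma tor_above r i j (v : 'rV[k]_(res_rk F i)) :
  (forall j (x : M), (r < j)%N -> x \in @gm_pc _ _ M j -> combo l D x) ->
  (forall c, deg i c != j -> v 0 c = 0) -> tor_cycle v -> (i + r < j)%N ->
  exists w, v = w *m tor_d F i.
Proof.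
move=> M_top vj vc irj.
have vE : const0 (map_mx (@mpolyC N k) v) = v.
  by apply/matrixP => a b; rewrite !mxE; exact: mpolyCK.
have /tor_cycleP{}vc : tor_cycle (const0 (map_mx (@mpolyC N k) v)) by rewrite vE.
rewrite -vE; apply/tor_boundP; apply: (acyclic_above (r := r) (j := j)) vc => //.
  by rewrite leq_addr leqnn.
apply/forallP => a; rewrite mxE; have := vj a.
have [->|_ /(_ isT)->] := eqVneq (deg i a) j; last first.
  by rewrite raddf0 eqxx; case: ifP => // _; exact: dhomog0.
by rewrite leqnn subnn -[_%:MP]mulr1 mul_mpolyC => _; apply: dhomogZ; exact: dhomog1.
Qed.

Lemma gen_lift j x : x \in @gm_pc _ _ M j ->
  exists2 v, free_homog (deg 0) j v & x = gen v.
Proof.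
move=> xj; have [v xE] := res_surj F x; exists (hproj (deg 0) j v).
  exact: hproj_homog.
rewrite -[x]/(x) {}xE in xj *.
by rewrite (gen_hproj (@res_gen_homog _ _ _ F) xj) eqxx.
Qed.

(** On the line j = i + r the connecting map H_(i+1)(G / l_t G) -> H_i(G) is onto,
    because l_t kills H_i(G) there for degree reasons. So a nonzero class of
    degree r in M / (l_0, ..., l_(D-1)) M survives, one position higher for each of
    the c other linear forms. *)
Lemma koszul_not_bound r (x : M) :
  (forall j (x : M), (r < j)%N -> x \in @gm_pc _ _ M j -> combo l D x) ->
  x \in @gm_pc _ _ M r -> ~ combo l D x ->
  forall i, (i <= c)%N -> exists v : 'rV[R]_(res_rk F i),
    [/\ free_homog (deg i) (i + r) v, koszul_cycle (D + i) v
      & ~ koszul_bound (D + i) v].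
Proof.
move=> M_top xr xD; elim=> [|i IH] ic.
  have [v vr xE] := gen_lift xr; exists v; rewrite addn0; split=> // -[w hw].
  apply: xD; rewrite xE -[gen v]subr0 -(gen_d w) -genB.
  exact: gen_combo hw.
have [v [vh vc vb]] := IH (ltnW ic); pose t := (D + i)%N.
have tDc : (t < D + c)%N by rewrite ltn_add2l.
have lvc : koszul_cycle t (l t *: v) by exact: koszul_cycleZ.
have : koszul_bound t (l t *: v).
  apply: (acyclic_above (r := r) (j := (i + r).+1)) lvc => //.
    by rewrite leq_addr ltnW.
  exact: free_homogZ.
case/(bound_homog (free_homogZ t vh)) => w wh hw; exists w; split=> //.
  rewrite addnS; apply/comboS; exists v; rewrite -opprB; exact: comboN.
rewrite addnS -/t => -[w' /comboS[u hu]]; apply: vb; exists u.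
apply: (regular_rV (l_reg tDc)); rewrite scalerBr.
have := combo_linear (mulmxr (dd i)) hu.
rewrite /= !mulmxBl res_dd subr0 -scalemxAl => hu'.
by rewrite -(subrKA (w *m dd i)); exact: comboD.
Qed.

Lemma tor_corner r (x : M) :
  (forall j (x : M), (r < j)%N -> x \in @gm_pc _ _ M j -> combo l D x) ->
  x \in @gm_pc _ _ M r -> ~ combo l D x -> tor_neq0 M c (c + r).
Proof.
move=> M_top xr xD.
have [v [vh vc vb]] := koszul_not_bound M_top xr xD (leqnn c).
exists F, (const0 v); split; last 2 first.
- exact/tor_cycleP.
- by move=> /tor_boundP.
move=> a ac; rewrite mxE; have /forallP/(_ a) := vh.
case: leqP => [ar hv|_ /eqP->]; last by rewrite mcoeff0.
apply: (dhomog_nemf_coeff hv).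
by rewrite [X in X != _]mdeg0 eq_sym subn_eq0 -ltnNge ltn_neqAle ac.
Qed.

End Koszul.

(** * Existence of graded free resolutions *)

Section Noetherian.

(** Induction on n. Take a finite L0 that dominates S in the coordinates below n,
    and M bounding the last coordinate on L0: if the last coordinate of x is at
    least M then L0 serves, and there are only M other values, each of which is
    treated by induction. *)
Lemma dickson (X : eqType) (F : X -> nat -> nat) n (S : X -> Prop) :
  exists2 L : seq X, (forall x, x \in L -> S x) &
    forall x, S x -> exists2 y, y \in L & forall i, (i < n)%N -> (F y i <= F x i)%N.
Proof.
elim: n S => [|n IH] S.
  have [[x Sx]|nS] := pselect (exists x, S x); last first.
    by exists [::] => // x Sx; case: nS; exists x.
  by exists [:: x] => [y|y _]; [rewrite inE => /eqP ->|exists x; rewrite ?inE].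
have [L0 L0S L0P] := IH S.
have /choice[L LP] : forall c, exists L : seq X,
    (forall x, x \in L -> S x /\ F x n = c) /\ forall x, S x /\ F x n = c ->
    exists2 y, y \in L & forall i, (i < n)%N -> (F y i <= F x i)%N.
  by move=> c; have [L LS LP] := IH (fun x => S x /\ F x n = c); exists L.
pose M := (\max_(x <- L0) F x n)%N.
exists (L0 ++ flatten [seq L c | c <- iota 0 M]) => [x|x Sx].
  rewrite mem_cat => /orP[/L0S //|/flatten_mapP[c _]].
  by have [+ _] := LP c => /[apply] -[].
have [Mx|xM] := leqP M (F x n).
  have [y yL yx] := L0P x Sx; exists y; first by rewrite mem_cat yL.
  move=> i; rewrite ltnS leq_eqVlt => /orP[/eqP->|/yx //].
  by apply: leq_trans Mx; exact: leq_bigmax_seq.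
have [LS /(_ x)[//|y yL yx]] := LP (F x n); exists y.
  rewrite mem_cat; apply/orP; right; apply/flatten_mapP; exists (F x n) => //.
  by rewrite mem_iota.
move=> i; rewrite ltnS leq_eqVlt => /orP[/eqP->|/yx //].
by have [_ ->] := LS _ yL.
Qed.

Variables (k : fieldType) (N : nat).
Local Notation R := {mpoly k[N]}.

(** Elements of I whose leading monomials generate those of I generate I:
    subtracting a multiple of one of them lowers the leading monomial. *)
Lemma hilbert_basis (I : R -> Prop) :
  (forall p q, I p -> I q -> I (p - q)) -> (forall r p, I p -> I (r * p)) ->
  exists2 L : seq R, (forall p, p \in L -> I p) &
    forall p, I p -> combo (nth 0 L) (size L) (p : R^o).
Proof.
move=> IB IM.
pose F (p : R) i := if insub i is Some j then mlead p (j : 'I_N) else 0%N.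
have [L LI LP] := dickson F N (fun p => I p /\ p != 0).
exists L => [p /LI[] //|p].
elim/mleadrect: p => p IH Ip.
have [->|p0] := eqVneq p 0; first exact: combo0.
have [q qL qp] := LP p (conj Ip p0); have [Iq q0] := LI q qL.
have {}qp : (mlead q <= mlead p)%MM.
  by apply/mnm_lepP => i; have := qp i (ltn_ord i); rewrite /F valK.
pose r := (mleadc p / mleadc q) *: 'X_[mlead p - mlead q] : R.
have cq0 : mleadc q != 0 by rewrite mleadc_eq0.
have cp0 : mleadc p != 0 by rewrite mleadc_eq0.
have r0 : mleadc p / mleadc q != 0 by rewrite mulf_neq0 ?invr_eq0.
have rE : mlead r = (mlead p - mlead q)%MM by rewrite mleadZ // mleadXm.
have rn0 : r != 0 by rewrite -mleadc_eq0 rE mcoeffZ mcoeffX eqxx mulr1.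
have rqE : mlead (r * q) = mlead p by rewrite mleadM // rE submK.
have rqc : (r * q)@_(mlead p) = mleadc p.
  transitivity ((r * q)@_(mlead r + mlead q)); first by rewrite -mleadM // rqE.
  by rewrite mleadcM rE mcoeffZ mcoeffX eqxx mulr1 mulfVK.
have -> : p = (p - r * q) + r * q by rewrite subrK.
apply: (@comboD _ _ R^o); last first.
  have := @combo_gen _ (nth 0 L) R^o (index q L) (size L) r.
  by rewrite index_mem nth_index // mulrC => /(_ qL).
have [->|pr0] := eqVneq (p - r * q) 0; first exact: (@combo0 _ _ R^o).
apply: IH; last by apply: IB => //; exact: IM.
rewrite lt_neqAle; apply/andP; split.
  apply: contra_neq pr0 => pE; apply/eqP; rewrite -mleadc_eq0 pE.
  by rewrite mcoeffB rqc subrr.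
by apply: le_trans (mleadB_le _ _) _; rewrite rqE joinxx.
Qed.

(** Induction on b: the first coordinates of K form an ideal, and the elements whose
    first coordinate is 0 a submodule of R^b. *)
Lemma noetherian b (K : 'rV[R]_b -> Prop) :
  K 0 -> (forall v w, K v -> K w -> K (v - w)) -> (forall r v, K v -> K (r *: v)) ->
  exists m (d : 'M[R]_(m, b)), forall v, K v <-> exists w, v = w *m d.
Proof.
elim: b K => [|b IH]; last rewrite -[b.+1]/(1 + b)%N; move=> K K0 KB KZ.
  exists 0%N, 0 => v; split=> [_|_]; last by rewrite thinmx0.
  by exists 0; rewrite !thinmx0.
have KN v : K v -> K (- v) by move=> Kv; rewrite -sub0r; exact: KB.
have KD v w : K v -> K w -> K (v + w) by move=> Kv Kw; rewrite -[w]opprK; exact/KB/KN.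
have [L LI LP] : exists2 L : seq R,
    (forall p, p \in L -> exists2 v : 'rV[R]_(1 + b), K v & v 0 0 = p) &
    forall p, (exists2 v : 'rV[R]_(1 + b), K v & v 0 0 = p) ->
       combo (nth 0 L) (size L) (p : R^o).
  apply: hilbert_basis => [p q [v Kv <-] [w Kw <-]|r p [v Kv <-]].
    by exists (v - w); rewrite ?mxE //; exact: KB.
  by exists (r *: v); rewrite ?mxE //; exact: KZ.
have /choice[u uP] : forall i : 'I_(size L), exists v : 'rV[R]_(1 + b), K v /\ v 0 0 = L`_i.
  by move=> i; have [v Kv vE] := LI _ (mem_nth 0 (ltn_ord i)); exists v.
have Ku (w : 'rV_(size L)) : K (w *m \matrix_i u i).
  rewrite mulmx_sum_row; apply: (big_ind K) => // i _.
  by apply: KZ; rewrite rowK; have [] := uP i.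
have [||| m [d dP]] := IH (fun v => K (row_mx (0 : 'M_(1, 1)) v)).
- by rewrite row_mx0.
- move=> v w Kv Kw.
  have -> : row_mx (0 : 'M_(1, 1)) (v - w) = row_mx 0 v - row_mx 0 w :> 'M_(1, 1 + b).
    by rewrite opp_row_mx add_row_mx oppr0 addr0.
  exact: KB.
- move=> r v Kv.
  have -> : row_mx (0 : 'M_(1, 1)) (r *: v) = r *: row_mx 0 v :> 'M_(1, 1 + b).
    by rewrite scale_row_mx scaler0.
  exact: KZ.
exists (size L + m)%N, (col_mx (\matrix_i u i) (row_mx (0 : 'M_(m, 1)) d)) => v.
split=> [Kv|[w ->]]; last first.
  rewrite -[w]hsubmxK mul_row_col mul_mx_row mulmx0; apply: KD => //.
  by apply/dP; exists (rsubmx w).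
have [q qE] := LP _ (ex_intro2 _ _ v Kv erefl).
pose w1 : 'rV[R]_(size L) := \row_i q i.
pose v' : 'rV[R]_(1 + b) := v - w1 *m \matrix_i u i.
have v'E : v' = row_mx (0 : 'M_(1, 1)) (rsubmx v').
  rewrite -[LHS]hsubmxK; congr row_mx; apply/rowP => i; rewrite !mxE.
  rewrite ord1 (_ : lshift b 0 = 0); last exact: val_inj.
  apply/eqP; rewrite subr_eq0 qE; apply/eqP/eq_bigr => j _.
  by rewrite !mxE (proj2 (uP j)) mulrC.
have /dP[w2 w2E] : K (row_mx (0 : 'M_(1, 1)) (rsubmx v')).
  by rewrite -v'E; apply: KB.
exists (row_mx w1 w2); rewrite mul_row_col mul_mx_row mulmx0 -w2E -v'E /v'.
by rewrite addrC subrK.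
Qed.

Definition homog_mx b b' (a : 'I_b -> nat) (a' : 'I_b' -> nat) (d : 'M[R]_(b', b)) :=
  forall r, free_homog a (a' r) (row r d).

(** A graded submodule is generated by the homogeneous parts of any generators. *)
Lemma graded_noetherian b (a : 'I_b -> nat) (K : 'rV[R]_b -> Prop) :
  K 0 -> (forall v w, K v -> K w -> K (v - w)) -> (forall r v, K v -> K (r *: v)) ->
  (forall j v, K v -> K (hproj a j v)) ->
  exists m (a' : 'I_m -> nat) (d : 'M[R]_(m, b)),
    homog_mx a a' d /\ forall v, K v <-> exists w, v = w *m d.
Proof.
move=> K0 KB KZ Kh; have [m [d dP]] := noetherian K0 KB KZ.
have KD v w : K v -> K w -> K (v + w).
  by move=> Kv Kw; rewrite -[w]opprK -[- w]sub0r; apply/KB/KB.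
have Krow i : K (row i d) by apply/dP; exists (delta_mx 0 i); rewrite rowE.
have /choice[T TP] : forall i, exists T, forall T', (T <= T')%N ->
    row i d = \sum_(j < T') hproj a j (row i d) by move=> i; exact: hproj_decomp.
pose T' := (\max_i T i)%N.
pose idx := ('I_m * 'I_T')%type; pose f (e : idx) := hproj a e.2 (row e.1 d).
exists #|{: idx}|, (fun r => nat_of_ord (enum_val r : idx).2), (\matrix_r f (enum_val r : idx)).
split=> [r|v]; first by rewrite rowK; exact: hproj_homog.
split=> [/dP[w ->]|[w ->]]; last first.
  rewrite mulmx_sum_row; apply: (big_ind K) => // r _.
  by rewrite rowK; apply/KZ/Kh.
exists (\row_r w 0 (enum_val r : idx).1); rewrite !mulmx_sum_row.
transitivity (\sum_(e : idx) w 0 e.1 *: f e).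
  rewrite -(pair_bigA _ (fun i j => w 0 i *: f (i, j))) /=; apply: eq_bigr => i _.
  by rewrite {1}(TP i T') ?scaler_sumr //; exact: leq_bigmax.
rewrite (reindex (@enum_val idx predT)) /=; last exact: onW_bij (enum_val_bij _).
by apply: eq_bigr => r _; rewrite rowK mxE.
Qed.

Record stage := Stage {
  st_b : nat; st_a : 'I_st_b -> nat; st_b' : nat; st_a' : 'I_st_b' -> nat;
  st_d : 'M[R]_(st_b', st_b); st_homog : homog_mx st_a st_a' st_d }.

Lemma next_syzygy (s : stage) : exists e : {m : nat & (('I_m -> nat) * 'M[R]_(m, st_b' s))%type},
  homog_mx (@st_a' s) (projT2 e).1 (projT2 e).2 /\
  forall v : 'rV_(st_b' s), v *m st_d s = 0 <-> exists w, v = w *m (projT2 e).2.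
Proof.
have [|v w hv hw|r v hv|j v hv|m [a [d [dh dP]]]] :=
  @graded_noetherian _ (@st_a' s) (fun v => v *m st_d s = 0).
- exact: mul0mx.
- by rewrite mulmxBl hv hw subrr.
- by rewrite -scalemxAl hv scaler0.
- rewrite -(hproj_mul _ _ (@st_homog s)) hv.
  exact: hproj0.
by exists (existT _ m (a, d)).
Qed.

Definition next_stage (s : stage) : stage :=
  Stage (proj1 (projT2 (cid (next_syzygy s)))).

Lemma next_stageP s (v : 'rV_(st_b' s)) :
  v *m st_d s = 0 <-> exists w, v = w *m st_d (next_stage s).
Proof. exact: (proj2 (projT2 (cid (next_syzygy s)))). Qed.

Lemma resolution_exists (M : gradedModule k N) b (a : 'I_b -> nat) (g : 'I_b -> M) :
  (forall c, g c \in gm_pc (a c)) -> (forall x, exists v, x = gen g v) ->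
  exists F : resolution M, True.
Proof.
move=> gh gsurj; have genh := gen_hproj gh.
have [|v w hv hw|r v hv|j v hv|m [a' [d [dh dP]]]] :=
  @graded_noetherian _ a (fun v => gen g v = 0).
- exact: gen0.
- by rewrite genB hv hw subrr.
- by rewrite genZ hv scaler0.
- have v0 : gen g v \in @gm_pc _ _ M 0 by rewrite hv; have [] := @gm_pc_zmod _ _ M 0.
  by rewrite (genh _ _ v0) hv if_same.
pose X i := iter i next_stage (Stage dh).
unshelve eexists (@Resolution _ _ M (fun i => st_b (X i)) (fun i => @st_a (X i)) g
  (fun i => st_d (X i)) gh _ _ _ _) => //.
- by move=> i; exact: st_homog.
- by move=> i v; exact: next_stageP.
Qed.

End Noetherian.

(** * A basis of the linear forms of R that extends theta *)

Section Variables.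
Variables (k : fieldType) (N : nat) (sigma : nat -> 'I_N).
Local Notation R := {mpoly k[N]}.
Hypothesis sigma_inj : forall s t, (s < N)%N -> (t < N)%N -> sigma s = sigma t -> s = t.

Definition vars t : R := 'X_(sigma t).

(** The ideal of some of the variables is a monomial ideal. *)
Lemma combo_varsP t (p : R) :
  combo vars t (p : R^o) <->
  forall m, m \in msupp p -> exists2 s, (s < t)%N & m (sigma s) != 0%N.
Proof.
split=> [[q ->] m|hp].
  move=> /msupp_sum_le /flatten_mapP[s _] /msuppM_le /allpairsP[[m1 m2] /= [+ _ ->]].
  rewrite msuppX inE => /eqP ->; exists s => //.
  by rewrite mnmDE mnm1E eqxx.
rewrite (mpolyE p) big_seq; apply: (big_ind (combo vars t)).
- exact: (@combo0 _ _ R^o).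
- exact: (@comboD _ _ R^o).
move=> m /hp[s st ms].
have Um : (U_(sigma s) <= m)%MM by rewrite lep1mP.
have -> : p@_m *: 'X_[m] = vars s * (p@_m *: 'X_[m - U_(sigma s)]).
  by rewrite -scalerAr -mpolyXD addmC submK.
exact: (@combo_gen _ vars R^o).
Qed.

Lemma regular_vars t : (t < N)%N -> regular_at vars R^o t.
Proof.
move=> tN p /combo_varsP hp; apply/combo_varsP => m mp.
have [|s st] := hp (m + U_(sigma t))%MM.
  by rewrite [_ *: _]mulrC (perm_mem (msuppMX _ _)) addmC mem_map //; exact: addmI.
have sN : (s < N)%N := ltn_trans st tN.
rewrite mnmDE mnm1E; case: (sigma t =P sigma s) => [/(sigma_inj tN sN) ts|_].
  by rewrite ts ltnn in st.
by rewrite addn0; exists s.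
Qed.

End Variables.

Section LinearForms.
Variables (k : fieldType) (N : nat).
Local Notation R := {mpoly k[N]}.

(** Substitutions that are inverse to each other on the variables are inverse. *)
Lemma comp_mpolyK (a b : N.-tuple R) :
  (forall i, tnth a i \mPo b = 'X_i) -> cancel (comp_mpoly a) (comp_mpoly b).
Proof.
move=> ab p; rewrite [p \mPo a]comp_mpolyE linear_sum /=.
rewrite -[RHS]comp_mpoly_id [RHS]comp_mpolyE; apply: eq_bigr => m _.
rewrite linearZ rmorph_prod /=; congr (_ *: _); apply: eq_bigr => i _.
by rewrite rmorphXn /= ab tnth_mktuple.
Qed.

Variables (sigma : nat -> 'I_N) (a b : N.-tuple R).
Hypothesis sigma_inj : forall s t, (s < N)%N -> (t < N)%N -> sigma s = sigma t -> s = t.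
Hypothesis ab : forall i, tnth a i \mPo b = 'X_i.
Hypothesis ba : forall i, tnth b i \mPo a = 'X_i.
Hypothesis b_homog : forall i, tnth b i \is 1.-homog.

Definition forms t := tnth a (sigma t).

(** The change of coordinates a carries the variables to the new linear forms, so
    all questions about the latter reduce to the variables. *)
Lemma combo_forms t (p : R) :
  combo forms t (p : R^o) <-> combo (vars k sigma) t (comp_mpoly b p : R^o).
Proof.
rewrite !comboR; split=> [[q ->]|[q pE]].
  exists (fun s => comp_mpoly b (q s)); rewrite linear_sum; apply: eq_bigr => s _.
  by rewrite /= rmorphM /= ab.
exists (fun s => comp_mpoly a (q s)); rewrite -[LHS](comp_mpolyK ba) [_ \mPo b]pE.
rewrite linear_sum; apply: eq_bigr => s _.
by rewrite /= rmorphM /= comp_mpolyXU -tnth_nth.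
Qed.

Lemma regular_forms t : (t < N)%N -> regular_at forms R^o t.
Proof.
move=> tN p /combo_forms; rewrite [_ *: _]/(_ * _) rmorphM /= ab.
by move/(regular_vars sigma_inj tN)/combo_forms.
Qed.

Lemma forms_max (p : R) : p@_0%MM = 0 -> combo forms N (p : R^o).
Proof.
have sigma_surj i : exists2 s, (s < N)%N & sigma s = i.
  have inj : injective (fun s : 'I_N => sigma s).
    by move=> s t /(sigma_inj (ltn_ord s) (ltn_ord t)); exact: val_inj.
  have [g _ gK] := injF_bij inj.
  by exists (g i) => //; exact: gK.
move=> p0; apply/combo_forms/combo_varsP => m mp.
have m0 : m != 0%MM.
  apply: contraTneq mp => ->.
  suff : (comp_mpoly b p)@_0%MM = 0 by rewrite mcoeff_msupp => ->; rewrite eqxx.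
  rewrite comp_mpolyE linear_sum big_seq big1 // => m' m'p.
  rewrite /= mcoeffZ; have [m'0|] := eqVneq m' 0%MM; first by rewrite m'0 p0 mul0r.
  move=> m'0; suff /dhomog_nemf_coeff -> : \prod_i tnth b i ^+ m' i \is (mdeg m').-homog.
  - by rewrite mulr0.
  - by rewrite [X in X != _]mdeg0 eq_sym mdeg_eq0.
  rewrite mdegE; apply: (big_ind2 (fun (p : R) t => p \is t.-homog)).
  - exact: dhomog1.
  - by move=> *; exact: dhomogM.
  by move=> i _; rewrite -[m' i in X in X.-homog]mul1n; apply: dhomogMn.
have [i mi] : exists i, m i != 0%N.
  apply/existsP; apply: contraNT m0; rewrite negb_exists => /forallP mi.
  by apply/eqP/mnmP => i; rewrite mnm0E; apply/eqP; rewrite -[_ == _]negbK mi.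
by have [s sN si] := sigma_surj i; exists s; rewrite // si.
Qed.

End LinearForms.

Section Theta.
Variables (k : fieldType) (n d : nat).
Hypothesis k_char0 : [pchar k] =i pred0.
Local Notation N := (nmon n d).
Local Notation R := {mpoly k[N]}.
Local Notation word := {ffun 'I_d -> 'I_n.+1}.

Definition mon (v : 'I_N) : 'X_{1.. n.+1} := val (val (enum_val v : monomial n d)).

(** The weight sum_j j m_j of the monomial m = mon v, so that theta_s only involves
    the monomials of weight s. *)
Definition weight (v : 'I_N) : nat := (\sum_(j < n.+1) j * mon v j)%N.

Definition content (f : word) : 'X_{1.. n.+1} := (\sum_a U_(f a))%MM.

Lemma mdeg_content f : mdeg (content f) = d.
Proof.
rewrite /content mdeg_sum (eq_bigr (fun _ => 1%N)) => [|a _]; last exact: mdeg1.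
by rewrite sum1_card card_ord.
Qed.

Lemma mdeg_mon v : mdeg (mon v) = d.
Proof. by apply/eqP; exact: (valP (enum_val v : monomial n d)). Qed.

Lemma mon_inj : injective mon.
Proof. by move=> u v /val_inj/val_inj/enum_val_inj. Qed.

Fact content_lt f : (mdeg (content f) < d.+1)%N.
Proof. by rewrite mdeg_content. Qed.

Fact content_eq f : mdeg (BMultinom (content_lt f)) == d.
Proof. by rewrite /= mdeg_content. Qed.

Definition word_index (f : word) : 'I_N :=
  enum_rank (exist _ (BMultinom (content_lt f)) (content_eq f) : monomial n d).

Lemma mon_word_index f : mon (word_index f) = content f.
Proof. by rewrite /mon /word_index enum_rankK. Qed.

Lemma mem_words f v : (f \in words d (mon v)) = (word_index f == v).
Proof. by rewrite inE -(inj_eq mon_inj) mon_word_index. Qed.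

Lemma contentE f j : content f j = (\sum_a (f a == j))%N.
Proof. by rewrite /content mnm_sumE; apply: eq_bigr => a _; rewrite mnm1E. Qed.

Lemma weight_word_index f : weight (word_index f) = (\sum_a f a)%N.
Proof.
rewrite /weight mon_word_index (eq_bigr (fun j : 'I_n.+1 => \sum_a j * (f a == j))%N).
  rewrite exchange_big; apply: eq_bigr => a _ /=.
  rewrite (bigD1 (f a)) //= eqxx muln1 big1 ?addn0 // => j.
  by rewrite eq_sym => /negPf ->; rewrite muln0.
by move=> j _; rewrite contentE big_distrr.
Qed.

Lemma weight_le v : (weight v <= d * n)%N.
Proof.
rewrite /weight -(mdeg_mon v) mdegE big_distrl /=; apply: leq_sum => j _.
by rewrite mulnC leq_mul2l -ltnS ltn_ord orbT.
Qed.

Definition nwords (v : 'I_N) : k := #|words d (mon v)|%:R.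

Lemma nwords_neq0 f : nwords (word_index f) != 0.
Proof.
rewrite /nwords; have /pcharf0P -> := k_char0; rewrite -lt0n card_gt0.
by apply/set0Pn; exists f; rewrite mem_words.
Qed.

(** The linear form of R whose image in A is theta_s: the factors nwords undo the
    averaging over words in symtensor. *)
Definition Theta s : R := \sum_(v | weight v == s) nwords v *: 'X_v.

(** The coefficient of T^s in prod_a (sum_j x_(a,j) T^j). *)
Definition theta s : symtens k n d :=
  \sum_(f : word | (\sum_a f a)%N == s) \prod_a xvar k a (f a).

Lemma symsym_mapX v : symsym_map (nwords v *: 'X_v) =
  \sum_(f in words d (mon v)) \prod_a xvar k a (f a).
Proof.
rewrite /symsym_map linearZ /= comp_mpolyXU -tnth_nth tnth_mktuple -/(mon v).
rewrite -mul_mpolyC /symtensor mulrA.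
have [w0|w0] := eqVneq (words d (mon v)) set0.
  by rewrite w0 !big_set0 mulr0.
have : nwords v != 0 by rewrite /nwords; have /pcharf0P -> := k_char0; rewrite cards_eq0.
by move=> nv; rewrite -rmorphM /= -/(nwords v) mulfV // mul1r.
Qed.

Lemma symsym_map_Theta s : symsym_map (Theta s) = theta s.
Proof.
rewrite /symsym_map linear_sum (eq_bigr _ (fun v _ => symsym_mapX v)) /=.
rewrite /theta (partition_big word_index (fun v => weight v == s)) /=.
  apply: eq_bigr => v /eqP vs; apply: eq_bigl => f.
  rewrite mem_words; case: eqP => [fv|_]; last by rewrite andbF.
  by rewrite andbT -weight_word_index fv vs eqxx.
by move=> f; rewrite weight_word_index.
Qed.

Lemma homogX v : ('X_v : R) \is 1.-homog.
Proof. by rewrite dhomogX; apply/eqP; exact: mdeg1. Qed.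

Lemma Theta_homog s : Theta s \is 1.-homog.
Proof.
rewrite /Theta; apply: (big_ind (fun p : R => p \is 1.-homog)) => [|p q|v _].
- exact: dhomog0.
- exact: dhomogD.
by apply: dhomogZ; exact: homogX.
Qed.

Definition greedy_word s : word := [ffun a : 'I_d => inord (minn n (s - a * n))].

Lemma sum_greedy_word s : (s <= d * n)%N -> (\sum_a greedy_word s a)%N = s.
Proof.
move=> sdn; have sumE e : (\sum_(a < e) minn n (s - a * n))%N = minn (e * n) s.
  elim: e => [|e IH]; first by rewrite big_ord0 min0n.
  rewrite big_ord_recr /= IH mulSn; have [es|es] := leqP s (e * n); last lia.
  by rewrite (eqP (es : _ - _ == 0)%N) minn0; lia.
rewrite -[RHS](minn_idPr sdn) -sumE; apply: eq_bigr => a _.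
by rewrite ffunE inordK // ltnS geq_minl.
Qed.

(** One monomial of each weight 0, ..., dn. In the new coordinates Theta_s takes the
    place of the variable of pivot s, and the other variables are kept. *)
Definition pivot s := word_index (greedy_word s).

Lemma weight_pivot s : (s <= d * n)%N -> weight (pivot s) = s.
Proof. by move=> sdn; rewrite weight_word_index sum_greedy_word. Qed.

Definition is_pivot v := v == pivot (weight v).

Lemma is_pivotP s : (s <= d * n)%N -> is_pivot (pivot s).
Proof. by move=> sdn; rewrite /is_pivot weight_pivot. Qed.

Definition newform v : R := if is_pivot v then Theta (weight v) else 'X_v.

Definition oldform v : R :=
  if is_pivot v then
    (nwords v)^-1 *: ('X_v - \sum_(u | (weight u == weight v) && (u != v)) nwords u *: 'X_u)
  else 'X_v.

Lemma nwords_pivot v : is_pivot v -> nwords v != 0.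
Proof. by move=> /eqP ->; exact: nwords_neq0. Qed.

Lemma not_pivot u v : is_pivot v -> weight u = weight v -> u != v -> is_pivot u = false.
Proof. by rewrite /is_pivot => /eqP vp ->; rewrite -vp => /negPf. Qed.

Lemma ThetaD1 v : Theta (weight v) = nwords v *: 'X_v +
  \sum_(u | (weight u == weight v) && (u != v)) nwords u *: 'X_u.
Proof. by rewrite /Theta (bigD1 v). Qed.

Lemma newformK v : newform v \mPo [tuple oldform u | u < N] = 'X_v.
Proof.
rewrite /newform; case: ifP => pv; last first.
  by rewrite comp_mpolyXU -tnth_nth tnth_mktuple /oldform pv.
rewrite ThetaD1 comp_mpolyD linearZ linear_sum /= comp_mpolyXU -tnth_nth tnth_mktuple.
rewrite {1}/oldform pv scalerA mulfV ?nwords_pivot // scale1r.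
rewrite [X in _ + X](_ : _ = \sum_(u | (weight u == weight v) && (u != v)) nwords u *: 'X_u).
  by rewrite subrK.
apply: eq_bigr => u /andP[/eqP uv nuv]; rewrite linearZ /= comp_mpolyXU.
by rewrite -tnth_nth tnth_mktuple /oldform (not_pivot pv).
Qed.

Lemma oldformK v : oldform v \mPo [tuple newform u | u < N] = 'X_v.
Proof.
rewrite /oldform; case: ifP => pv; last first.
  by rewrite comp_mpolyXU -tnth_nth tnth_mktuple /newform pv.
have sumE : (\sum_(u | (weight u == weight v) && (u != v)) nwords u *: 'X_u)
    \mPo [tuple newform u | u < N] =
    \sum_(u | (weight u == weight v) && (u != v)) nwords u *: 'X_u.
  rewrite linear_sum; apply: eq_bigr => u /andP[/eqP uv nuv].
  by rewrite linearZ /= comp_mpolyXU -tnth_nth tnth_mktuple /newform (not_pivot pv).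
rewrite linearZ /= comp_mpolyB sumE comp_mpolyXU -tnth_nth tnth_mktuple.
by rewrite /newform pv ThetaD1 addrK scalerA mulVf ?nwords_pivot // scale1r.
Qed.

Lemma newform_homog v : newform v \is 1.-homog.
Proof. by rewrite /newform; case: ifP => _; [exact: Theta_homog|exact: homogX]. Qed.

Lemma oldform_homog v : oldform v \is 1.-homog.
Proof.
rewrite /oldform; case: ifP => _; last exact: homogX.
apply: dhomogZ; apply: dhomogD; rewrite ?dhomogN ?homogX //.
apply: (big_ind (fun p : R => p \is 1.-homog)) => [|p q|u _].
- exact: dhomog0.
- exact: dhomogD.
exact/dhomogZ/homogX.
Qed.

Local Notation D := (d * n).+1.

(* The variables are listed with the pivots first, so that the new linear forms
   start with Theta_0, ..., Theta_(dn). *)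
Definition pivots_first : seq 'I_N :=
  [seq pivot s | s <- iota 0 D] ++ [seq v <- enum 'I_N | ~~ is_pivot v].

Lemma pivots_first_uniq : uniq pivots_first.
Proof.
rewrite cat_uniq filter_uniq ?enum_uniq // andbT; apply/andP; split.
  rewrite map_inj_in_uniq ?iota_uniq // => s t; rewrite !mem_iota !add0n !ltnS /=.
  by move=> sD tD /(congr1 weight); rewrite !weight_pivot.
apply/hasPn => v; rewrite mem_filter => /andP[npv _].
apply: contra npv => /mapP[s]; rewrite mem_iota add0n ltnS /= => sD ->.
exact: is_pivotP.
Qed.

Lemma size_pivots_first : size pivots_first = N.
Proof.
rewrite -[RHS](card_ord N) cardE; apply/perm_size/uniq_perm.
- exact: pivots_first_uniq.
- exact: enum_uniq.
move=> v; rewrite mem_enum [RHS]inE mem_cat mem_filter mem_enum andbT.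
have [pv|_] := boolP (is_pivot v); last by rewrite !orbT.
rewrite orbF (eqP pv); apply/mapP; exists (weight v); rewrite // mem_iota ltnS.
exact: weight_le.
Qed.

Lemma D_le_N : (D <= N)%N.
Proof. by rewrite -size_pivots_first size_cat size_map size_iota leq_addr. Qed.

Definition sigma t : 'I_N := nth (pivot 0) pivots_first t.

Lemma sigma_inj s t : (s < N)%N -> (t < N)%N -> sigma s = sigma t -> s = t.
Proof.
move=> sN tN /eqP; rewrite nth_uniq ?size_pivots_first //; first exact/eqP.
exact: pivots_first_uniq.
Qed.

Definition lform t := forms sigma [tuple newform v | v < N] t.

Lemma lformE s : (s < D)%N -> lform s = Theta s.
Proof.
move=> sD; rewrite /lform /forms tnth_mktuple /sigma nth_cat size_map size_iota sD.
rewrite (nth_map 0%N) ?size_iota // nth_iota //.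
by rewrite /newform is_pivotP // weight_pivot.
Qed.

Lemma lform_homog t : lform t \is 1.-homog.
Proof. by rewrite /lform /forms tnth_mktuple newform_homog. Qed.

Lemma lform_reg t : (t < N)%N -> regular_at lform R^o t.
Proof.
apply: (@regular_forms _ _ sigma _ [tuple oldform v | v < N]).
- exact: sigma_inj.
- by move=> v; rewrite tnth_mktuple newformK.
- by move=> v; rewrite tnth_mktuple oldformK.
Qed.

Lemma lform_max (p : R) : p@_0%MM = 0 -> combo lform N (p : R^o).
Proof.
apply: (@forms_max _ _ sigma _ [tuple oldform v | v < N]).
- exact: sigma_inj.
- by move=> v; rewrite tnth_mktuple newformK.
- by move=> v; rewrite tnth_mktuple oldformK.
- by move=> v; rewrite tnth_mktuple oldform_homog.
Qed.

End Theta.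

(** * Regular sequences and extensions of modules *)

Section Filtration.
Variables (k : fieldType) (K : nat).
Local Notation P := {mpoly k[K]}.
Variables (D : nat) (th : nat -> P).

Definition span_mod (I Z : P -> Prop) t s (p : P) : Prop :=
  exists i (q : nat -> P), [/\ I i, forall v, Z (q v) & p = i + \sum_(t <= v < s) th v * q v].

Record ideal_like (I : P -> Prop) : Prop := IdealLike {
  ideal0 : I 0;
  idealB : forall p q, I p -> I q -> I (p - q);
  idealM : forall r p, I p -> I (r * p) }.

Record graded_like (Z : nat -> P -> Prop) : Prop := GradedLike {
  gr0 : forall m, Z m 0;
  grB : forall m p q, Z m p -> Z m q -> Z m (p - q);
  grC : forall m (c : k) p, Z m p -> Z m (c%:MP * p);
  gr_th : forall m v p, Z m.-1 p -> Z m (th v * p) }.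

(** The sequence th_t, ..., th_(D-1) is regular on Z / I. The components of Z are
    numbered so that Z 0 = 0 in all uses; this gives a meaning to m.-1. *)
Definition reg_seq (Z : nat -> P -> Prop) I t := forall s m p, (t <= s < D)%N ->
  Z m p -> span_mod I (Z m) t s (th s * p) -> span_mod I (Z m.-1) t s p.

(** In degree m the quotient of Z / I by th_t, ..., th_(D-1) is zero if b is false,
    and at most a line if b is true. *)
Definition top_rank (b : bool) (Z : nat -> P -> Prop) I t m :=
  exists p1 : P, [/\ Z m p1, ~~ b -> p1 = 0 & forall p, Z m p ->
    exists c : k, span_mod I (Z m.-1) t D (p - c%:MP * p1)].

Lemma idealD I : ideal_like I -> forall p q, I p -> I q -> I (p + q).
Proof. by move=> [I0 IB _] p q Ip Iq; rewrite -[q]opprK -[- q]sub0r; apply/IB/IB. Qed.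

Lemma grD Z : graded_like Z -> forall m p q, Z m p -> Z m q -> Z m (p + q).
Proof.
move=> [Z0 ZB _ _] m p q Zp Zq; rewrite -[q]opprK -[- q]sub0r.
by apply: (ZB _ _ _ Zp); exact: ZB.
Qed.

Lemma gr_sum Z : graded_like Z -> forall m t s (q : nat -> P), (forall v, Z m.-1 (q v)) ->
  Z m (\sum_(t <= v < s) th v * q v).
Proof.
move=> hZ m t s q Zq; apply: (big_ind (Z m)); first exact: gr0.
  exact: grD.
by move=> v _; exact: gr_th.
Qed.

Section SpanMod.
Variables (I Z : P -> Prop).
Hypothesis hI : ideal_like I.
Hypothesis Z0 : Z 0.
Hypothesis ZB : forall p q, Z p -> Z q -> Z (p - q).

Lemma span_ideal t s i : I i -> span_mod I Z t s i.
Proof.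
move=> Ii; exists i, (fun _ => 0); split=> //.
by rewrite big1 ?addr0 // => v _; rewrite mulr0.
Qed.

Lemma spanB t s p q : span_mod I Z t s p -> span_mod I Z t s q ->
  span_mod I Z t s (p - q).
Proof.
move=> [i [x [Ii Zx ->]]] [j [y [Ij Zy ->]]].
exists (i - j), (fun v => x v - y v); split; first exact: (idealB hI).
  by move=> v; exact: ZB.
rewrite opprD addrACA -sumrB; congr (_ + _); apply: eq_bigr => v _.
by rewrite mulrBr.
Qed.

Lemma spanD t s p q : span_mod I Z t s p -> span_mod I Z t s q ->
  span_mod I Z t s (p + q).
Proof.
move=> hp hq; rewrite -[q]opprK -[- q]sub0r.
by apply: spanB => //; apply: spanB => //; exact/span_ideal/(ideal0 hI).
Qed.

Lemma span_gen t s q : (forall v, Z (q v)) ->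
  span_mod I Z t s (\sum_(t <= v < s) th v * q v).
Proof. by move=> Zq; exists 0, q; rewrite add0r; split=> //; exact: (ideal0 hI). Qed.

End SpanMod.

Lemma span_mono (I J Z Z' : P -> Prop) t s p : (forall p, I p -> J p) ->
  (forall p, Z p -> Z' p) -> span_mod I Z t s p -> span_mod J Z' t s p.
Proof.
by move=> IJ ZZ' [i [q [Ii Zq ->]]]; exists i, q; split=> // [|v]; [exact: IJ|exact: ZZ'].
Qed.

Lemma top_rankW Z I t m b : top_rank false Z I t m -> top_rank b Z I t m.
Proof. by move=> [p1 [Zp1 /(_ isT) p10 h]]; exists p1; split. Qed.

Lemma reg_seq_trivial Z I t : graded_like Z -> (forall m p, Z m p -> I p) ->
  reg_seq Z I t.
Proof. by move=> hZ ZI s m p _ Zp _; apply: span_ideal (ZI _ _ Zp); exact: gr0. Qed.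

Lemma top_rank_trivial Z I t m : graded_like Z -> (forall m p, Z m p -> I p) ->
  top_rank false Z I t m.
Proof.
move=> hZ ZI; exists 0; split=> [|//|p Zp]; [exact: gr0|exists 0; rewrite mulr0 subr0].
by apply: span_ideal (ZI _ _ Zp); exact: gr0.
Qed.

(** An extension 0 -> Z'/I' -> Z/I -> Z/I'' -> 0 whose first map is the multiplication
    by x. *)
Section Extension.
Variables (x : P) (Z Z' : nat -> P -> Prop) (I I' I'' : P -> Prop) (t : nat).
Hypotheses (hZ : graded_like Z) (hZ' : graded_like Z').
Hypotheses (hI : ideal_like I) (hI'' : ideal_like I'').
Hypothesis xZ' : forall m p, Z' m p -> Z m (x * p).
Hypothesis xI'' : forall m p, Z' m p -> I'' (x * p).
Hypothesis I''P : forall m p, Z m p -> I'' p -> exists2 z, Z' m z & I (p - x * z).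
Hypothesis xI : forall m p, Z' m p -> I (x * p) -> I' p.
Hypothesis I'I : forall p, I' p -> I (x * p).
Hypothesis II'' : forall p, I p -> I'' p.

Lemma span_lift m s p : Z m p -> span_mod I'' (Z m.-1) t s p ->
  exists2 z, Z' m z & span_mod I (Z m.-1) t s (p - x * z).
Proof.
move=> Zp [i [q [Ii Zq pE]]].
have Zi : Z m i.
  have -> : i = p - \sum_(t <= v < s) th v * q v by rewrite pE addrK.
  by apply: (grB hZ) Zp _; exact: (gr_sum hZ).
have [z Z'z Iz] := I''P Zi Ii; exists z => //; exists (i - x * z), q; split=> //.
by rewrite pE addrAC.
Qed.

(** Modulo th the first map stays injective, since th is regular on Z/I''. By
    induction on the length of the sequence: in an equation expressing x z, the last
    coefficient is, by regularity on Z/I'', a combination of the others modulo I''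
    and hence can be replaced by an element of x Z'. *)
Lemma span_restrict : reg_seq Z I'' t -> forall s m z, (s <= D)%N -> Z' m z ->
  span_mod I (Z m.-1) t s (x * z) -> span_mod I' (Z' m.-1) t s z.
Proof.
move=> hreg; elim=> [|s IH] m z sD Z'z.
  move=> [i [q [Ii _]]]; rewrite big_geq // addr0 => zE.
  by apply: span_ideal; [exact: gr0|apply: (xI Z'z); rewrite zE].
have [ts|st] := leqP t s; last first.
  move=> [i [q [Ii _]]]; rewrite big_geq // addr0 => zE.
  by apply: span_ideal; [exact: gr0|apply: (xI Z'z); rewrite zE].
move=> [i [q [Ii Zq zE]]].
rewrite big_nat_recr //= in zE.
have [y Z'y [i2 [q' [Ii2 Zq' q'E]]]] :
    exists2 y, Z' m.-1 y & span_mod I (Z m.-1.-1) t s (q s - x * y).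
  apply: span_lift (Zq s) _; apply: hreg (Zq s) _; first by rewrite ts.
  have -> : th s * q s = x * z - i - \sum_(t <= v < s) th v * q v.
    by rewrite zE; ring.
  apply: spanB => //; [exact: (grB hZ)|apply: spanB => //|].
  - exact: (grB hZ).
  - by apply: span_ideal; [exact: gr0|exact: xI'' Z'z].
  - by apply: span_ideal; [exact: gr0|exact: II''].
  by apply: span_gen.
have Z'w : Z' m (z - th s * y) by apply: (grB hZ') => //; exact: (gr_th hZ').
have /(IH _ _ (ltnW sD) Z'w) [j [w [Ij Z'w' wE]]] : span_mod I (Z m.-1) t s (x * (z - th s * y)).
  exists (i + th s * i2), (fun v => q v + th s * q' v); split.
  - by apply: idealD => //; exact: idealM.
  - by move=> v; apply: grD => //; exact: gr_th.
  rewrite (eq_bigr (fun v => th v * q v + th s * (th v * q' v))); last first.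
    by move=> v _; ring.
  rewrite big_split -mulr_sumr /= mulrBr zE.
  have -> : x * (th s * y) = th s * (q s - (i2 + \sum_(t <= v < s) th v * q' v)).
    by rewrite -q'E; ring.
  by ring.
exists j, (fun v => if v == s then y else w v); split=> //.
  by move=> v; case: ifP.
rewrite big_nat_recr //= eqxx; rewrite (eq_big_nat _ _ (F2 := fun v => th v * w v)).
  by rewrite addrA -wE subrK.
by move=> v /andP[_ vs]; rewrite ltn_eqF.
Qed.

Lemma reg_seq_ext : reg_seq Z' I' t -> reg_seq Z I'' t -> reg_seq Z I t.
Proof.
move=> hreg' hreg'' s m p tsD Zp hp; have /andP[ts sD] := tsD.
have : span_mod I'' (Z m.-1) t s p.
  by apply: hreg'' => //; apply: span_mono hp.
case/(span_lift Zp) => z Z'z hz.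
have : span_mod I (Z m) t s (x * (th s * z)).
  have -> : x * (th s * z) = th s * p - th s * (p - x * z) by ring.
  apply: spanB => //; first exact: (grB hZ).
  case: hz => i [q [Ii Zq ->]]; exists (th s * i), (fun v => th s * q v); split.
  - exact: idealM.
  - by move=> v; exact: gr_th.
  by rewrite mulrDr mulr_sumr; congr (_ + _); apply: eq_bigr => v _; rewrite mulrCA.
have Z'sz : Z' m.+1 (th s * z) by exact: gr_th.
move/(span_restrict hreg'' (ltnW sD) Z'sz) => /(hreg' _ _ _ tsD Z'z) [i [q [I'i Z'q zE]]].
have -> : p = (p - x * z) + x * z by rewrite subrK.
apply: spanD => //; first exact: gr0.
  exact: grB.
exists (x * i), (fun v => x * q v); split; first exact: I'I.
  by move=> v; exact: xZ'.
by rewrite zE mulrDr mulr_sumr; congr (_ + _); apply: eq_bigr => v _; rewrite mulrCA.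
Qed.

Lemma top_rank_ext b m : top_rank b Z' I' t m -> top_rank false Z I'' t m ->
  top_rank b Z I t m.
Proof.
move=> [p1 [Z'p1 p1b h']] [p2 [_ /(_ isT) -> h'']]; exists (x * p1).
split=> [|/p1b ->|p Zp]; [exact: xZ'|by rewrite mulr0|].
have [c0] := h'' p Zp; rewrite mulr0 subr0 => /(span_lift Zp)[z Z'z hz].
have [c [i [q [I'i Z'q zE]]]] := h' z Z'z; exists c.
have -> : p - c%:MP * (x * p1) = (p - x * z) + x * (z - c%:MP * p1) by ring.
apply: spanD => //; [exact: gr0|exact: grB|].
exists (x * i), (fun v => x * q v); split; first exact: I'I.
  by move=> v; exact: xZ'.
by rewrite zE mulrDr mulr_sumr; congr (_ + _); apply: eq_bigr => v _; rewrite mulrCA.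
Qed.

End Extension.

(** Division by the first element th_t of the sequence: I1 is I + th_t Z. *)
Section FirstElement.
Variables (Z : nat -> P -> Prop) (I I1 : P -> Prop) (t : nat).
Hypotheses (hZ : graded_like Z) (hI : ideal_like I) (hI1 : ideal_like I1).
Hypothesis tD : (t < D)%N.
Hypothesis II1 : forall p, I p -> I1 p.
Hypothesis thI1 : forall m q, Z m q -> I1 (th t * q).
Hypothesis I1P : forall m p, Z m p -> I1 p -> exists2 q, Z m.-1 q & I (p - th t * q).
Hypothesis th_nzd : forall m q, Z m q -> I (th t * q) -> I q.

Lemma span_first m s p : (t < s)%N -> Z m p ->
  span_mod I1 (Z m.-1) t.+1 s p -> span_mod I (Z m.-1) t s p.
Proof.
move=> ts Zp [i [q [Ii Zq pE]]].
have Zi : Z m i.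
  have -> : i = p - \sum_(t.+1 <= v < s) th v * q v by rewrite pE addrK.
  by apply: (grB hZ) Zp _; exact: (gr_sum hZ).
have [z Zz Iz] := I1P Zi Ii.
exists (i - th t * z), (fun v => if v == t then z else q v); split=> // [v|].
  by case: ifP.
rewrite big_ltn //= eqxx (eq_big_nat _ _ (F2 := fun v => th v * q v)).
  by rewrite addrA subrK.
by move=> v /andP[tv _]; rewrite gtn_eqF.
Qed.

Lemma reg_seq_first : reg_seq Z I1 t.+1 -> reg_seq Z I t.
Proof.
move=> hreg s m p /andP[ts sD] Zp; move: ts; rewrite leq_eqVlt => /orP[/eqP <-|ts].
  move=> [i [q [Ii _]]]; rewrite big_geq // addr0 => zE.
  by apply: span_ideal; [exact: gr0|apply: th_nzd Zp _; rewrite zE].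
move=> [i [q [Ii Zq pE]]]; apply: span_first => //; apply: hreg; rewrite ?ts //.
exists (i + th t * q t), q; split=> //.
  by apply: idealD => //; [exact: II1|exact: thI1 (Zq t)].
by rewrite pE big_ltn // addrA.
Qed.

Lemma top_rank_first b m : top_rank b Z I1 t.+1 m -> top_rank b Z I t m.
Proof.
move=> [p1 [Zp1 p1b h]]; exists p1; split=> // p Zp; have [c hc] := h p Zp; exists c.
by apply: span_first hc => //; apply: (grB hZ) => //; exact: (grC hZ).
Qed.

End FirstElement.

End Filtration.

(** * Segre products, by induction on the number of variables *)

Section Supports.
Variables (k : fieldType) (K : nat).
Local Notation P := {mpoly k[K]}.
Implicit Types (B C E : 'X_{1..K} -> Prop) (p q : P).

Definition supp_in B p := forall m, m \in msupp p -> B m.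

Lemma supp_in0 B : supp_in B 0.
Proof. by move=> m; rewrite msupp0. Qed.

Lemma supp_inD B p q : supp_in B p -> supp_in B q -> supp_in B (p + q).
Proof. by move=> hp hq m /msuppD_le; rewrite mem_cat => /orP[/hp|/hq]. Qed.

Lemma supp_inB B p q : supp_in B p -> supp_in B q -> supp_in B (p - q).
Proof. by move=> hp hq m /msuppB_le; rewrite mem_cat => /orP[/hp|/hq]. Qed.

Lemma supp_inX B m : B m -> supp_in B 'X_[m].
Proof. by move=> Bm m'; rewrite msuppX inE => /eqP ->. Qed.

Lemma supp_inZ B c p : supp_in B p -> supp_in B (c *: p).
Proof. by move=> hp m /msuppZ_le; exact: hp. Qed.

Lemma supp_in_sum B I (r : seq I) (Q : pred I) (F : I -> P) :
  (forall i, Q i -> supp_in B (F i)) -> supp_in B (\sum_(i <- r | Q i) F i).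
Proof. by move=> hF; apply: big_ind => //; [exact: supp_in0|exact: supp_inD]. Qed.

Lemma supp_inM B C E p q : (forall m1 m2, B m1 -> C m2 -> E (m1 + m2)%MM) ->
  supp_in B p -> supp_in C q -> supp_in E (p * q).
Proof.
by move=> BCE hp hq m /msuppM_le/allpairsP[[m1 m2] /= [m1p m2q ->]]; apply: BCE; auto.
Qed.

Lemma supp_in_mono B C p : (forall m, B m -> C m) -> supp_in B p -> supp_in C p.
Proof. by move=> BC hp m /hp/BC. Qed.

Lemma supp_inMX U p : supp_in (fun m => (m + U)%MM \in msupp ('X_[U] * p)) p.
Proof. by move=> m mp; rewrite mulrC (perm_mem (msuppMX _ _)) addmC map_f. Qed.

(** An element of a monomial ideal (A, U) is an element of (A) plus X_U z. *)
Lemma divide_supp (A : pred 'X_{1..K}) U p : supp_in (fun m => A m || (U <= m)%MM) p ->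
  exists2 z, supp_in (fun m => (m + U)%MM \in msupp p) z &
    supp_in (fun m => (m \in msupp p) && A m) (p - 'X_[U] * z).
Proof.
move=> hp; exists (\sum_(m <- msupp p | (m \in msupp p) && ~~ A m) p@_m *: ('X_[m - U] : P)).
  apply: supp_in_sum => m /andP[mp Am]; apply: supp_inZ; apply: supp_inX.
  by rewrite submK //; have := hp m mp; rewrite (negPf Am).
have pE : p = \sum_(m <- msupp p | (m \in msupp p) && A m) p@_m *: ('X_[m] : P) +
    \sum_(m <- msupp p | (m \in msupp p) && ~~ A m) p@_m *: ('X_[m] : P).
  by rewrite {1}(mpolyE p) big_seq (bigID A).
rewrite mulr_sumr [X in supp_in _ (X - _)]pE -addrA.
apply: supp_inD; first by apply: supp_in_sum => m mA; apply: supp_inZ; exact: supp_inX.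
rewrite [X in X - _](_ : _ = \sum_(m <- msupp p | (m \in msupp p) && ~~ A m)
    'X_[U] * (p@_m *: ('X_[m - U] : P))); first by rewrite subrr; exact: supp_in0.
apply: eq_bigr => m /andP[mp Am]; rewrite -scalerAr -mpolyXD addmC submK //.
by have := hp m mp; rewrite (negPf Am).
Qed.

End Supports.

Section MonomialIdeals.
Variables (k : fieldType) (n d : nat).
Local Notation V := (nvar n d).
Local Notation P := {mpoly k[V]}.
Local Notation word := {ffun 'I_d -> 'I_n.+1}.
Implicit Types (c e : 'I_d -> nat) (T : {set 'I_d}) (u : 'X_{1.. V}).

Local Notation th := (theta k n d : nat -> P).

Definition wmon (f : word) : 'X_{1.. V} := (\sum_a U_(enum_rank (a, f a)))%MM.

Lemma thetaE s : th s = \sum_(f : word | (\sum_a f a)%N == s) 'X_[wmon f].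
Proof. by apply: eq_bigr => f _; rewrite -mprodXE. Qed.

Lemma wmonE f a j : wmon f (enum_rank (a, j)) = (f a == j).
Proof.
rewrite /wmon mnm_sumE (bigD1 a) //= big1 => [|b ba]; rewrite mnm1E.
  by rewrite (inj_eq enum_rank_inj) xpair_eqE eqxx addn0.
by rewrite (inj_eq enum_rank_inj) xpair_eqE (negPf ba).
Qed.

Lemma bdeg_wmon a f : bdeg a (wmon f) = 1%N.
Proof.
rewrite /bdeg (bigD1 (f a)) //= big1 ?addn0 => [|j jf]; rewrite wmonE ?eqxx //.
by rewrite eq_sym (negPf jf).
Qed.

(** Degree m of the Segre product of the twists by - e a of the rows. As e a > 0
    throughout, nothing has degree 0, and A in degree t is degree t + 1 of the
    product for e = 1. *)
Definition shifted e m : P -> Prop := supp_in (fun u => forall a, (bdeg a u + e a)%N = m).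

(** Row a retains the variables x_(a,j) with c a <= j; the others generate cut. *)
Definition killed c u := [exists b : 'I_d * 'I_n.+1, (b.2 < c b.1)%N && (u (enum_rank b) != 0%N)].

Definition cut c : P -> Prop := supp_in (killed c).

(** The first variable that row a retains; cut_prod is cut plus the product of the
    slots of the rows in T. *)
Definition slot c a : 'I_V := enum_rank (a, inord (c a) : 'I_n.+1).

Definition divs c T u := [forall a in T, u (slot c a) != 0%N].

Definition cut_prod c T : P -> Prop := supp_in (fun u => killed c u || divs c T u).

Lemma supp_ideal (B : 'X_{1.. V} -> Prop) : (forall u1 u2, B u2 -> B (u1 + u2)%MM) ->
  ideal_like (supp_in B : P -> Prop).
Proof.
move=> BM; split; [exact: supp_in0|exact: supp_inB|move=> r p].
by apply: (@supp_inM _ _ (fun _ => True)) => // u1 u2 _; exact: BM.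
Qed.

Lemma killedM c u1 u2 : killed c u2 -> killed c (u1 + u2)%MM.
Proof.
move=> /existsP[b /andP[bc ub]]; apply/existsP; exists b; rewrite bc mnmDE.
by rewrite addn_eq0 (negPf ub) andbF.
Qed.

Lemma divsM c T u1 u2 : divs c T u2 -> divs c T (u1 + u2)%MM.
Proof.
move=> /forall_inP h; apply/forall_inP => a aT.
by rewrite mnmDE addn_eq0 negb_and (h a aT) orbT.
Qed.

Lemma cut_ideal_like c : ideal_like (cut c).
Proof. by apply: supp_ideal => u1 u2; exact: killedM. Qed.

Lemma cut_prod_ideal_like c T : ideal_like (cut_prod c T).
Proof.
apply: supp_ideal => u1 u2 /orP[/killedM->//|/divsM->]; exact: orbT.
Qed.

Lemma cut_sub_cut_prod c T p : cut c p -> cut_prod c T p.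
Proof. by apply: supp_in_mono => u ->. Qed.

Lemma shifted_graded e : (forall a, 0 < e a)%N -> graded_like th (shifted e).
Proof.
move=> e0; split=> [m|m p q|m c p|m v p Zp]; [exact: supp_in0|exact: supp_inB| |].
  by rewrite mul_mpolyC; exact: supp_inZ.
rewrite thetaE mulr_suml; apply: supp_in_sum => f _.
apply: (supp_inM (B := fun u => u = wmon f)) Zp; last by exact: supp_inX.
move=> _ u -> hu a; rewrite [bdeg _ _]bdegD bdeg_wmon -addnA hu.
by have := hu a; have := e0 a; case: (m) => //=; lia.
Qed.

(** A word whose letters have the same sum as c but which is not c has a letter
    smaller than c a for some a. So modulo cut the form theta of index sum_a c a is the
    product of the slots of all rows. *)
Lemma theta_lead c : (forall a, c a <= n)%N ->
  cut c (th (\sum_a c a)%N - 'X_[wmon [ffun a => inord (c a)]]).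
Proof.
move=> cn; set f0 := finfun _; rewrite thetaE (bigD1 f0) /=; last first.
  by apply/eqP/eq_bigr => a _; rewrite ffunE inordK // ltnS.
rewrite addrC addrK; apply: supp_in_sum => f /andP[/eqP fs ff0]; apply: supp_inX.
apply/existsP; have [a fa] : exists a, (f a < c a)%N.
  apply/existsP; apply: contraNT ff0; rewrite negb_exists => /forallP hf.
  have cf a : (c a <= f a)%N by rewrite leqNgt; exact: hf.
  have : (\sum_a (f a - c a) = 0)%N.
    apply/eqP; rewrite -(eqn_add2r (\sum_a c a)) add0n -big_split /= -fs.
    by apply/eqP/eq_bigr => a _; rewrite subnK.
  move/eqP; rewrite sum_nat_eq0 => /forallP h; apply/eqP/ffunP => a; apply: val_inj.
  rewrite ffunE /= inordK ?ltnS //; apply/eqP; rewrite eqn_leq cf andbT -subn_eq0.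
  exact: h.
by exists (a, f a); rewrite /= fa wmonE eqxx.
Qed.

(** Modulo cut, theta is a product of variables that cut does not involve. *)
Lemma theta_nzd c q : (forall a, c a <= n)%N -> cut c (th (\sum_a c a)%N * q) -> cut c q.
Proof.
move=> cn hq; set f0 : word := [ffun a => inord (c a)].
have : cut c ('X_[wmon f0] * q).
  have -> : 'X_[wmon f0] * q =
      th (\sum_a c a)%N * q - q * (th (\sum_a c a)%N - 'X_[wmon f0]) by ring.
  apply: (idealB (cut_ideal_like c)) => //; apply: (idealM (cut_ideal_like c)); exact: theta_lead.
move=> h u uq; have /existsP[[a j] /= /andP[jc]] := h _ (@supp_inMX _ _ _ _ _ uq).
rewrite mnmDE wmonE ffunE => uw; apply/existsP; exists (a, j); rewrite /= jc.
suff f0j : (inord (c a) == j) = false by rewrite f0j addn0 in uw.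
by apply: contraTF jc => /eqP <-; rewrite inordK ?ltnn // ltnS.
Qed.

Lemma divs_all c u : divs c setT u = (wmon [ffun a => inord (c a)] <= u)%MM.
Proof.
apply/forall_inP/mnm_lepP => [h i|h a _].
  rewrite -[i]enum_valK; case: (enum_val i) => a j; rewrite wmonE ffunE.
  by case: eqP => // <-; rewrite lt0n; apply: h.
by have := h (slot c a); rewrite wmonE ffunE eqxx lt0n.
Qed.

Lemma theta_cut_prod c q : (forall a, c a <= n)%N -> cut_prod c setT (th (\sum_a c a)%N * q).
Proof.
move=> cn; set f0 : word := [ffun a => inord (c a)].
have -> : th (\sum_a c a)%N * q = q * (th (\sum_a c a)%N - 'X_[wmon f0]) + q * 'X_[wmon f0] by ring.
apply: (idealD (cut_prod_ideal_like c setT)); apply: (idealM (cut_prod_ideal_like c setT)).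
  by apply: cut_sub_cut_prod; exact: theta_lead.
by apply: supp_inX; rewrite divs_all lepm_refl orbT.
Qed.

Lemma cut_prod_theta c e m p : (forall a, c a <= n)%N -> (forall a, 0 < e a)%N ->
  shifted e m p -> cut_prod c setT p ->
  exists2 q, shifted e m.-1 q & cut c (p - th (\sum_a c a)%N * q).
Proof.
move=> cn e0 Zp hp; set f0 : word := [ffun a => inord (c a)].
have [|q hq Jq] := @divide_supp _ _ (killed c) (wmon f0) p.
  by move=> u /hp; rewrite divs_all.
exists q.
  move=> u /hq /Zp h a; have := h a; rewrite [bdeg _ _]bdegD bdeg_wmon => <-.
  by rewrite addn1 addSn.
have -> : p - th (\sum_a c a)%N * q =
  (p - 'X_[wmon f0] * q) - q * (th (\sum_a c a)%N - 'X_[wmon f0]) by ring.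
apply: (idealB (cut_ideal_like c)); first by move=> u /Jq /andP[].
by apply: (idealM (cut_ideal_like c)); exact: theta_lead.
Qed.

Definition bump1 (c : 'I_d -> nat) a : 'I_d -> nat := fun b => (c b + (b == a))%N.

Lemma killed_bump1 c a u : (c a <= n)%N ->
  killed (bump1 c a) u = killed c u || (u (slot c a) != 0%N).
Proof.
move=> can; apply/existsP/orP => [[[b j] /andP[/=]]|[/existsP[b /andP[bc ub]]|ua]].
- rewrite /bump1; case: (b =P a) => [->|_]; last first.
    by rewrite addn0 => jc uj; left; apply/existsP; exists (b, j); rewrite /= jc.
  rewrite addn1 ltnS leq_eqVlt => /orP[/eqP jc uj|jc uj].
    by right; rewrite /slot -jc inord_val.
  by left; apply/existsP; exists (a, j); rewrite /= jc.
- by exists b; rewrite ub andbT /bump1 (leq_trans bc) ?leq_addr.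
by exists (a, inord (c a)); rewrite /= ua inordK ?ltnS // /bump1 eqxx addn1 leqnn.
Qed.

Lemma divsD1 c T a u : a \in T ->
  divs c T u = (u (slot c a) != 0%N) && divs c (T :\ a) u.
Proof.
move=> aT; apply/forall_inP/andP => [h|[ua /forall_inP h] b bT].
  by split; [exact: h|apply/forall_inP => b /setD1P[_ bT]; exact: h].
by have [->//|ba] := eqVneq b a; apply: h; rewrite !inE ba.
Qed.

Lemma slot_inj c a b : (slot c a == slot c b) = (a == b).
Proof.
rewrite (inj_eq enum_rank_inj) xpair_eqE; case: eqP => //= ->; exact: eqxx.
Qed.

Lemma divs_slot c T a u : a \notin T -> divs c T (u + U_(slot c a))%MM = divs c T u.
Proof.
move=> aT; apply: eq_forallb_in => b bT; rewrite mnmDE mnm1E slot_inj.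
by rewrite (_ : (a == b) = false) ?addn0 //; apply: contraNF aT => /eqP ->.
Qed.

Lemma killed_slot c a u : (c a <= n)%N -> killed c (u + U_(slot c a))%MM = killed c u.
Proof.
move=> can; apply: eq_existsb => -[b j] /=; case: ltnP => //= jc.
rewrite mnmDE mnm1E (inj_eq enum_rank_inj) xpair_eqE.
suff -> : (a == b) && (inord (c a) == j) = false by rewrite addn0.
apply: contraTF jc => /andP[/eqP <- /eqP <-].
by rewrite inordK ?ltnS // -leqNgt.
Qed.

End MonomialIdeals.

Section SegreModules.
Variables (k : fieldType) (n d : nat).
Local Notation V := (nvar n d).
Local Notation P := {mpoly k[V]}.
Implicit Types (c e : 'I_d -> nat) (T : {set 'I_d}) (u : 'X_{1.. V}).
Local Notation th := (theta k n d : nat -> P).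
Local Notation shifted := (@shifted k n d).
Local Notation cut := (@cut k n d).
Local Notation cut_prod := (@cut_prod k n d).
Local Notation D := (d * n).+1.
Local Notation tot c := (\sum_a c a)%N.
Local Notation room c := (\sum_a (n - c a))%N.

Lemma bdeg_slot c a b u : bdeg b (u + U_(slot n c a))%MM = (bdeg b u + (b == a))%N.
Proof. by rewrite [LHS]bdegD bdegU. Qed.

Lemma cut_prod1 c a : (c a <= n)%N -> cut_prod c [set a] = cut (bump1 c a).
Proof.
move=> can; have E u : killed c u || divs c [set a] u = killed (bump1 c a) u.
  rewrite killed_bump1 // (@divsD1 _ _ _ _ a) ?set11 // setDv.
  by congr (_ || _); rewrite andbC (_ : divs _ _ _ = true) //; apply/forall_inP => b; rewrite inE.
by apply/funext => p; apply/propext; split; apply: supp_in_mono => u; rewrite E.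
Qed.

(** For a in T, multiplication by the slot of row a gives
    0 -> shifted(e + 1_a) / cut_prod(T - a) -> shifted(e) / cut_prod(T)
      -> shifted(e) / cut(c + 1_a) -> 0. *)
Section Step.
Variables (c e : 'I_d -> nat) (T : {set 'I_d}) (a : 'I_d).
Hypotheses (can : (c a <= n)%N) (e0 : forall a, (0 < e a)%N) (aT : a \in T).
Local Notation x := ('X_(slot n c a) : P).

Let e'0 b : (0 < bump1 e a b)%N.
Proof. by rewrite addn_gt0 e0. Qed.

Let xZ' m p : shifted (bump1 e a) m p -> shifted e m (x * p).
Proof.
move=> hp; apply: (supp_inM (B := fun u => u = U_(slot n c a)%MM)) hp; last exact: supp_inX.
by move=> _ u -> hu b; rewrite addmC bdeg_slot -addnA [(_ + e b)%N]addnC; exact: hu.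
Qed.

Let xI'' m p : shifted (bump1 e a) m p -> cut (bump1 c a) (x * p).
Proof.
move=> _; rewrite mulrC; apply: (idealM (cut_ideal_like k n _)); apply: supp_inX.
by rewrite killed_bump1 // mnm1E eqxx orbT.
Qed.

Let I''P m p : shifted e m p -> cut (bump1 c a) p ->
  exists2 z, shifted (bump1 e a) m z & cut_prod c T (p - x * z).
Proof.
move=> Zp hp; have [|z hz Jz] := @divide_supp _ _ (killed c) U_(slot n c a)%MM p.
  by move=> u /hp; rewrite killed_bump1 // lep1mP.
exists z; last by apply: cut_sub_cut_prod => u /Jz /andP[].
move=> u /hz/Zp h b; have := h b.
by rewrite bdeg_slot /bump1 -addnA [((b == a) + _)%N]addnC.
Qed.

Let xI m p : shifted (bump1 e a) m p -> cut_prod c T (x * p) -> cut_prod c (T :\ a) p.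
Proof.
move=> _ h u up; have := h _ (@supp_inMX _ _ _ _ _ up).
rewrite killed_slot // (divsD1 _ _ aT) divs_slot ?setD11 //.
by case/orP=> [->|/andP[_ ->]]; rewrite ?orbT.
Qed.

Let I'I p : cut_prod c (T :\ a) p -> cut_prod c T (x * p).
Proof.
apply: (supp_inM (B := fun u => u = U_(slot n c a)%MM)); last exact: supp_inX.
move=> _ u -> /orP[/killedM -> //|/divsM h].
by rewrite (divsD1 _ _ aT) h andbT mnmDE mnm1E eqxx orbT.
Qed.

Let II'' p : cut_prod c T p -> cut (bump1 c a) p.
Proof.
apply: supp_in_mono => u; rewrite killed_bump1 //.
by rewrite (divsD1 _ _ aT) => /orP[->|/andP[->]] //; rewrite orbT.
Qed.

Lemma reg_seq_step t : reg_seq D th (shifted (bump1 e a)) (cut_prod c (T :\ a)) t ->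
  reg_seq D th (shifted e) (cut (bump1 c a)) t -> reg_seq D th (shifted e) (cut_prod c T) t.
Proof.
exact: (reg_seq_ext (shifted_graded k n e0) (shifted_graded k n e'0) (cut_prod_ideal_like k n _ _)
  (cut_ideal_like k n _) xZ' xI'' I''P xI I'I II'').
Qed.

Lemma top_rank_step t b m : top_rank D th b (shifted (bump1 e a)) (cut_prod c (T :\ a)) t m ->
  top_rank D th false (shifted e) (cut (bump1 c a)) t m ->
  top_rank D th b (shifted e) (cut_prod c T) t m.
Proof.
exact: (top_rank_ext (shifted_graded k n e0) (cut_prod_ideal_like k n _ _) xZ' I''P I'I).
Qed.

End Step.

(** With n - c a = n_a, the module is the section module of O(m - e a)_a on the
    product of the P^(n_a). The condition prevents any m from having both a row
    with m - e a >= 0 and a row with m - e b < - n_b, the two cases where a row has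
    cohomology; so the intermediate cohomology vanishes. *)
Definition balanced c e := forall a b, a != b -> (e b <= e a + (n - c b))%N.

(** The quotient by th_t, ..., th_(dn) lives in degrees up to
    room c - max_a (n - c a - e a), and is at most a line in that degree when all the
    n - c a - e a are equal. *)
Definition cohen_macaulay (Zm : nat -> P -> Prop) (I : P -> Prop) t e (c : 'I_d -> nat) :=
  [/\ reg_seq D th Zm I t,
      forall m, (exists a, room c + e a < m + (n - c a))%N -> top_rank D th false Zm I t m
    & forall m, (forall a, room c + e a = m + (n - c a))%N -> top_rank D th true Zm I t m].

Lemma cohen_macaulay_first c e : (forall a, c a <= n)%N -> (forall a, 0 < e a)%N ->
  (tot c < D)%N ->
  cohen_macaulay (shifted e) (cut_prod c setT) (tot c).+1 e c ->
  cohen_macaulay (shifted e) (cut c) (tot c) e c.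
Proof.
move=> cn e0 cD [hreg htop hsoc].
have thJT m q : shifted e m q -> cut_prod c setT (th (tot c) * q).
  by move=> _; exact: theta_cut_prod.
have JTP m p : shifted e m p -> cut_prod c setT p ->
    exists2 q, shifted e m.-1 q & cut c (p - th (tot c) * q) by exact: cut_prod_theta.
have nzd m q : shifted e m q -> cut c (th (tot c) * q) -> cut c q by move=> _; exact: theta_nzd.
split.
- exact: (reg_seq_first (shifted_graded k n e0) (cut_prod_ideal_like k n _ _)
    (@cut_sub_cut_prod _ _ _ _ _) thJT JTP nzd).
- by move=> m /htop; exact: (top_rank_first (shifted_graded k n e0) cD JTP).
by move=> m /hsoc; exact: (top_rank_first (shifted_graded k n e0) cD JTP).
Qed.

(** The shift after multiplication by the slots of the rows outside T. *)
Definition raise e T : 'I_d -> nat := fun b => (e b + (b \notin T))%N.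

Lemma bump1_raise e T a : a \in T -> bump1 (raise e T) a = raise e (T :\ a).
Proof.
move=> aT; apply/funext => b; rewrite /bump1 /raise !inE -addnA negb_and negbK.
by congr (_ + _)%N; case: eqP => [->|_]; rewrite ?aT ?addn0.
Qed.

Lemma room_bump1 c a : (c a < n)%N -> room (bump1 c a) = (room c).-1.
Proof.
move=> can; rewrite (bigD1 a) //= [in RHS](bigD1 a) //= /bump1 eqxx.
rewrite (eq_bigr (fun b => n - c b)%N) => [|b /negPf->]; last by rewrite addn0.
by set S := (\sum_(_ | _) _)%N; lia.
Qed.

Lemma tot_bump1 c a : tot (bump1 c a) = (tot c).+1.
Proof.
rewrite big_split /= -addn1; congr (_ + _)%N.
by rewrite (bigD1 a) //= eqxx big1 // => b /negPf ->.
Qed.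

Lemma tot_room c : (forall a, c a <= n)%N -> (tot c + room c = d * n)%N.
Proof.
move=> cn; rewrite -big_split /= (eq_bigr (fun=> n)) => [|a _]; last by rewrite subnKC.
by rewrite sum_nat_const card_ord.
Qed.

(** One variable x_(a,n) is left in each row and all shifts are equal, so the module
    is spanned by the powers of theta_(dn) = prod_a x_(a,n). *)
Lemma cohen_macaulay_base c e : (forall a, c a = n) -> (forall a, 0 < e a)%N ->
  balanced c e -> cohen_macaulay (shifted e) (cut_prod c setT) (tot c).+1 e c.
Proof.
move=> cn e0 bal; have c_le a : (c a <= n)%N by rewrite cn.
have room0 : room c = 0%N by rewrite big1 // => a _; rewrite cn subnn.
have totD : (tot c).+1 = D by have := tot_room c_le; rewrite room0 addn0 => ->.
have ee a b : e a = e b.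
  have [->//|ab] := eqVneq a b; apply/eqP; rewrite eqn_leq.
  have := bal _ _ ab; rewrite eq_sym in ab; have := bal _ _ ab.
  by rewrite !cn subnn !addn0 => -> ->.
have bdegE a u : ~~ killed c u -> bdeg a u = u (slot n c a).
  move=> ku; rewrite /bdeg (bigD1 (inord (c a))) //= big1 ?addn0 // => j jc.
  apply/eqP; apply: contraNT ku => uj; apply/existsP; exists (a, j); rewrite /= uj andbT.
  rewrite cn ltn_neqAle -ltnS ltn_ord andbT; apply: contra jc => /eqP jn.
  by apply/eqP/val_inj; rewrite /= inordK cn.
rewrite totD; split=> [s m p|m [a am]|m em].
- by move=> /andP[Ds sD]; have := leq_ltn_trans Ds sD; rewrite ltnn.
(* A monomial of degree above e involves x_(a,n) for each a. *)
- exists 0; split=> [|//|p Zp]; first exact: supp_in0.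
  exists 0; rewrite mulr0 subr0; apply: span_ideal; first exact: supp_in0.
  move=> u up; have [//|ku] := boolP (killed c u); apply/forall_inP => b _.
  rewrite -bdegE // -lt0n; have := Zp u up b; rewrite (ee b a).
  by move: am; rewrite room0 cn; lia.
exists 1; split=> // [|p Zp].
  by rewrite -mpolyX0; apply: supp_inX => a; have := em a; rewrite bdeg0 room0 cn subnn addn0.
exists p@_0%MM; apply: span_ideal; first exact: supp_in0.
move=> u; have [->|u0] := eqVneq u 0%MM.
  by rewrite mcoeff_msupp mulr1 mcoeffB mcoeffC eqxx mulr1 subrr eqxx.
rewrite mulr1 mcoeff_msupp mcoeffB mcoeffC (negPf u0) mulr0 subr0 -mcoeff_msupp => up.
have [//|ku] := boolP (killed c u); case/eqP: u0; apply/mnmP => i; rewrite mnm0E.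
rewrite -[i]enum_valK; case: (enum_val i) => a j.
have := em a; rewrite room0 cn subnn addn0 -(Zp u up a) => /addIn/esym.
by move=> /eqP; rewrite sum_nat_eq0 => /forallP/(_ j)/eqP.
Qed.

(** The rows are split off the product of the slots in increasing order of key. When
    e b = e a + n_b the module shifted / cut(c + 1_b) is balanced only after e a was
    raised, so a must precede b: this forces the order of the shift e, and at equal
    shifts, that rows with a single variable left come last. *)
Definition key c e a := (2 * e a + (c a == n))%N.

(** Induction on T, by the exact sequence for the row a of least key in T. If row a
    retains several variables then shifted / cut(c + 1_a) is balanced again. If it
    retains only one, then shifted / cut(c + 1_a) = 0: its elements would have degree
    0 in row a, but some other row has a larger shift. When all n - c a - e a are
    equal, only the piece of the last row of T reaches the top degree. *)
Lemma cohen_macaulay_step c e T : (forall a, c a <= n)%N -> (forall a, 0 < e a)%N ->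
  balanced c e -> (exists a, c a < n)%N ->
  (forall a e', (c a < n)%N -> (forall a, 0 < e' a)%N -> balanced (bump1 c a) e' ->
    cohen_macaulay (shifted e') (cut (bump1 c a)) (tot c).+1 e' (bump1 c a)) ->
  T != set0 -> (forall x b, x \notin T -> b \in T -> key c e x <= key c e b)%N ->
  cohen_macaulay (shifted (raise e T)) (cut_prod c T) (tot c).+1 e c.
Proof.
move=> cn e0 bal [z0 cz0] IH; have [N] := ubnP #|T|.
elim: N T => // N IHN T; rewrite ltnS => TN T0 Tup.
have er0 b : (0 < raise e T b)%N by rewrite addn_gt0 e0.
have /set0Pn[b0 b0T] := T0.
have [a aT amin] : exists2 a, a \in T & forall b, b \in T -> (key c e a <= key c e b)%N.
  by case: (arg_minnP (key c e) b0T) => a; exists a.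
move: b0T => _ {b0}.
have [qreg qtop qsoc] : [/\ reg_seq D th (shifted (raise e T)) (cut (bump1 c a)) (tot c).+1,
    forall m, (exists x, room c + e x < m + (n - c x))%N ->
      top_rank D th false (shifted (raise e T)) (cut (bump1 c a)) (tot c).+1 m
  & forall m, (forall x, room c + e x = m + (n - c x))%N ->
      top_rank D th (T :\ a == set0) (shifted (raise e T)) (cut (bump1 c a)) (tot c).+1 m].
  have [can|can] := ltnP (c a) n.
    have ra := room_bump1 can.
    have r0 : (0 < room c)%N by rewrite (bigD1 a) //= addn_gt0 subn_gt0 can.
    have [|hreg htop hsoc] := IH a (raise e T) can er0.
      move=> x b xb; have := bal x b xb; have := cn b; rewrite /raise /bump1.
      have [ba|ba] := eqVneq b a; have [xT|xT] := boolP (x \in T).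
      + by rewrite ba aT /=; have := amin x xT; rewrite /key; lia.
      + by rewrite ba aT /=; lia.
      + have [bT|bT] := boolP (b \in T); first by lia.
        by have := Tup b a bT aT; have := amin x xT; rewrite /key /=; lia.
      + by case: (b \in T) => /=; lia.
    split=> // [m [x xm]|m xm].
      apply: htop; exists x; rewrite ra /raise /bump1.
      move: xm (cn x); have [->|xa] := eqVneq x a; rewrite ?aT /=.
        by move: r0 can; move: (room c) => S; lia.
      by case: (x \in T) => /=; move: r0; move: (room c) => S; lia.
    have [Ta|/set0Pn[y]] := eqVneq (T :\ a) set0.
      apply: hsoc => x; have := xm x; rewrite ra /raise /bump1.
      move: (cn x); have [->|xa] := eqVneq x a; rewrite ?aT /=.
        by move: r0 can; move: (room c) => S; lia.
      suff -> : (x \in T) = false by rewrite /=; move: r0; move: (room c) => S; lia.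
      by apply: contraFF (in_set0 x) => xT; rewrite -Ta !inE xa xT.
    rewrite !inE => /andP[ya yT]; apply: htop; exists y.
    by have := xm y; rewrite ra /raise /bump1 (negPf ya) yT /=; move: r0; move: (room c) => S; lia.
  have ca : c a = n by apply/eqP; rewrite eqn_leq cn can.
  have [b eb] : exists b, (raise e T a < raise e T b)%N.
    rewrite /raise aT /=; have [TT|] := eqVneq T setT.
      exists z0; have := amin z0; rewrite TT !inE /key => /(_ isT).
      by rewrite ca eqxx (ltn_eqF cz0) /=; lia.
    rewrite -subTset => /subsetPn[b _ bT]; exists b.
    have ba : b != a by apply: contraNneq bT => ->.
    by have := bal b a ba; rewrite ca subnn bT /=; lia.
  have ZJ m p : shifted (raise e T) m p -> cut (bump1 c a) p.
    move=> Zp u up; apply: contraT => ku; have := Zp u up a.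
    suff -> : bdeg a u = 0%N by move=> am; have := Zp u up b; lia.
    rewrite /bdeg big1 // => j _; apply/eqP; apply: contraNT ku => uj.
    apply/existsP; exists (a, j); rewrite /= uj andbT /bump1 ca eqxx addn1.
    exact: ltn_ord.
  have Zg := shifted_graded k n er0.
  split=> [|m _|m _]; first exact: (reg_seq_trivial Zg ZJ).
    by apply: top_rank_trivial.
  by apply: top_rankW; apply: top_rank_trivial.
have [Ta|Ta] := eqVneq (T :\ a) set0.
  have -> : cut_prod c T = cut (bump1 c a).
    rewrite -cut_prod1 //; congr (cut_prod c _); apply/setP => x; rewrite inE.
    have [->|xa] := eqVneq x a; first by rewrite aT.
    by apply: contraFF (in_set0 x) => xT; rewrite -Ta !inE xa xT.
  by split=> // m /qsoc; rewrite Ta eqxx.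
have [||hreg htop hsoc] := IHN (T :\ a) _ Ta.
- by rewrite (cardsD1 a T) aT in TN.
- move=> x b; rewrite !inE negb_and negbK => /orP[/eqP->|xT] /andP[_ bT].
    exact: amin.
  exact: Tup.
rewrite -(bump1_raise _ aT) in hreg htop hsoc.
split=> [|m xm|m xm].
- exact: reg_seq_step hreg qreg.
- exact: top_rank_step (htop m xm) (qtop m xm).
by apply: top_rank_step (hsoc m xm) _ => //; have := qsoc m xm; rewrite (negPf Ta).
Qed.

(** Division by theta_t, which is the product of the slots modulo cut, leads to the
    modules with one variable fewer in one row. *)
Theorem segre_cohen_macaulay c e : (forall a, c a <= n)%N -> (forall a, 0 < e a)%N ->
  balanced c e -> cohen_macaulay (shifted e) (cut c) (tot c) e c.
Proof.
have [h] := ubnP (room c); elim: h c e => // h IH c e; rewrite ltnS => ch cn e0 bal.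
have cD : (tot c < D)%N by rewrite ltnS -(tot_room cn) leq_addr.
apply: cohen_macaulay_first => //.
have [cn'|] := boolP [forall a, c a == n]; last rewrite negb_forall => /existsP[z cz].
  by apply: cohen_macaulay_base => // a; apply/eqP; exact: forallP cn' a.
have raiseT : raise e setT = e by apply/funext => a; rewrite /raise inE addn0.
rewrite -[X in shifted X]raiseT; apply: cohen_macaulay_step => //.
- by exists z; rewrite ltn_neqAle cn cz.
- move=> a e' can e'0 bal'; rewrite -(tot_bump1 c a); apply: IH => //.
  + by rewrite room_bump1 // -ltnS prednK // (bigD1 a) //= addn_gt0 subn_gt0 can.
  + by move=> b; rewrite /bump1; case: eqP => [->|_]; rewrite ?addn1 ?addn0.
- by apply/set0Pn; exists z; rewrite inE.
by move=> x b; rewrite inE.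
Qed.

End SegreModules.

(** * The residue of an element of top degree *)

Section Alternation.
Variables (k : fieldType) (W : nat).
Hypothesis k_char0 : [pchar k] =i pred0.
Local Notation Q := {mpoly k[W]}.

Definition alt (p : Q) : Q := \sum_(s : 'S_W) (-1) ^+ odd_perm s *: msym s p.

Lemma alt_linear : linear alt.
Proof.
move=> c p q; rewrite /alt scaler_sumr -big_split; apply: eq_bigr => s _.
by rewrite msymD msymZ scalerDr !scalerA mulrC.
Qed.

HB.instance Definition _ := GRing.isLinear.Build k Q Q _ alt alt_linear.

Lemma alt_msym s p : alt (msym s p) = (-1) ^+ odd_perm s *: alt p.
Proof.
rewrite /alt scaler_sumr [RHS](reindex (fun t => s * t)%g); last first.
  by apply: onW_bij; exists (fun t => s^-1 * t)%g => t; rewrite ?mulKg ?mulKVg.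
apply: eq_bigr => t _; rewrite scalerA odd_permM signr_addb mulrA -expr2 sqrr_sign mul1r.
by rewrite msymMm.
Qed.

Lemma alt_symM e p : (forall s, msym s e = e) -> alt (e * p) = e * alt p.
Proof.
move=> he; rewrite /alt mulr_sumr; apply: eq_bigr => s _.
by rewrite msymM he scalerAr.
Qed.

Lemma msymXU s w : msym s ('X_w : Q) = 'X_(s w).
Proof.
rewrite msymX; congr 'X_[_]; apply/mnmP => j; rewrite mnmE !mnm1E.
by rewrite -(inj_eq (@perm_inj _ s)) permKV.
Qed.

Lemma alt_repeated (m : 'X_{1..W}) i j : i != j -> m i = m j -> alt 'X_[m] = 0.
Proof.
move=> ij mij; have : alt 'X_[m] = - alt 'X_[m].
  rewrite -{1}(_ : msym (tperm i j) 'X_[m] = 'X_[m]).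
    by rewrite alt_msym odd_tperm ij expr1 scaleN1r.
  rewrite msymX; congr 'X_[_]; apply/mnmP => l; rewrite mnmE tpermV.
  by case: tpermP => [->|->|].
move/eqP; rewrite -addr_eq0 -mulr2n -scaler_nat scaler_eq0 => /orP[|/eqP //].
by have /pcharf0P -> := k_char0.
Qed.

Lemma alt_coef_uniq (m : 'X_{1..W}) : injective m -> (alt 'X_[m])@_m = 1.
Proof.
move=> m_inj; rewrite /alt linear_sum (bigD1 1%g) //= big1 => [|s s1].
  by rewrite odd_perm1 expr0 scale1r msym1m mcoeffX eqxx addr0.
rewrite mcoeffZ msymX mcoeffX; case: eqP => [ms|_]; last by rewrite mulr0.
case/eqP: s1; apply/permP => i; rewrite perm1; apply: m_inj.
by rewrite -{1}ms mnmE permK.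
Qed.

Definition vdeg (B : 'I_W -> nat) : Q -> Prop := supp_in (fun m => forall w, m w <= B w)%N.

Lemma vdegM B C p q : vdeg B p -> vdeg C q -> vdeg (fun w => B w + C w)%N (p * q).
Proof.
by apply: supp_inM => m1 m2 h1 h2 w; rewrite mnmDE leq_add.
Qed.

Lemma vdegW B C p : (forall w, B w <= C w)%N -> vdeg B p -> vdeg C p.
Proof. by move=> BC; apply: supp_in_mono => m h w; apply: leq_trans (BC w). Qed.

Lemma vdeg_one : vdeg (fun _ => 0%N) 1.
Proof. by rewrite -mpolyX0; apply: supp_inX => w; rewrite mnm0E. Qed.

Lemma vdeg_exp B p m : vdeg B p -> vdeg (fun w => B w * m)%N (p ^+ m).
Proof.
move=> hp; elim: m => [|m IH]; first by apply: vdegW vdeg_one => w; rewrite muln0.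
by rewrite exprS; apply: vdegW (vdegM hp IH) => w; rewrite mulnS.
Qed.

Lemma vdeg_prod I (r : seq I) (B : I -> 'I_W -> nat) (F : I -> Q) :
  (forall i, vdeg (B i) (F i)) -> vdeg (fun w => \sum_(i <- r) B i w)%N (\prod_(i <- r) F i).
Proof.
move=> hF; elim: r => [|i r IH].
  by rewrite big_nil; apply: vdegW vdeg_one => w.
by rewrite big_cons; apply: vdegW (vdegM (hF i) IH) => w; rewrite big_cons.
Qed.

(** Pigeonhole: W exponents at most b, with b + 1 < W, cannot be distinct. *)
Lemma alt_small b p : vdeg (fun _ => b) p -> (b.+1 < W)%N -> alt p = 0.
Proof.
move=> hp bW; rewrite (mpolyE p) linear_sum big_seq big1 // => m mp.
rewrite linearZ; pose f (w : 'I_W) : 'I_b.+1 := inord (m w).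
have /injectivePn[i [j ij fij]] : ~~ injectiveb f.
  by apply: contraTN bW => /injectiveP/leq_card; rewrite !card_ord -leqNgt.
rewrite /= (alt_repeated ij) ?scaler0 //.
by have /(congr1 val) := fij; rewrite /= !inordK // ltnS; exact: hp.
Qed.

End Alternation.

Section Residue.
Variables (k : fieldType) (n d : nat).
Hypotheses (k_char0 : [pchar k] =i pred0) (d_gt0 : (0 < d)%N).
Local Notation V := (nvar n d).
Local Notation P := {mpoly k[V]}.
Local Notation W := #|{: 'I_d * 'I_n}|.
Local Notation Q := {mpoly k[W]}.
Local Notation th := (theta k n d : nat -> P).

Definition root_index (a : 'I_d) (i : 'I_n) : 'I_W := enum_rank (a, i).

(** The rows are viewed as n-fold products of linear polynomials: x_(a,j) becomes the
    j-th elementary symmetric function of the n roots of row a. *)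
Definition factor (a : 'I_d) : {poly Q} := \prod_(i < n) (1 + 'X_(root_index a i) *: 'X).

Definition to_roots (p : P) : Q :=
  p \mPo [tuple (factor (enum_val v).1)`_(enum_val v).2 | v < V].

Lemma to_roots_xvar a j : to_roots (xvar k a j) = (factor a)`_j.
Proof. by rewrite /to_roots /xvar comp_mpolyXU -tnth_nth tnth_mktuple enum_rankK. Qed.

Lemma size_prod_linear (A : nzRingType) (I : Type) (r : seq I) (F : I -> A) :
  (size (\prod_(i <- r) (1 + F i *: 'X))%R <= (size r).+1)%N.
Proof.
elim: r => [|i r IH]; first by rewrite big_nil size_poly1.
rewrite big_cons /=; apply: leq_trans (size_polyMleq _ _) _.
have : (size (1 + F i *: 'X : {poly A})%R <= 2)%N.
  apply: leq_trans (size_polyD _ _) _; rewrite size_poly1 geq_max /=.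
  by apply: leq_trans (size_scale_leq _ _) _; rewrite size_polyX.
by move=> h; rewrite -subn1 leq_subLR; apply: leq_trans (leq_add h IH) _.
Qed.

Lemma lead_prod_linear (A : comNzRingType) (I : Type) (r : seq I) (F : I -> A) :
  (\prod_(i <- r) (1 + F i *: 'X))`_(size r) = \prod_(i <- r) F i.
Proof.
elim: r => [|i r IH]; first by rewrite !big_nil coefC eqxx.
rewrite !big_cons mulrDl mul1r coefD /= nth_default ?size_prod_linear // add0r.
by rewrite -scalerAl coefZ coefXM /= IH.
Qed.

Lemma size_factor a : (size (factor a) <= n.+1)%N.
Proof.
by rewrite /factor -big_enum (leq_trans (size_prod_linear _ _)) ?size_enum_ord.
Qed.

Lemma factor_lead a : (factor a)`_n = \prod_i 'X_(root_index a i).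
Proof.
have := lead_prod_linear (enum 'I_n) (fun i => 'X_(root_index a i) : Q).
by rewrite !big_enum size_enum_ord.
Qed.

Lemma factor_const a : (factor a)`_0 = 1.
Proof.
rewrite -horner_coef0 /factor horner_prod big1 // => i _.
by rewrite hornerD hornerC hornerZ hornerX mulr0 addr0.
Qed.

Lemma to_roots_theta s : to_roots (th s) = (\prod_a factor a)`_s.
Proof.
transitivity (\sum_(f : {ffun 'I_d -> 'I_n.+1} | (\sum_a f a)%N == s) \prod_a (factor a)`_(f a)).
  rewrite /to_roots /theta linear_sum; apply: eq_bigr => f _.
  by rewrite rmorph_prod; apply: eq_bigr => a _; exact: to_roots_xvar.
have factorE a : factor a = \sum_(j < n.+1) (factor a)`_j *: 'X^j.
  rewrite -poly_def; apply/polyP => i; rewrite coef_poly; case: ltnP => // ni.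
  by rewrite nth_default // (leq_trans (size_factor a)).
rewrite [in RHS](eq_bigr _ (fun a _ => factorE a)) bigA_distr_bigA /= coef_sum.
rewrite [RHS](bigID (fun f : {ffun 'I_d -> 'I_n.+1} => (\sum_a f a)%N == s)) /=.
rewrite [X in _ + X]big1 ?addr0 => [|f fs].
  apply: eq_bigr => f /eqP fs; rewrite scaler_prod coefZ.
  by rewrite prodrXr coefXn fs eqxx mulr1.
by rewrite scaler_prod coefZ prodrXr coefXn eq_sym (negPf fs) mulr0.
Qed.

Lemma all_factors : \prod_a factor a = \prod_(w < W) (1 + ('X_w : Q) *: 'X).
Proof.
rewrite /factor pair_big /= [RHS](reindex enum_rank) /=; last first.
  exact: onW_bij (enum_rank_bij _).
by apply: eq_bigr => -[a i].
Qed.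

(** The theta's are the coefficients of the product of all rows, hence symmetric in
    all the roots. *)
Lemma to_roots_theta_sym s (t : 'S_W) : msym t (to_roots (th s)) = to_roots (th s).
Proof.
rewrite !to_roots_theta all_factors.
rewrite -[LHS](coef_map (msym t)) rmorph_prod; congr ((polyseq _)`_s).
rewrite [RHS](reindex t) /=; last exact: onW_bij (injF_bij (@perm_inj _ t)).
apply: eq_bigr => w _.
by rewrite rmorphD rmorph1 /= map_polyZ map_polyX; congr (_ + _ *: _); exact: msymXU.
Qed.

Local Notation row w := (enum_val (w : 'I_W)).1.

Lemma vdeg_factor a j : vdeg (fun w => row w == a) (factor a)`_j.
Proof.
have h (r : seq 'I_n) : forall j, vdeg (fun w => \sum_(i <- r) (w == root_index a i))%N
    (\prod_(i <- r) (1 + ('X_(root_index a i) : Q) *: 'X))`_j.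
  elim: r => [|i r IH] {}j.
    rewrite big_nil coefC; case: ifP => _; last exact: supp_in0.
    by apply: vdegW (@vdeg_one _ _) => w.
  rewrite !big_cons coefM; apply: supp_in_sum => l _.
  apply: vdegW (vdegM (B := fun w => (w == root_index a i) : nat) _ (IH (j - l)%N)).
    by move=> w; rewrite big_cons.
  rewrite coefD coefZ coefX coefC; apply: supp_inD.
    case: ifP => _; last exact: supp_in0.
    by apply: vdegW (@vdeg_one _ _).
  case: eqP => _; rewrite ?mulr0 ?mulr1; last exact: supp_in0.
  by apply: supp_inX => w; rewrite mnm1E eq_sym.
apply: vdegW (h (index_enum 'I_n) j) => w; rewrite /root_index.
have [wa|wa] := eqVneq (row w) a; last first.
  rewrite big1 // => i _; apply/eqP; rewrite eqb0; apply: contra wa => /eqP ->.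
  by rewrite enum_rankK.
rewrite (bigD1 (enum_val w).2) //= big1 ?addn0 ?leq_b1 // => i iw.
apply/eqP; rewrite eqb0; apply: contra iw => /eqP ->.
by rewrite enum_rankK.
Qed.

(** The coefficients of factor a have degree 1 in each root of row a, so the degree in
    a root is at most the degree in its row. *)
Lemma vdeg_to_roots b (p : P) : supp_in (fun u => forall a, bdeg a u <= b)%N p ->
  vdeg (fun _ => b) (to_roots p).
Proof.
move=> hp; rewrite /to_roots comp_mpolyE big_seq; apply: supp_in_sum => u up; apply: supp_inZ.
pose B (v : 'I_V) (w : 'I_W) := ((row w == (enum_val v).1) * u v)%N.
have hB : vdeg (fun w => \sum_(v < V) B v w)%N
    (\prod_(v < V) tnth [tuple (factor (enum_val v).1)`_(enum_val v).2 | v < V] v ^+ u v).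
  by apply: vdeg_prod => v; rewrite tnth_mktuple; apply: vdeg_exp; exact: vdeg_factor.
apply: vdegW hB => w.
apply: leq_trans (hp u up (row w)); rewrite /B /bdeg.
rewrite (reindex (@enum_rank ('I_d * 'I_n.+1)%type)) /=; last exact: onW_bij (enum_rank_bij _).
under eq_bigr => x _ do rewrite enum_rankK.
rewrite (eq_bigr (fun x => (row w == x.1) * u (enum_rank (x.1, x.2)))%N); last by case.
rewrite -(pair_bigA _ (fun b j => (row w == b) * u (enum_rank (b, j)))%N) /=.
rewrite (bigD1 (row w)) //= eqxx [X in (_ + X)%N]big1 ?addn0 => [|a aw].
  by apply: leq_sum => j _; rewrite mul1n.
by rewrite big1 // => j _; rewrite eq_sym (negPf aw).
Qed.

(** Multiplying by z^eps and alternating over each row amounts to multiplying by the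
    Vandermonde determinants of the rows. In degree (d - 1) n the alternating sum is
    then a multiple of the Vandermonde determinant of all the roots; residue is that
    multiple, read off at the monomial staircase. *)
Definition eps : 'X_{1..W} := [multinom nat_of_ord (enum_val w).2 | w < W].

Definition staircase : 'X_{1..W} := [multinom (row w * n + (enum_val w).2)%N | w < W].

Definition residue (p : P) : k := (alt (to_roots p * 'X_[eps]))@_staircase.

Lemma residueB p q : residue (p - q) = residue p - residue q.
Proof. by rewrite /residue /to_roots comp_mpolyB mulrBl linearB mcoeffB. Qed.

Lemma residueC c p : residue (c%:MP * p) = c * residue p.
Proof. by rewrite /residue mul_mpolyC /to_roots linearZ /= -scalerAl linearZ mcoeffZ. Qed.

Lemma residue_sum I (r : seq I) (B : pred I) (F : I -> P) :
  residue (\sum_(i <- r | B i) F i) = \sum_(i <- r | B i) residue (F i).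
Proof.
have r0 : residue 0 = 0 by rewrite -(subrr 0) residueB subrr.
apply: big_morph => // p q; rewrite -{1}[q]opprK -[- q]sub0r !residueB r0.
by rewrite sub0r opprK.
Qed.

Lemma card_roots : W = (d * n)%N.
Proof. by rewrite card_prod !card_ord. Qed.

(** theta_s is symmetric, and what remains has all exponents at most
    (d - 1) n - 1 + (n - 1) = dn - 2, too small for an alternating polynomial. *)
Lemma residue_theta s (q : P) :
  supp_in (fun u => forall a, bdeg a u + 1 = (d - 1) * n)%N q -> residue (th s * q) = 0.
Proof.
move=> hq; rewrite /residue /to_roots rmorphM /= -mulrA alt_symM; last exact: to_roots_theta_sym.
have [r0|r0] := posnP ((d - 1) * n).
  suff -> : q = 0 by rewrite comp_mpoly0 mul0r linear0 mulr0 mcoeff0.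
  apply/eqP; rewrite -msupp_eq0; apply/eqP; case E : (msupp q) => [//|u l].
  have uq : u \in msupp q by rewrite E mem_head.
  by have := hq u uq (Ordinal d_gt0); rewrite r0 addn1.
have n0 : (0 < n)%N by move: r0; rewrite muln_gt0 => /andP[].
have dn : (d * n = (d - 1) * n + n)%N by rewrite mulnBl mul1n subnK // leq_pmull.
rewrite (@alt_small _ _ k_char0 (((d - 1) * n).-1 + n.-1)) ?mulr0 ?mcoeff0 //; last first.
  by rewrite card_roots dn; lia.
apply: vdegM.
  by apply: vdeg_to_roots => u uq a; have := hq u uq a; lia.
by apply: supp_inX => w; rewrite mnmE -ltnS prednK.
Qed.

(* In the roots, corner times z^eps is the monomial staircase. *)
Definition corner : P :=
  \prod_(a < d) (xvar k a ord_max ^+ (a * n) * xvar k a ord0 ^+ ((d - 1 - a) * n)).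

Lemma to_roots_corner : to_roots corner * 'X_[eps] = 'X_[staircase].
Proof.
rewrite !mpolyXE_id {1}/to_roots rmorph_prod /=.
rewrite (eq_bigr (fun a : 'I_d => \prod_(i < n) 'X_(root_index a i) ^+ (a * n))); last first.
  move=> a _; rewrite rmorphM !rmorphXn /= -!/(to_roots _) !to_roots_xvar factor_const expr1n.
  by rewrite mulr1 factor_lead prodrXl.
rewrite pair_big [X in _ * X](reindex enum_rank) /=; last exact: onW_bij (enum_rank_bij _).
rewrite [RHS](reindex enum_rank) /=; last exact: onW_bij (enum_rank_bij _).
rewrite -big_split; apply: eq_bigr => -[a i] _ /=.
by rewrite -exprD !mnmE enum_rankK.
Qed.

Lemma staircase_inj : injective staircase.
Proof.
move=> w1 w2; rewrite !mnmE => E; apply: enum_val_inj.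
case: (enum_val w1) (enum_val w2) E => a i [b j] /= E.
have n0 : (0 < n)%N by exact: leq_ltn_trans (leq0n i) (ltn_ord i).
have ab : a = b.
  apply: val_inj; have := congr1 (fun x => x %/ n)%N E.
  by rewrite !divnMDl // !divn_small // !addn0.
by move: E; rewrite ab => /addnI/val_inj ->.
Qed.

Lemma residue_corner : residue corner = 1.
Proof. by rewrite /residue to_roots_corner alt_coef_uniq //; exact: staircase_inj. Qed.

Lemma bdegMn a (u : 'X_{1.. V}) m : bdeg a (u *+ m)%MM = (bdeg a u * m)%N.
Proof. by rewrite /bdeg big_distrl; apply: eq_bigr => j _; rewrite mulmnE. Qed.

Lemma corner_deg : supp_in (fun u => forall a, bdeg a u = (d - 1) * n)%N corner.
Proof.
rewrite /corner /xvar; under eq_bigr => a _ do rewrite !mpolyXn -mpolyXD.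
rewrite mprodXE; apply: supp_inX => b.
rewrite (big_morph _ (bdegD b) (@bdeg0 n d b)) (bigD1 b) //= big1 => [|a ab].
  rewrite addn0 bdegD !bdegMn !bdegU eqxx !mul1n -mulnDl; congr (_ * _)%N.
  by have := ltn_ord b; lia.
by rewrite bdegD !bdegMn !bdegU eq_sym (negPf ab).
Qed.

(** The effect on the roots of exchanging rows a and b: n transpositions, which is
    where the parity of n comes from. *)
Definition block_tperm a b : 'S_W :=
  (\prod_(i <- enum 'I_n) tperm (root_index a i) (root_index b i))%g.

Lemma root_index_eq x y j l : (root_index x j == root_index y l) = (x == y) && (j == l).
Proof. by rewrite (inj_eq enum_rank_inj) xpair_eqE. Qed.

Lemma tperm_root_index a b c i j :
  tperm (root_index a j) (root_index b j) (root_index c i) =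
  if i == j then root_index (tperm a b c) i else root_index c i.
Proof.
have [->|ij] := eqVneq i j; last by rewrite tpermD // root_index_eq [j == i]eq_sym (negPf ij) andbF.
case: (tpermP a b c) => [->|->|/eqP ca /eqP cb]; rewrite ?tpermL ?tpermR //.
by rewrite tpermD // root_index_eq eqxx andbT eq_sym.
Qed.

Lemma block_tpermE a b c i : block_tperm a b (root_index c i) = root_index (tperm a b c) i.
Proof.
suff h (r : seq 'I_n) : uniq r -> forall c,
    (\prod_(j <- r) tperm (root_index a j) (root_index b j))%g (root_index c i) =
    if i \in r then root_index (tperm a b c) i else root_index c i.
  by rewrite /block_tperm h ?enum_uniq // mem_enum.
elim: r => [_|j r IH /andP[jr ur]] {}c; first by rewrite big_nil perm1.
rewrite big_cons permM inE tperm_root_index; have [ij|ij] := eqVneq i j; last exact: IH.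
by rewrite IH // ij (negPf jr).
Qed.

Lemma odd_block_tperm a b : a != b -> odd_perm (block_tperm a b) = odd n.
Proof.
move=> ab; rewrite /block_tperm -[in RHS](size_enum_ord n).
elim: (enum 'I_n) => [|i r IH]; first by rewrite big_nil odd_perm1.
rewrite big_cons odd_permM odd_tperm IH /= (inj_eq enum_rank_inj) xpair_eqE (negPf ab).
by rewrite andFb.
Qed.

Lemma to_roots_tperm a b (p : P) :
  to_roots (perm_act (tperm a b) p) = msym (block_tperm a b) (to_roots p).
Proof.
rewrite /perm_act [p \mPo _]comp_mpolyE [to_roots p]comp_mpolyE /to_roots !linear_sum.
apply: eq_bigr => u _; rewrite !linearZ /=; congr (_ *: _).
rewrite !rmorph_prod; apply: eq_bigr => v _; rewrite !rmorphXn; congr (_ ^+ _).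
rewrite !tnth_mktuple [LHS]to_roots_xvar -[RHS](coef_map (msym _)); congr ((polyseq _)`_ _).
rewrite /factor rmorph_prod; apply: eq_bigr => i _.
rewrite rmorphD rmorph1 /= map_polyZ map_polyX; congr (_ + _ *: _).
by rewrite /= msymXU block_tpermE.
Qed.

Lemma msym_eps a b : msym (block_tperm a b) ('X_[eps] : Q) = 'X_[eps].
Proof.
rewrite {1}mpolyXE_id rmorph_prod [RHS](@mpolyXE _ _ (block_tperm a b)).
apply: eq_bigr => w _; rewrite rmorphXn /= msymXU; congr (_ ^+ _).
by rewrite -[w]enum_valK; case: (enum_val w) => c i; rewrite !mnmE block_tpermE !enum_rankK.
Qed.

Lemma residue_tperm a b (p : P) : a != b ->
  residue (perm_act (tperm a b) p) = (-1) ^+ n * residue p.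
Proof.
move=> ab; rewrite /residue to_roots_tperm -{1}(msym_eps a b) -msymM alt_msym mcoeffZ.
by rewrite odd_block_tperm //; congr (_ * _); exact: signr_odd.
Qed.

End Residue.

(** * The regularity of direct summands of powers of A *)

Section RegularityBounds.
Variables (k : fieldType) (N : nat) (M : gradedModule k N).

(** A set of integers that is bounded above is empty or has a maximum; so reg cannot
    be +oo. *)
Lemma reg_le (r : nat) : (forall i j, tor_neq0 M i j -> (j <= i + r)%N) ->
  (reg M <= r%:Z%:E)%E.
Proof.
move=> Mr; have val_le s : reg_val M s -> s <= r%:Z.
  by move=> [i [j [/Mr jir js]]]; rewrite -(lerD2l i%:Z) -js -PoszD lez_nat.
rewrite /reg; case: pselect => [H|nomax].
  by rewrite lee_fin; apply/val_le/(proj1 (projT2 (cid H))).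
case: asboolP => [[s0 s0v]|_]; last exact: leNye.
have climb m : exists2 s, reg_val M s & s0 + m%:Z <= s.
  elim: m => [|m [s sv ms]]; first by exists s0; rewrite ?addr0.
  apply: contra_notP nomax => nos; exists s; split=> // t tv.
  rewrite leNgt; apply/negP => st; apply: nos; exists t => //.
  by rewrite -addn1 PoszD addrA; apply: le_trans (_ : s + 1 <= t); rewrite ?lerD2r ?lezD1.
have [s sv] := climb (`|r%:Z - s0|.+1)%N.
have := val_le s sv; move: (val_le s0 s0v) => h1 h2 h3; lia.
Qed.

Lemma reg_eq (r : nat) i : (forall i j, tor_neq0 M i j -> (j <= i + r)%N) ->
  tor_neq0 M i (i + r) -> reg M = r%:Z%:E.
Proof.
move=> Mr Mi; have rv : reg_val M r%:Z by exists i, (i + r)%N; rewrite PoszD.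
have val_le s : reg_val M s -> s <= r%:Z.
  by move=> [i' [j [/Mr jir js]]]; rewrite -(lerD2l i'%:Z) -js -PoszD lez_nat.
rewrite /reg; case: pselect => [H|nomax]; last by case: nomax; exists r%:Z.
congr (_%:E); case: (cid H) => s [sv smax] /=.
by apply/eqP; rewrite eq_le val_le // smax.
Qed.

End RegularityBounds.

(** M is a direct summand of a power of A, so that regularity of l and membership in
    l M can be tested in A. *)
Section Retracts.
Variables (R : comNzRingType) (l : nat -> R) (I : finType) (M A : lmodType R).
Variables (iota : I -> M -> A) (rho : I -> A -> M).
Hypothesis iota_lin : forall i, linear (iota i).
Hypothesis rho_lin : forall i, linear (rho i).
Hypothesis rhoK : forall x, \sum_i rho i (iota i x) = x.

Lemma combo_lin (V W : lmodType R) (f : V -> W) t x : linear f -> combo l t x -> combo l t (f x).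
Proof.
move=> fl [q ->]; exists (f \o q).
have fD u v : f (u + v) = f u + f v by rewrite -[u]scale1r fl !scale1r.
have f0 : f 0 = 0 by apply: (addrI (f 0)); rewrite -fD !addr0.
rewrite (big_morph f fD f0); apply: eq_bigr => s _.
by rewrite -[_ *: _]addr0 fl f0 addr0.
Qed.

Lemma retract_combo t x : (forall i, combo l t (iota i x)) -> combo l t x.
Proof.
move=> hx; rewrite -[x]rhoK; apply: (big_ind (combo l t)); first exact: combo0.
  exact: comboD.
by move=> i _; apply: combo_lin.
Qed.

Lemma retract_regular t : regular_at l A t -> regular_at l M t.
Proof.
move=> hA x hx; apply: retract_combo => i; apply: hA.
have <- : iota i (l t *: x) = l t *: iota i x.
  have i0 : iota i 0 = 0.
    by have := iota_lin i (-1) 0 0; rewrite scaler0 addr0 scaleN1r addNr.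
  by rewrite -[l t *: x]addr0 iota_lin i0 addr0.
exact: combo_lin.
Qed.

End Retracts.

Section Segre.
Variables (k : fieldType) (n d : nat).
Hypotheses (k_char0 : [pchar k] =i pred0) (d_gt0 : (0 < d)%N).
Local Notation V := (nvar n d).
Local Notation P := {mpoly k[V]}.
Local Notation D := (d * n).+1.
Local Notation th := (theta k n d : nat -> P).
Local Notation A := (A_mod k n d_gt0).
Local Notation l := (lform k n d).
Local Notation r := ((d - 1) * n)%N.
Local Notation mf := (bdeg (Ordinal d_gt0)).

Let ones : 'I_d -> nat := fun _ => 1%N.
Let none : 'I_d -> nat := fun _ => 0%N.

Lemma segre_pc_shifted t (p : P) : (p \in @segre_pc k n d t) <-> shifted ones t.+1 p.
Proof.
split=> [/segre_pcP hp u up a|hp].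
  by rewrite /ones addn1; congr _.+1; exact: dhomog_mf (hp a) _ up.
apply/segre_pcP => a; apply/dhomogP => u up.
by have /eqP := hp u up a; rewrite /ones addn1 eqSS => /eqP.
Qed.

Lemma shifted_segre t (p : P) : shifted ones t p -> p \in @segre k n d.
Proof.
by move=> hp; apply/segreP => u up a b; apply/eqP; rewrite -(eqn_add2r 1) !(hp u up).
Qed.

Lemma cut_none (p : P) : cut none p -> p = 0.
Proof.
move=> hp; apply/eqP; rewrite -msupp_eq0; apply/eqP; case E : (msupp p) => [//|u s].
have up : u \in msupp p by rewrite E mem_head.
by have /existsP[b] := hp u up; rewrite ltn0.
Qed.

(** A is the balanced case where no variable is missing and all shifts are equal. *)
Lemma segre_cm : cohen_macaulay (@shifted k n d ones) (@cut k n d none) 0 ones none.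
Proof.
have := @segre_cohen_macaulay k n d none ones.
by rewrite big1 //; apply=> // a b _; rewrite leq_addr.
Qed.

Lemma room_none : (\sum_(a < d) (n - none a))%N = (d * n)%N.
Proof. by rewrite (eq_bigr (fun=> n)) => [|a _]; rewrite ?sum_nat_const ?card_ord ?subn0. Qed.

Lemma theta_homog s : th s \is 1.-homog for mf.
Proof.
apply/dhomogP => u; rewrite thetaE => /msupp_sum_le/flatten_mapP[f _].
by rewrite msuppX inE => /eqP ->; exact: bdeg_wmon.
Qed.

(** In the homogeneous part of a combination of the theta's the coefficients are
    homogeneous of one degree less. *)
Lemma theta_combo_homog t (q : nat -> P) m : (forall s, q s \in @segre k n d) ->
  exists2 q' : nat -> P, forall s, shifted ones m (q' s) &
    pihomog mf m (\sum_(s < t) th s * q s) = \sum_(s < t) th s * q' s.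
Proof.
move=> qA; exists (fun s => if m is m'.+1 then pihomog mf m' (q s) else 0) => [s|].
  case: m => [|m]; first exact: supp_in0.
  by apply/segre_pc_shifted; exact: pi_pc.
rewrite linear_sum; apply: eq_bigr => s _.
rewrite /= (pihomogM _ _ (theta_homog s)); case: m => [|m]; first by rewrite mulr0.
by rewrite subn1.
Qed.

Lemma span_none m t p : span_mod th (cut none) (shifted ones m) 0 t p ->
  exists2 q : nat -> P, forall s, shifted ones m (q s) & p = \sum_(s < t) th s * q s.
Proof.
by move=> [i [q [/cut_none -> Zq ->]]]; exists q; rewrite ?add0r ?big_mkord.
Qed.

Lemma segre_regular t (p : P) (q : nat -> P) : (t < D)%N -> p \in @segre k n d ->
  (forall s, q s \in @segre k n d) -> th t * p = \sum_(s < t) th s * q s ->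
  exists2 q' : nat -> P, forall s, q' s \in @segre k n d & p = \sum_(s < t) th s * q' s.
Proof.
move=> tD pA qA pE; have [hreg _ _] := segre_cm.
have /choice[q' q'P] : forall m, exists q' : nat -> P, (forall s, q' s \in @segre k n d) /\
    pihomog mf m p = \sum_(s < t) th s * q' s.
  move=> m; have [q1 Zq1 q1E] := theta_combo_homog t m.+1 qA.
  have Zp : shifted ones m.+1 (pihomog mf m p) by apply/segre_pc_shifted; exact: pi_pc.
  have [] := span_none (hreg t m.+1 (pihomog mf m p) _ Zp _); first by rewrite tD.
    exists 0, q1; split=> //; first exact: supp_in0.
    by rewrite add0r big_mkord -q1E -pE (pihomogM _ _ (theta_homog t)) subn1.
  by move=> q2 Zq2 ->; exists q2; split=> // s; exact: shifted_segre (Zq2 s).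
rewrite {1}(pihomog_partitionE (leqnn (mmeasure mf p))).
exists (fun s => \sum_(m < mmeasure mf p) q' m s) => [s|].
  apply: (big_ind (fun x : symtens k n d => x \in @segre k n d)).
  - by apply/segreP => u; rewrite msupp0.
  - exact: segreD.
  by move=> m _; have [] := q'P m.
rewrite (eq_bigr (fun m : 'I_(mmeasure mf p) => \sum_(s < t) th s * q' m s)).
  by rewrite exchange_big; apply: eq_bigr => s _; rewrite mulr_sumr.
by move=> m _; have [] := q'P m.
Qed.

Lemma val_lform s (x : A) : (s < D)%N -> val (l s *: x) = th s * val x.
Proof. by move=> sD; rewrite /= lformE // symtens_scaleE symsym_map_Theta. Qed.

Lemma combo_segre t (x : A) : (t <= D)%N -> combo l t x <->
  exists2 q : nat -> P, forall s, q s \in @segre k n d & val x = \sum_(s < t) th s * q s.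
Proof.
move=> tD; split=> [[q ->]|[q qA xE]].
  exists (fun s => val (q s)) => [s|]; first exact: (valP (q s)).
  rewrite raddf_sum; apply: eq_bigr => s _.
  by apply: val_lform; exact: leq_trans (ltn_ord s) tD.
exists (fun s => Submodule (qA s : q s \in sub_pred (segre_submod k n d))).
apply: val_inj; rewrite raddf_sum xE; apply: eq_bigr => s _.
by apply/esym/val_lform; exact: leq_trans (ltn_ord s) tD.
Qed.

Lemma A_regular t : (t < D)%N -> regular_at l A t.
Proof.
move=> tD x /(combo_segre _ (ltnW tD))[q qA]; rewrite val_lform // => xE.
by apply/(combo_segre _ (ltnW tD)); apply: segre_regular tD (valP x) qA xE.
Qed.

Lemma theta_top j (p : P) : (r < j)%N -> shifted ones j.+1 p ->
  exists2 q : nat -> P, forall s, shifted ones j (q s) & p = \sum_(s < D) th s * q s.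
Proof.
move=> rj Zp; have [_ htop _] := segre_cm.
have [|p1 [_ /(_ isT) -> /(_ _ Zp)[c]]] := htop j.+1.
  exists (Ordinal d_gt0); rewrite room_none /ones /none subn0.
  by rewrite -[d in (d * n)%N](subnK d_gt0) mulnDl mul1n; lia.
by rewrite mulr0 subr0 => /span_none.
Qed.

Lemma A_top j (x : A) : (r < j)%N -> x \in gm_pc j -> combo l D x.
Proof.
rewrite inE /= => rj /segre_pc_shifted/(theta_top rj)[q Zq xE].
by apply/combo_segre => //; exists q => // s; exact: shifted_segre (Zq s).
Qed.

Lemma perm_act_comp s t (p : symtens k n d) :
  perm_act s (perm_act t p) = perm_act (t * s)%g p.
Proof.
rewrite [perm_act t p]comp_mpolyE [RHS]comp_mpolyE perm_act_sum.
apply: eq_bigr => u _; rewrite -!mul_mpolyC [LHS]perm_actM perm_actC; congr (_ * _).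
rewrite [LHS]rmorph_prod; apply: eq_bigr => v _; rewrite [LHS]rmorphXn; congr (_ ^+ _).
by rewrite !tnth_mktuple permM; exact: perm_act_xvar.
Qed.

Local Notation order := (#|{: 'S_d}|%:R : k).

Lemma order_neq0 : order != 0.
Proof.
have /pcharf0P -> := k_char0; rewrite -lt0n; apply/card_gt0P.
by exists 1%g.
Qed.

Lemma perm_act_segre s (p : symtens k n d) : p \in @segre k n d -> perm_act s p \in @segre k n d.
Proof.
move=> /(segre_span d_gt0)[T [c [cP ->]]]; rewrite perm_act_sum.
apply: (big_ind (fun x : symtens k n d => x \in @segre k n d)).
- by apply/segreP => u; rewrite msupp0.
- exact: segreD.
by move=> t _; apply: segre_pc_segre (perm_act_pc s (cP t)).
Qed.

Lemma segre_sum I (r : seq I) (B : pred I) (F : I -> symtens k n d) :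
  (forall i, B i -> F i \in @segre k n d) -> \sum_(i <- r | B i) F i \in @segre k n d.
Proof.
move=> hF; apply: (big_ind (fun x : symtens k n d => x \in @segre k n d)) => //.
  by apply/segreP => u; rewrite msupp0.
exact: segreD.
Qed.

Lemma segreC (c : k) (p : symtens k n d) : p \in @segre k n d -> c%:MP * p \in @segre k n d.
Proof. by move=> hp; apply: segreM hp; apply: segre_pc_segre (segre_pcC _ _ c). Qed.

Section Hom.
Variables (e : nat) (X : mx_representation k [set: 'S_d]%G e).
Local Notation H := (Hom_mod n d_gt0 X).

Lemma homs_segre (f : {ffun 'I_e -> symtens k n d}) i : f \in homs X -> f i \in @segre k n d.
Proof. by rewrite homsE => /andP[/forallP]. Qed.

Definition Hom_coord (i : 'I_e) (f : H) : A :=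
  Submodule (homs_segre i (valP f) : _ \in sub_pred (segre_submod k n d)).

(** The linear map V -> A that sends the i-th basis vector to p and the others to 0,
    averaged over S_d to make it equivariant. *)
Definition reynolds_fun (i : 'I_e) (p : symtens k n d) : {ffun 'I_e -> symtens k n d} :=
  [ffun j => \sum_(s : 'S_d) (order^-1 * X (s^-1)%g j i)%:MP * perm_act s p].

Lemma reynolds_funP i p : p \in @segre k n d -> reynolds_fun i p \in homs X.
Proof.
move=> hp; rewrite homsE; apply/andP; split.
  by apply/forallP => j; rewrite ffunE; apply: segre_sum => s _; exact/segreC/perm_act_segre.
apply/forallP => t; apply/forallP => j; apply/eqP; rewrite ffunE perm_act_sum.
transitivity (\sum_(s : 'S_d) \sum_l (X t j l)%:MP *
    ((order^-1 * X (s^-1)%g l i)%:MP * perm_act s p)); last first.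
  by rewrite exchange_big; apply: eq_bigr => l _; rewrite ffunE mulr_sumr.
rewrite [RHS](reindex (fun s => s * t)%g) /=; last first.
  by apply: onW_bij; exists (fun s => s * t^-1)%g => s; rewrite ?mulgK ?mulgKV.
apply: eq_bigr => s _; rewrite perm_actM perm_actC perm_act_comp.
under [RHS]eq_bigr => l _ do rewrite mulrA -rmorphM /= mulrCA.
rewrite -mulr_suml -rmorph_sum /= -mulr_sumr; congr (_%:MP * _); congr (_ * _).
have -> : (s^-1 = t * (s * t)^-1)%g by rewrite invMg mulKVg.
by rewrite repr_mxM ?inE // mxE.
Qed.

Definition Hom_proj (i : 'I_e) (p : A) : H :=
  Submodule (reynolds_funP i (valP p) : _ \in sub_pred (homs_submod n X)).

Lemma Hom_coord_linear i : linear (Hom_coord i).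
Proof. by move=> r x y; apply: val_inj; rewrite /= !ffunE. Qed.

Lemma Hom_proj_linear i : linear (Hom_proj i).
Proof.
move=> r x y; apply: val_inj; apply/ffunP => j; rewrite /= !ffunE scaler_sumr -big_split.
apply: eq_bigr => s _; rewrite /= perm_actD perm_actZ mulrDr; congr (_ + _).
by rewrite !symtens_scaleE mulrCA.
Qed.

Lemma Hom_projK f : \sum_i Hom_proj i (Hom_coord i f) = f.
Proof.
apply: val_inj; rewrite raddf_sum; apply/ffunP => j; rewrite sum_ffunE /=.
have /forallP fE : equivariant X (val f) by have := valP f; rewrite /sub_pred homsE => /andP[].
transitivity (\sum_(s : 'S_d) order^-1%:MP * val f j); last first.
  rewrite -mulr_suml sumr_const -rmorphMn /= -mulr_natr mulVf ?order_neq0 //.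
  by rewrite rmorph1 mul1r.
under eq_bigr => i _ do rewrite ffunE.
rewrite exchange_big; apply: eq_bigr => s _ /=.
transitivity (\sum_i \sum_l (order^-1 * X (s^-1)%g j i * X s i l)%:MP * val f l).
  apply: eq_bigr => i _; have /forallP/(_ i)/eqP -> := fE s.
  by rewrite mulr_sumr; apply: eq_bigr => l _; rewrite mulrA -rmorphM.
rewrite exchange_big (eq_bigr (fun l => (order^-1 * (l == j)%:R)%:MP * val f l)) /=.
  rewrite (bigD1 j) //= eqxx mulr1 big1 ?addr0 // => l /negPf ->.
  by rewrite mulr0 rmorph0 mul0r.
move=> l _; rewrite -mulr_suml -rmorph_sum /=; congr (_%:MP * _).
rewrite (eq_bigr (fun i => order^-1 * (X (s^-1)%g j i * X s i l))); last first.
  by move=> i _; rewrite mulrA.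
rewrite -mulr_sumr; congr (_ * _).
have := repr_mxM X (in_setT s^-1%g) (in_setT s); rewrite mulVg repr_mx1.
by move=> /matrixP/(_ j l); rewrite !mxE eq_sym => <-.
Qed.

Lemma Hom_regular t : (t < D)%N -> regular_at l H t.
Proof.
move=> tD; apply: (retract_regular Hom_coord_linear Hom_proj_linear Hom_projK).
exact: A_regular.
Qed.

Lemma Hom_top j (x : H) : (r < j)%N -> x \in gm_pc j -> combo l D x.
Proof.
move=> rj xj; apply: (retract_combo Hom_proj_linear Hom_projK) => i.
apply: A_top rj _; move: xj; rewrite !inE /=.
by move=> /andP[/forallP/(_ i)].
Qed.

End Hom.

Local Notation B := (B_mod k n d_gt0).

Definition average (p : symtens k n d) : symtens k n d :=
  \sum_(s : 'S_d) order^-1%:MP * perm_act s p.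

Lemma average_inv s p : perm_act s (average p) = average p.
Proof.
rewrite /average perm_act_sum [RHS](reindex (fun t => t * s)%g) /=; last first.
  by apply: onW_bij; exists (fun t => t * s^-1)%g => t; rewrite ?mulgK ?mulgKV.
by apply: eq_bigr => t _; rewrite perm_actM perm_actC perm_act_comp.
Qed.

Lemma average_pc t p : p \in @segre_pc k n d t -> average p \in @invariants_pc k n d t.
Proof.
move=> hp; rewrite invariants_pcE; apply/andP; split; last first.
  by apply/forallP => s; rewrite average_inv.
apply: segre_pc_sum => s _; rewrite -[t]add0n; apply: segre_pcM (segre_pcC _ _ _) _.
exact: perm_act_pc.
Qed.

Lemma average_invariant p : p \in @segre k n d -> average p \in @invariants k n d.
Proof.
move=> hp; rewrite invariantsE; apply/andP; split; last first.
  by apply/forallP => s; rewrite average_inv.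
by apply: segre_sum => s _; apply/segreC/perm_act_segre.
Qed.

Lemma average_id p : p \in @invariants k n d -> average p = p.
Proof.
rewrite invariantsE => /andP[_ /forallP ip]; rewrite /average.
rewrite (eq_bigr (fun=> order^-1%:MP * p)) => [|s _]; last by rewrite (eqP (ip s)).
by rewrite -mulr_suml sumr_const -rmorphMn /= -mulr_natr mulVf ?order_neq0 // rmorph1 mul1r.
Qed.

Lemma invariants_segre p : p \in @invariants k n d -> p \in @segre k n d.
Proof. by rewrite invariantsE => /andP[]. Qed.

Definition B_incl (_ : unit) (x : B) : A :=
  Submodule (invariants_segre (valP x) : _ \in sub_pred (segre_submod k n d)).

Definition B_proj (_ : unit) (x : A) : B :=
  Submodule (average_invariant (valP x) : _ \in sub_pred (invariants_submod k n d)).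

Lemma B_incl_linear u : linear (B_incl u).
Proof. by move=> r x y; apply: val_inj. Qed.

Lemma B_proj_linear u : linear (B_proj u).
Proof.
move=> r x y; apply: val_inj; rewrite /= /average scaler_sumr -big_split.
apply: eq_bigr => s _; rewrite /= perm_actD perm_actZ mulrDr; congr (_ + _).
by rewrite !symtens_scaleE mulrCA.
Qed.

Lemma B_projK x : \sum_u B_proj u (B_incl u x) = x.
Proof.
rewrite (big_pred1 tt) => [|[]] //; apply: val_inj; exact: average_id (valP x).
Qed.

Lemma B_regular t : (t < D)%N -> regular_at l B t.
Proof.
move=> tD; apply: (retract_regular B_incl_linear B_proj_linear B_projK).
exact: A_regular.
Qed.

Lemma B_combo (x : B) : combo l D (B_incl tt x) -> combo l D x.
Proof. by move=> h; apply: (retract_combo B_proj_linear B_projK) => -[]. Qed.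

Lemma B_incl_pc j (x : B) : x \in gm_pc j -> B_incl tt x \in gm_pc j.
Proof. by rewrite !inE /= => /andP[]. Qed.

Lemma B_top j (x : B) : (r < j)%N -> x \in gm_pc j -> combo l D x.
Proof. by move=> rj /B_incl_pc xj; apply/B_combo/(A_top rj). Qed.

End Segre.

(** * Computation of the regularities *)

Section Final.
Variables (k : fieldType) (n d : nat).
Hypotheses (k_char0 : [pchar k] =i pred0) (d_gt0 : (0 < d)%N).
Local Notation V := (nvar n d).
Local Notation N := (nmon n d).
Local Notation P := {mpoly k[V]}.
Local Notation R := {mpoly k[N]}.
Local Notation D := (d * n).+1.
Local Notation th := (theta k n d : nat -> P).
Local Notation A := (A_mod k n d_gt0).
Local Notation B := (B_mod k n d_gt0).
Local Notation l := (lform k n d).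
Local Notation r := ((d - 1) * n)%N.
Local Notation mf := (bdeg (Ordinal d_gt0)).
Local Notation ones := (fun _ : 'I_d => 1%N).

Local Notation c := (N - D)%N.

(* theta, followed by c other linear forms, is a basis of the linear forms of R. *)
Let DcN : (D + c = N)%N.
Proof. by rewrite subnKC // D_le_N. Qed.

Let l_reg t : (t < D + c)%N -> regular_at l R^o t.
Proof. by rewrite DcN; exact: lform_reg. Qed.

Let l_max (p : R) : p@_0%MM = 0 -> combo l (D + c) (p : R^o).
Proof. by rewrite DcN; exact: lform_max. Qed.

Lemma tor_le r' (M : gradedModule k N) : (forall t, (t < D)%N -> regular_at l M t) ->
  (forall j (x : M), (r' < j)%N -> x \in gm_pc j -> combo l D x) ->
  forall i j, tor_neq0 M i j -> (j <= i + r')%N.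
Proof.
move=> M_reg M_top i j [F [v [vj vc vb]]]; rewrite leqNgt; apply/negP => ij; apply: vb.
exact: (tor_above (@lform_homog k n d) l_reg l_max M_reg M_top vj vc ij).
Qed.

Definition generated (M : gradedModule k N) := exists b (a : 'I_b -> nat) (g : 'I_b -> M),
  (forall i, g i \in gm_pc (a i)) /\ forall x, exists v, x = gen g v.

(** By hypothesis r is the top degree of M / theta M, and so the corner
    Tor_c(M, k)_(c + r) does not vanish. *)
Lemma reg_exact (M : gradedModule k N) (x : M) : (forall t, (t < D)%N -> regular_at l M t) ->
  (forall j (x : M), (r < j)%N -> x \in gm_pc j -> combo l D x) ->
  generated M -> x \in gm_pc r -> ~ combo l D x -> reg M = r%:Z%:E.
Proof.
move=> M_reg M_top [b [a [g [gh gsurj]]]] xr xD.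
have [F _] := resolution_exists gh gsurj.
apply: (@reg_eq _ _ _ _ c); first exact: tor_le M_reg M_top.
exact: (tor_corner (@lform_homog k n d) l_reg l_max F M_reg M_top xr xD).
Qed.

Lemma mdeg_bdeg (u : 'X_{1.. V}) : mdeg u = (\sum_a bdeg a u)%N.
Proof.
rewrite mdegE (reindex (@enum_rank ('I_d * 'I_n.+1)%type)) /=; last first.
  exact: onW_bij (enum_rank_bij _).
rewrite (eq_bigr (fun x => u (enum_rank (x.1, x.2)))) => [|[a j] //].
by rewrite -(pair_bigA _ (fun a j => u (enum_rank (a, j)))).
Qed.

(** The monomials of degree at most r generate A, since in larger degrees A = theta A. *)
Lemma A_generated : generated A.
Proof.
pose idx := ('X_{1..V < (d * r).+1})%type.
have /choice[g gP] : forall u : idx, exists x : A, x \in gm_pc (mf u) /\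
    ('X_[u : 'X_{1..V}] \in @segre k n d -> val x = 'X_[u : 'X_{1..V}] :> P).
  move=> u.
  have [uA|uA] := boolP (('X_[u : 'X_{1..V}] : symtens k n d) \in @segre k n d); last first.
    by exists 0; split=> //; have [] := @gm_pc_zmod _ _ A (mf u).
  exists (Submodule (uA : _ \in sub_pred (segre_submod k n d))); split=> //.
  rewrite inE /=; apply/segre_pcP => a; rewrite dhomogX; apply/eqP.
  have uu : (u : 'X_{1..V}) \in msupp ('X_[u : 'X_{1..V}] : P) by rewrite msuppX inE.
  exact: (segreP _ uA _ uu).
pose gg (i : 'I_#|{: idx}|) := g (enum_val i).
pose S (x : A) := exists v, x = gen gg v.
have SD x y : S x -> S y -> S (x + y).
  by move=> [v ->] [w ->]; exists (v + w); rewrite genD.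
have S0 : S 0 by exists 0; rewrite gen0.
have SZ f x : S x -> S (f *: x) by move=> [v ->]; exists (f *: v); rewrite genZ.
have Sh m x : x \in gm_pc m -> S x.
  elim/ltn_ind: m x => m IH x; rewrite inE /= => xm.
  have [rm|mr] := ltnP r m.
    have /segre_pc_shifted/(theta_top d_gt0 rm)[q Zq xE] := xm.
    case: m => // m in IH xm rm Zq *.
    have qA s : q s \in @segre_pc k n d m by apply/segre_pc_shifted; exact: Zq.
    pose y s : A := Submodule (segre_pc_segre (qA s) : _ \in sub_pred (segre_submod k n d)).
    have -> : x = \sum_(s < D) l s *: y s.
      apply: val_inj; rewrite raddf_sum [LHS]xE; apply: eq_bigr => s _.
      by apply/esym/val_lform.
    by apply: (big_ind S) => // s _; apply: SZ; apply: (IH m) => //; rewrite inE; exact: qA.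
  exists (\row_i ((val x : P)@_(enum_val i : idx))%:MP); apply: val_inj.
  have xd : (msize (val x : P) <= (d * r).+1)%N.
    rewrite msizeE; apply/bigmax_leqP_seq => u ux _; rewrite ltnS mdeg_bdeg.
    rewrite (eq_bigr (fun=> m)) => [|a _]; last exact: dhomog_mf (segre_pcP _ _ xm a) _ ux.
    by rewrite sum_nat_const card_ord leq_mul2l mr orbT.
  rewrite [LHS](mpolywE xd) raddf_sum (reindex (@enum_val idx predT)) /=; last first.
    exact: onW_bij (enum_val_bij _).
  apply: eq_bigr => i _; rewrite mxE /gg; set u : idx := enum_val i.
  transitivity (symsym_map (((val x : P)@_u)%:MP : R) * val (g u)); last by [].
  rewrite [symsym_map _]comp_mpolyC.
  have [u0|ux] := eqVneq (val x : P)@_u 0; first by rewrite u0 scale0r mul0r.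
  rewrite -mcoeff_msupp in ux; rewrite -mul_mpolyC; congr (_ * _); apply/esym.
  have [_ ->//] := gP u; apply: (segre_pc_segre (t := m)); apply/segre_pcP => a.
  by rewrite dhomogX; apply/eqP; exact: dhomog_mf (segre_pcP _ _ xm a) _ ux.
exists #|{: idx}|, (fun i => mf (enum_val i : idx)), gg; split=> [i|x].
  by have [] := gP (enum_val i).
have [T [y [yP ->]]] := gm_span x.
by apply: (big_ind S) => // t _; exact: Sh (yP t).
Qed.

Lemma lin_gen (M M' : gradedModule k N) (f : M -> M') b (g : 'I_b -> M) v :
  linear f -> f (gen g v) = gen (f \o g) v.
Proof.
move=> fl; have fD x y : f (x + y) = f x + f y by rewrite -[x]scale1r fl !scale1r.
have f0 : f 0 = 0 by apply: (addrI (f 0)); rewrite -fD !addr0.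
rewrite /gen (big_morph f fD f0); apply: eq_bigr => i _.
by rewrite -[_ *: _]addr0 fl f0 addr0.
Qed.

Lemma B_generated : generated B.
Proof.
have [b [a [g [gh gsurj]]]] := A_generated.
exists b, a, (fun i => B_proj tt (g i)); split=> [i|x].
  by have := gh i; rewrite !inE /= => /average_pc; rewrite invariants_pcE.
have [v xE] := gsurj (B_incl tt x); exists v.
have := B_projK k_char0 x; rewrite (big_pred1 tt) => [<-|[]] //.
by rewrite xE (lin_gen _ _ (@B_proj_linear _ _ _ _ tt)).
Qed.

Lemma perm_act1 (p : symtens k n d) : perm_act 1%g p = p.
Proof.
rewrite /perm_act -[RHS]comp_mpoly_id; congr (_ \mPo _).
by apply: eq_from_tnth => v; rewrite !tnth_mktuple perm1 /xvar -surjective_pairing enum_valK.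
Qed.

Lemma residue_even s (p : P) : ~~ odd n -> residue (perm_act s p : P) = residue p.
Proof.
move=> ne; have [ts -> /allP h] := prod_tpermP s.
elim: ts p h => [|[a b] ts IH] p h; first by rewrite big_nil perm_act1.
rewrite big_cons -perm_act_comp IH => [|t tts]; last by apply: h; rewrite inE tts orbT.
have /= ab := h (a, b) (mem_head _ _).
by rewrite residue_tperm // -signr_odd (negPf ne) expr0 mul1r.
Qed.

Lemma residue_not_combo (x : A) : x \in gm_pc r -> residue (val x : P) != 0 -> ~ combo l D x.
Proof.
rewrite inE /= => xr x0 /(combo_segre k_char0)[//|q qA xE]; case/eqP: x0.
have [q' Zq' q'E] := theta_combo_homog d_gt0 D r qA.
have /segre_pcP/(_ (Ordinal d_gt0))/pihomog_dE := xr; rewrite {1}xE q'E => <-.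
rewrite residue_sum big1 // => s _; apply: residue_theta => //; exact: Zq'.
Qed.

Lemma corner_segre : (corner k n d : symtens k n d) \in @segre_pc k n d r.
Proof.
apply/segre_pcP => a; apply/dhomogP => u up; exact: corner_deg up a.
Qed.

Lemma reg_A : reg A = r%:Z%:E.
Proof.
pose x : A := Submodule (segre_pc_segre corner_segre : _ \in sub_pred (segre_submod k n d)).
have xr : x \in gm_pc r by rewrite inE /=; exact: corner_segre.
apply: reg_exact A_generated (xr) _.
- by move=> t; exact: A_regular.
- by move=> j y; exact: A_top.
apply: residue_not_combo; first exact: xr.
by rewrite [residue _]residue_corner // oner_eq0.
Qed.

Lemma residue_average (p : P) : ~~ odd n -> residue (average p : P) = residue p.
Proof.
move=> ne; rewrite /average residue_sum (eq_bigr (fun=> (#|{: 'S_d}|%:R : k)^-1 * residue p)).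
  rewrite sumr_const -[LHS]mulr_natr mulrAC mulVf ?mul1r //; exact: (order_neq0 d k_char0).
by move=> s _; rewrite residueC residue_even.
Qed.

Lemma reg_B_even : ~~ odd n -> reg B = r%:Z%:E.
Proof.
move=> ne; pose x : B :=
  Submodule (average_invariant d_gt0 (segre_pc_segre corner_segre)
    : _ \in sub_pred (invariants_submod k n d)).
have xr : x \in gm_pc r by rewrite inE /=; apply: average_pc; exact: corner_segre.
apply: reg_exact B_generated (xr) _.
- by move=> t; exact: B_regular.
- by move=> j y; exact: B_top.
move=> h; apply: (@residue_not_combo (B_incl tt x)).
- exact: B_incl_pc.
- by rewrite [residue _]residue_average // residue_corner // oner_eq0.
by apply: combo_lin h; exact: B_incl_linear.
Qed.

(** In degree r the quotient A / theta A is at most a line, and it is detected by the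
    residue since the residue of corner is not 0. An invariant x has residue
    (-1)^n times itself, that is 0 for n odd; so x lies in theta A. *)
Lemma B_top_odd (x : B) : odd n -> (1 < d)%N -> x \in gm_pc r -> combo l D x.
Proof.
move=> no d1; rewrite inE /= => /andP[/segre_pc_shifted Zx /forallP xinv].
have [_ _ hsoc] := segre_cm k n d.
have [|p1 [_ _ h]] := hsoc r.+1.
  move=> a; rewrite room_none subn0.
  by rewrite -[d in (d * n)%N](subnK d_gt0) mulnDl mul1n; lia.
have res0 (q : nat -> P) : (forall s, shifted ones r (q s)) ->
    residue (\sum_(s < D) th s * q s) = 0.
  by move=> Zq; rewrite residue_sum big1 // => s _; apply: residue_theta => //; exact: Zq.
have [c1 /span_none[q1 Zq1 q1E]] := h _ (proj1 (segre_pc_shifted _ _) corner_segre).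
have p1_neq0 : residue p1 != 0.
  have := residueB (corner k n d) (c1%:MP * p1); rewrite q1E res0 // residue_corner //.
  move/esym/eqP; rewrite subr_eq0 residueC => /eqP E.
  by apply: contra_eq_neq E => ->; rewrite mulr0 oner_eq0.
have resx : residue (val x : P) = 0.
  have ab : Ordinal d_gt0 != Ordinal d1 by [].
  have := residue_tperm (val x : P) ab.
  rewrite (eqP (xinv _)) -signr_odd no expr1 mulN1r => /eqP.
  rewrite -addr_eq0 -mulr2n -mulr_natr mulf_eq0 => /orP[/eqP //|].
  by have /pcharf0P -> := k_char0.
have [c2 /span_none[q2 Zq2 q2E]] := h _ Zx.
have c20 : c2 = 0.
  have := residueB (val x : P) (c2%:MP * p1); rewrite q2E res0 // resx residueC sub0r.
  by move/esym/eqP; rewrite oppr_eq0 mulf_eq0 (negPf p1_neq0) orbF => /eqP.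
apply: B_combo => //; apply/combo_segre => //.
exists q2 => [s|]; first exact: shifted_segre (Zq2 s).
by rewrite -q2E c20 mul0r subr0.
Qed.

Lemma reg_B_odd : odd n -> (1 < d)%N -> (reg B < r%:Z%:E)%E.
Proof.
move=> no d1; have r0 : (0 < r)%N by rewrite muln_gt0 subn_gt0 d1 odd_gt0.
apply: (@le_lt_trans _ _ ((r.-1)%:Z%:E)); last by rewrite lte_fin ltz_nat; lia.
apply: reg_le; apply: tor_le => [t|j x rj xj]; first exact: B_regular.
have [rj'|rj'] := ltnP r j; first exact: B_top xj.
have jr : j = r by lia.
by apply: B_top_odd => //; rewrite -jr.
Qed.

Lemma reg_Hom e (X : mx_representation k [set: 'S_d]%G e) :
  (reg (Hom_mod n d_gt0 X) <= r%:Z%:E)%E.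
Proof.
apply: reg_le; apply: tor_le => [t|j x]; first exact: Hom_regular.
exact: Hom_top.
Qed.

End Final.

Theorem theorem3p9 (k : closedFieldType) (k_char0 : [pchar k] =i pred0)
    (n d : nat) (d_gt0 : (0 < d)%N) :
  [/\ reg (A_mod k n d_gt0) = (((d - 1) * n)%N%:Z)%:E,
      forall lam : seq nat, is_partition d lam ->
        (reg (M_mod k n d_gt0 lam) <= (((d - 1) * n)%N%:Z)%:E)%E,
      ~~ odd n -> reg (B_mod k n d_gt0) = reg (A_mod k n d_gt0)
    & odd n -> (1 < d)%N ->
        (reg (B_mod k n d_gt0) < reg (A_mod k n d_gt0))%E].
Proof.
split.
- exact: reg_A.
- by move=> lam _; exact: reg_Hom.
- by move=> ne; rewrite reg_A // reg_B_even.
- by move=> no d1; rewrite reg_A //; exact: reg_B_odd.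
Qed.
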